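(* Let $A$ be a unital $C^*$-algebra and let $X\subset A$ be such that $\operatorname{span}(X)$ is dense in $A$. Let $d,N\in\mathbf N$. Suppose that for every finite $\mathcal F\subset X$ and every $\varepsilon>0$ there exist $C^*$-subalgebras $B_0,\dots,B_d$ of $A$, each of nuclear dimension at most $N$, and elements $b_0,\dots,b_d\in A$ of norm at most $1$ such that $b_i\mathcal Fb_i^*\subset B_i$ for $0\le i\le d$ and $$\max_{x\in\mathcal F}\Big\|x-\sum_{i=0}^d b_ixb_i^*\Big\|<\varepsilon.$$ Then the nuclear dimension of $A$ is at most $(d+1)(N+1)-1$.
   Context: $\mathbf N=\{0,1,2,\dots\}$. A $C^*$-algebra $A$ has nuclear dimension at most $n\in\mathbf N$ if for every finite $\mathcal F\subset A$ and $\varepsilon>0$ there are a finite-dimensional $C^*$-algebra $F=\bigoplus_{j=0}^nF_j$, a completely positive contractive map $\psi:A\to F$ and a completely positive map $\phi:F\to A$ such that each $\phi|_{F_j}$ is contractive and order zero (i.e. positive $a,b$ with $ab=0$ have images with product $0$) and $\|\phi(\psi(a))-a\|<\varepsilon$ for all $a\in\mathcal F$. The $C^*$-subalgebras $B_i$ need not be unital or contain the unit of $A$. Here $b_i\mathcal Fb_i^*=\{b_ixb_i^*:x\in\mathcal F\}$. *)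

(* Defs.v *)
From HB Require Import structures.
From mathcomp Require Import all_boot all_order all_algebra.
From mathcomp Require Import complex.
From mathcomp Require Import all_classical all_reals all_analysis.

Set Implicit Arguments.
Unset Strict Implicit.
Unset Printing Implicit Defensive.

Import Order.TTheory GRing.Theory Num.Theory.
Import numFieldNormedType.Exports.

Local Open Scope classical_set_scope.
Local Open Scope ring_scope.

(* C*-algebras over the complex numbers R[i], with or without a unit.  The product
   is a new operation, since the ring structures of the library all have a unit. *)
HB.mixin Record isCStarAlgebra (R : realType) A
    of CompleteNormedModule R[i] A := {
  cmul : A -> A -> A;
  cmulA : associative cmul;
  cmulDl : left_distributive cmul +%R;
  cmulDr : right_distributive cmul +%R;
  cmulZl : forall (c : R[i]) (x y : A), cmul (c *: x) y = c *: cmul x y;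
  cmulZr : forall (c : R[i]) (x y : A), cmul x (c *: y) = c *: cmul x y;
  star : A -> A;
  starK : involutive star;
  starD : {morph star : x y / x + y};
  starZ : forall (c : R[i]) (x : A), star (c *: x) = conjc c *: star x;
  starM : forall x y : A, star (cmul x y) = cmul (star y) (star x);
  norm_cmul : forall x y : A, `|cmul x y| <= `|x| * `|y|;
  cstar_identity : forall x : A, `|cmul (star x) x| = `|x| ^+ 2
}.

#[short(type="cstarAlgType")]
HB.structure Definition CStarAlgebra (R : realType) :=
  {A of CompleteNormedModule R[i] A & isCStarAlgebra R A}.

Notation "x ** y" := (cmul x y) (at level 40, left associativity) : ring_scope.

Definition linear_span (K : pzRingType) (V : lmodType K) (X : set V) : set V :=
  [set y | exists n (c : 'I_n -> K) (x : 'I_n -> V),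
      (forall i, X (x i)) /\ y = \sum_(i < n) c i *: x i].

Section Subalgebras.
Variables (R : realType) (A : cstarAlgType R).

(* The zero algebra counts as unital. *)
Definition is_unital : Prop :=
  exists u : A, forall x, u ** x = x /\ x ** u = x.

Definition is_cstar_subalgebra (B : set A) : Prop :=
  [/\ closed B,
      B 0,
      forall (c : R[i]) x y, B x -> B y -> B (c *: x + y),
      forall x y, B x -> B y -> B (x ** y)
    & forall x, B x -> B (star x)].

Definition positive_in (B : set A) (a : A) : Prop :=
  exists2 c, B c & a = star c ** c.

Definition mx_over (B : set A) k (M : 'M[A]_k) : Prop :=
  forall i j, B (M i j).

Definition mxmul k (M N : 'M[A]_k) : 'M[A]_k :=
  \matrix_(i, j) \sum_(l < k) M i l ** N l j.

Definition mxstar k (M : 'M[A]_k) : 'M[A]_k := (map_mx star M)^T.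

(* Positivity in the matrix C*-algebra M_k(B). *)
Definition mx_positive_in (B : set A) k (M : 'M[A]_k) : Prop :=
  exists2 C : 'M[A]_k, mx_over B C & M = mxmul (mxstar C) C.

Definition finite_dimensional : Prop :=
  exists n (e : 'I_n -> A), linear_span (range e) = [set: A].

(* A is the C*-algebraic direct sum of the C*-subalgebras S j, that is, their
   vector-space direct sum with S i ** S j = 0 for i != j. *)
Definition is_direct_sum n (S : 'I_n -> set A) : Prop :=
  [/\ forall j, is_cstar_subalgebra (S j),
      forall i j x y, i != j -> S i x -> S j y -> x ** y = 0
    & forall a, exists! s : 'I_n -> A,
        (forall j, S j (s j)) /\ a = \sum_(j < n) s j].

End Subalgebras.

Section Maps.
Variables (R : realType) (A1 A2 : cstarAlgType R).

(* f, restricted to D, is a completely positive linear map from D to E; the values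
   of f outside D are irrelevant. *)
Definition completely_positive (D : set A1) (E : set A2) (f : A1 -> A2) : Prop :=
  [/\ forall x, D x -> E (f x),
      forall (c : R[i]) x y, D x -> D y -> f (c *: x + y) = c *: f x + f y
    & forall k (M : 'M[A1]_k),
        mx_positive_in D M -> mx_positive_in E (map_mx f M)].

Definition contractive (D : set A1) (f : A1 -> A2) : Prop :=
  forall x, D x -> `|f x| <= `|x|.

Definition order_zero (D : set A1) (f : A1 -> A2) : Prop :=
  forall a b, positive_in D a -> positive_in D b -> a ** b = 0 -> f a ** f b = 0.

End Maps.

(* The C*-algebra B, a C*-subalgebra of A, has nuclear dimension at most n; take
   B = [set: A] for A itself.  As norms take values in R[i], so does eps; 0 < eps
   forces it to be real. *)
Definition nuclear_dim_le (R : realType) (A : cstarAlgType R)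
    (n : nat) (B : set A) : Prop :=
  forall (S : set A) (eps : R[i]), finite_set S -> S `<=` B -> 0 < eps ->
  exists (F : cstarAlgType R) (Fj : 'I_n.+1 -> set F)
         (psi : A -> F) (phi : F -> A),
    [/\ finite_dimensional F /\ is_direct_sum Fj,
        completely_positive B [set: F] psi /\ contractive B psi,
        completely_positive [set: F] B phi,
        forall j, contractive (Fj j) phi /\ order_zero (Fj j) phi
      & forall a, S a -> `|phi (psi a) - a| < eps].

(* Main.v *)
Require Import Defs.
From HB Require Import structures.
From mathcomp Require Import all_boot all_order all_algebra.
From mathcomp Require Import complex.
From mathcomp Require Import all_classical all_reals all_analysis.
From mathcomp Require Import ring lra zify.
From Stdlib Require Ncring Ncring_tac.
Import Order.TTheory GRing.Theory Num.Theory.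
Import numFieldNormedType.Exports.
Local Open Scope classical_set_scope.
Local Open Scope ring_scope.

Set Implicit Arguments.
Unset Strict Implicit.
Unset Printing Implicit Defensive.

(** Applying the definition of the nuclear dimension to each [B_i] gives completely
    positive contractions [psi_i : B_i -> F_i] and [phi_i : F_i -> B_i].  The map
    [x |-> b_i x b_i^*] does not send all of [A] into [B_i], so [psi_i] has to be
    extended to [A]: for an approximate unit [u] of [B_i], the map
    [x |-> psi_i (u x u)] is completely positive on the idealizer of [B_i], which is
    unital, and extends to [A] by Arveson's theorem, [F_i] being finite dimensional.
    The direct sum of the [F_i] then has [(d + 1)(N + 1)] order zero summands.

    Arveson's theorem is obtained from the M. Riesz extension theorem.  With
    [tau x = Tr (y |-> x y)] on the finite-dimensional [F], completely positive maps
    [A -> F] correspond to positive functionals on [A (x) F^op], and the latter is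
    represented inside the matrices over [A] by means of a Parseval frame of [F] for
    the inner product [tau (y^* x)].  Positivity in matrix algebras [M_k(A)] is
    treated without their C*-norm: sums of squares there have square roots because the
    binomial series of [sqrt (1 - x)] converges for power-bounded [x]. *)

(** * Banach star-algebras and square roots *)

(** Elements of [A] are approximated by combinations of elements of [X] whose coefficients may be
    large, so the maps approximating the identity on [X] need a norm bound fixed before the finite
    set and the tolerance. It comes from the number of summands: [psi] is contractive and [phi] is
    contractive on each of (d + 1)(N + 1) orthogonal pieces, so [phi \o psi] has norm at most (d +
    1)(N + 1). The M. Riesz theorem extends from a subspace only if it majorises the whole space,
    here by multiples of the unit; a subalgebra [B_i] without the unit of [A] offers nothing of the
    kind, which is why the extension starts from the idealizer. The price is that the extended map
    sees [u y u] in place of [y]; the approximation inside [B_i] is therefore requested at the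
    elements [u y u]. No spectrum of elements of [A] is used. For [0 <= q <= 1] the estimate
    [n q (1 - q)^n <= 1] replaces functional calculus, both for the positivity of [st c * c] and for
    approximate units. *)

#[local] Instance ncring_ops (V : pzRingType) :
  @Ncring.Ring_ops V 0 1 +%R *%R (fun x y => x - y) -%R eq := {}.
#[local] Instance ncring_ring (V : pzRingType) :
  @Ncring.Ring V 0 1 +%R *%R (fun x y => x - y) -%R eq (ncring_ops V).
Proof.
split.
- exact: RelationClasses.eq_equivalence.
- by move=> ? ? -> ? ? ->.
- by move=> ? ? -> ? ? ->.
- by move=> ? ? -> ? ? ->.
- by move=> ? ? ->.
- exact: add0r.
- exact: addrC.
- exact: addrA.
- exact: mul1r.
- exact: mulr1.
- exact: mulrA.
- exact: mulrDl.
- by move=> x y z; exact: mulrDr.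
- by [].
- exact: subrr.
Qed.
Lemma mul1r_inj (V : pzRingType) (x y : V) : 1 * x = 1 * y -> x = y.
Proof. by rewrite !mul1r. Qed.
(* The multiplication by 1 makes the ring structure visible to the reification. *)
Ltac ncring :=
  rewrite ?expr2 ?mulr2n; apply: mul1r_inj; Ncring_tac.non_commutative_ring.

(* The complex scalars are given as central elements, since the library has no
   algebra structure on rings that may be trivial. *)
HB.mixin Record isBanachStar (R : realType) V of GRing.PzRing V := {
  bsc : R[i] -> V;
  bscD : {morph bsc : c d / c + d};
  bscM : {morph bsc : c d / c * d};
  bsc1 : bsc 1 = 1;
  bscC : forall c (x : V), x * bsc c = bsc c * x;
  st : V -> V;
  stK : involutive st;
  stD : {morph st : x y / x + y};
  st_sc : forall c : R[i], st (bsc c) = bsc (conjc c);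
  stM : forall x y : V, st (x * y) = st y * st x;
  nrm : V -> R;
  nrm0_eq0 : forall x, nrm x = 0 -> x = 0;
  nrmD : forall x y, nrm (x + y) <= nrm x + nrm y;
  nrmZr : forall (c : R) (x : V), nrm (bsc c%:C%C * x) = `|c| * nrm x;
  nrmZi : forall x : V, nrm (bsc 'i%C * x) = nrm x;
  nrmM : forall x y, nrm (x * y) <= nrm x * nrm y;
  nrm_st : forall x, nrm (st x) = nrm x;
  nrm_complete : forall u : nat -> V,
    (forall e : R, 0 < e -> exists n0, forall n m,
      (n0 <= n)%N -> (n0 <= m)%N -> nrm (u n - u m) < e) ->
    exists l, forall e : R, 0 < e -> exists n0, forall n,
      (n0 <= n)%N -> nrm (u n - l) < e
}.

#[short(type="banStarType")]
HB.structure Definition BanachStar (R : realType) :=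
  {V of GRing.PzRing V & isBanachStar R V}.

Notation "c *r x" := (bsc c%:C%C * x)
  (at level 40, left associativity) : ring_scope.

Lemma bscMr (R : realType) (V : banStarType R) c (x y : V) :
  x * (bsc c * y) = bsc c * (x * y).
Proof. by rewrite mulrA bscC mulrA. Qed.

Lemma bscMM (R : realType) (V : banStarType R) c d (x y : V) :
  (bsc c * x) * (bsc d * y) = bsc (d * c) * (x * y).
Proof. by rewrite bscMr [in LHS]mulrA !bscM !mulrA. Qed.

Section BanStarTheory.
Variables (R : realType) (V : banStarType R).
Implicit Types (x y z : V) (c d e : R).

Lemma bsc0 : bsc 0 = 0 :> V.
Proof. by apply: (addrI (bsc 0)); rewrite -bscD !addr0. Qed.
Lemma bscN (c : R[i]) : bsc (- c) = - bsc c :> V.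
Proof. by apply/eqP; rewrite -addr_eq0 -bscD addNr bsc0. Qed.
Lemma rscA c d x : c *r (d *r x) = (c * d) *r x.
Proof. by rewrite mulrA -bscM -rmorphM. Qed.
Lemma rscDl c d x : (c + d) *r x = c *r x + d *r x.
Proof. by rewrite rmorphD bscD mulrDl. Qed.
Lemma rscN1 x : (-1) *r x = - x.
Proof. by rewrite rmorphN rmorph1 bscN bsc1 mulN1r. Qed.
Lemma rscNl c x : (- c) *r x = - (c *r x).
Proof. by rewrite rmorphN bscN mulNr. Qed.
Lemma rscBl c d x : (c - d) *r x = c *r x - d *r x.
Proof. by rewrite rscDl rscNl. Qed.
Lemma rsc1 x : 1 *r x = x. Proof. by rewrite rmorph1 bsc1 mul1r. Qed.
Lemma rsc0 x : 0 *r x = 0. Proof. by rewrite rmorph0 bsc0 mul0r. Qed.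
Lemma rscMl c x y : (c *r x) * y = c *r (x * y).
Proof. by rewrite mulrA. Qed.
Lemma rscMr c x y : x * (c *r y) = c *r (x * y).
Proof. by rewrite !mulrA bscC. Qed.
Lemma rsc2 x : 2 *r x = x + x.
Proof. by rewrite rscDl rsc1. Qed.
Lemma rsc_nat n x : n%:R *r x = x *+ n.
Proof.
elim: n => [|n IH]; first by rewrite rsc0.
by rewrite mulrS rscDl rsc1 IH mulrS.
Qed.
Lemma rsc_exp c x n : (c *r x) ^+ n = (c ^+ n) *r (x ^+ n).
Proof.
elim: n => [|n IH]; first by rewrite !expr0 rsc1.
by rewrite !exprS IH rscMl rscMr rscA.
Qed.

Lemma st_rsc c x : st (c *r x) = c *r st x.
Proof. by rewrite stM st_sc conjc_real bscC. Qed.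
Lemma st0 : st (0 : V) = 0.
Proof. by have := st_rsc 0 0; rewrite !rsc0. Qed.
Lemma stN x : st (- x) = - st x.
Proof. by apply/eqP; rewrite -addr_eq0 -stD addNr st0. Qed.
Lemma stB x y : st (x - y) = st x - st y.
Proof. by rewrite stD stN. Qed.
Lemma st1 : st (1 : V) = 1.
Proof. by rewrite -[LHS]mulr1 -{2}(stK 1) -stM mulr1 stK. Qed.
Lemma st_sum I (r : seq I) (P : pred I) (F : I -> V) :
  st (\sum_(i <- r | P i) F i) = \sum_(i <- r | P i) st (F i).
Proof. exact: (big_morph st stD st0). Qed.
Lemma stX x n : st (x ^+ n) = st x ^+ n.
Proof.
elim: n => [|n IH]; first by rewrite !expr0 st1.
by rewrite exprS stM IH exprSr.
Qed.

Definition sa x := st x = x.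
Lemma sa0 : sa 0. Proof. exact: st0. Qed.
Lemma sa1 : sa 1. Proof. exact: st1. Qed.
Lemma saD x y : sa x -> sa y -> sa (x + y).
Proof. by rewrite /sa stD => -> ->. Qed.
Lemma saN x : sa x -> sa (- x). Proof. by rewrite /sa stN => ->. Qed.
Lemma saB x y : sa x -> sa y -> sa (x - y).
Proof. by move=> hx hy; apply: saD hx (saN hy). Qed.
Lemma saZ c x : sa x -> sa (c *r x). Proof. by rewrite /sa st_rsc => ->. Qed.
Lemma saX x n : sa x -> sa (x ^+ n). Proof. by rewrite /sa stX => ->. Qed.
Lemma saM x y : sa x -> sa y -> x * y = y * x -> sa (x * y).
Proof. by rewrite /sa stM => -> -> ->. Qed.
Lemma sa_stM x : sa (st x * x). Proof. by rewrite /sa stM stK. Qed.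

Lemma nrm0 : nrm (0 : V) = 0.
Proof. by have := nrmZr 0 (0 : V); rewrite -/(0 *r _) rsc0 normr0 mul0r. Qed.
Lemma nrmN x : nrm (- x) = nrm x.
Proof.
by rewrite -rscN1 nrmZr normrN normr1 mul1r.
Qed.
Lemma nrm_ge0 x : 0 <= nrm x.
Proof. have := nrmD x (- x); rewrite subrr nrm0 nrmN; lra. Qed.
Lemma nrmB x y : nrm (x - y) <= nrm x + nrm y.
Proof. by rewrite -(nrmN y) nrmD. Qed.
Lemma nrmC x y : nrm (x - y) = nrm (y - x).
Proof. by rewrite -nrmN opprB. Qed.
Lemma nrm_tri x y z : nrm (x - z) <= nrm (x - y) + nrm (y - z).
Proof. by apply: le_trans (nrmD _ _); rewrite addrA subrK. Qed.
Lemma nrmBge x y : nrm x - nrm y <= nrm (x - y).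
Proof. by have := nrmD (x - y) y; rewrite subrK; lra. Qed.
Lemma nrm_sum I (r : seq I) (P : pred I) (F : I -> V) :
  nrm (\sum_(i <- r | P i) F i) <= \sum_(i <- r | P i) nrm (F i).
Proof.
elim/big_ind2: _ => [|x1 x2 y1 y2 h1 h2|//]; first by rewrite nrm0.
by apply: le_trans (nrmD _ _) _; rewrite lerD.
Qed.
Lemma nrm_small x : (forall e, 0 < e -> nrm x < e) -> x = 0.
Proof.
move=> h; apply: nrm0_eq0; apply: contrapT => /eqP nx.
have p : 0 < nrm x by rewrite lt_neqAle eq_sym nx nrm_ge0.
by have := h _ p; rewrite ltxx.
Qed.

Definition lim_to (u : nat -> V) l := forall e, 0 < e -> exists n0, forall n,
  (n0 <= n)%N -> nrm (u n - l) < e.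

Lemma lim_const x : lim_to (fun=> x) x.
Proof. by move=> e e0; exists 0 => n _; rewrite subrr nrm0. Qed.
Lemma lim_unique u x y : lim_to u x -> lim_to u y -> x = y.
Proof.
move=> hx hy; apply/eqP; rewrite -subr_eq0; apply/eqP/nrm_small => e e0.
have e2 : 0 < e / 2 by lra.
have [n hn] := hx _ e2; have [m hm] := hy _ e2.
have := hn _ (leq_maxl n m); have := hm _ (leq_maxr n m).
set k := maxn n m => h1 h2.
have := nrm_tri x (u k) y; rewrite (nrmC x (u k)); lra.
Qed.
Lemma lim_shift u x : lim_to u x -> lim_to (fun n => u n.+1) x.
Proof.
move=> h e e0; have [n hn] := h e e0; exists n => m hm.
exact: hn (leqW hm).
Qed.
Lemma limD u v x y : lim_to u x -> lim_to v y -> lim_to (fun n => u n + v n) (x + y).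
Proof.
move=> hx hy e e0; have e2 : 0 < e / 2 by lra.
have [n hn] := hx _ e2; have [m hm] := hy _ e2.
exists (maxn n m) => k; rewrite geq_max => /andP[/hn h1 /hm h2].
have -> : u k + v k - (x + y) = (u k - x) + (v k - y) by ncring.
by have := nrmD (u k - x) (v k - y); lra.
Qed.
Lemma lim_nrm_le u x c : lim_to u x -> (forall n, nrm (u n) <= c) -> nrm x <= c.
Proof.
move=> h hc; rewrite leNgt; apply/negP => lt.
have e0 : 0 < nrm x - c by lra.
have [n /(_ n (leqnn _))] := h _ e0; have := hc n.
have := nrmBge x (u n); rewrite nrmC; lra.
Qed.
Lemma limM u v x y : lim_to u x -> lim_to v y -> lim_to (fun n => u n * v n) (x * y).
Proof.
move=> hx hy e e0.
pose K := 1 + nrm x + nrm y.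
have K0 : 0 < K by rewrite /K; have := nrm_ge0 x; have := nrm_ge0 y; lra.
pose d := Num.min 1 (e / (2 * K)).
have d0 : 0 < d by rewrite lt_min ltr01 divr_gt0 // mulr_gt0.
have dK : d * (2 * K) <= e by rewrite -ler_pdivlMr ?mulr_gt0 // ge_min lexx orbT.
have d1 : d <= 1 by rewrite ge_min lexx.
have [n hn] := hx _ d0; have [m hm] := hy _ d0.
exists (maxn n m) => k; rewrite geq_max => /andP[/hn h1 /hm h2].
have -> : u k * v k - x * y = (u k - x) * (v k - y) + (u k - x) * y + x * (v k - y)
  by ncring.
have := nrmD ((u k - x) * (v k - y) + (u k - x) * y) (x * (v k - y)).
have := nrmD ((u k - x) * (v k - y)) ((u k - x) * y).
have := nrmM (u k - x) (v k - y); have := nrmM (u k - x) y.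
have := nrmM x (v k - y).
have := nrm_ge0 x; have := nrm_ge0 y; have := nrm_ge0 (u k - x).
have := nrm_ge0 (v k - y); rewrite /K in dK; nra.
Qed.
Lemma limZ u x c : lim_to u x -> lim_to (fun n => c *r u n) (c *r x).
Proof. exact: limM (lim_const _). Qed.
Lemma limX u x k : lim_to u x -> lim_to (fun n => u n ^+ k) (x ^+ k).
Proof.
move=> h; elim: k => [|k IH]; first exact: lim_const.
rewrite exprS; have := limM h IH; congr lim_to; apply/funext => n.
by rewrite exprS.
Qed.
Lemma lim_st u x : lim_to u x -> lim_to (fun n => st (u n)) (st x).
Proof.
by move=> h e /h [n hn]; exists n => m /hn; rewrite -stB nrm_st.
Qed.

(** Tailored to [sqrt_one_sub]: the square root is a limit of polynomials with real coefficients in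
    one element, so it stays in any such set. *)
Definition closed_subalg (W : set V) :=
  [/\ W 1, forall c x y, W x -> W y -> W (c *r x + y),
      forall x y, W x -> W y -> W (x * y)
    & forall u l, (forall n, W (u n)) -> lim_to u l -> W l].

End BanStarTheory.

Section SquareRoot.
Variables (R : realType) (V : banStarType R) (x : V) (C : R).
Hypothesis hC : forall n, nrm (x ^+ n) <= C.

(* Power series of [1 - sqrt (1 - t)], through its Newton-type recursion. *)
Fixpoint sqrt_iter n : V :=
  if n is m.+1 then 2^-1 *r (x + sqrt_iter m ^+ 2) else 0.
Fixpoint sqrt_wt n : R := if n is m.+1 then 2^-1 * (1 + sqrt_wt m ^+ 2) else 0.

(* [dom v w]: [v] is a polynomial in [x] with nonnegative coefficients of sum [w]. *)
Inductive dom : V -> R -> Prop :=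
| dom0 : dom 0 0
| domX n : dom (x ^+ n) 1
| domD v w v' w' : dom v w -> dom v' w' -> dom (v + v') (w + w')
| domZ c v w : 0 <= c -> dom v w -> dom (c *r v) (c * w).

Lemma dom_nrm v w : dom v w -> nrm v <= C * w.
Proof.
elim=> {v w} [|n|v w v' w' _ h _ h'|c v w c0 _ h].
- by rewrite nrm0 mulr0.
- by rewrite mulr1.
- by apply: le_trans (nrmD _ _) _; rewrite mulrDr lerD.
- by rewrite nrmZr ger0_norm // mulrCA ler_wpM2l.
Qed.

Lemma dom_commr v w z : dom v w -> z * x = x * z -> z * v = v * z.
Proof.
move=> h zx; elim: h => {v w} [|n|v w v' w' _ h _ h'|c v w c0 _ h].
- by rewrite mulr0 mul0r.
- exact: commrX.
- by rewrite mulrDr mulrDl h h'.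
- by rewrite rscMr rscMl h.
Qed.

Lemma dom_comm v w v' w' : dom v w -> dom v' w' -> v * v' = v' * v.
Proof.
move=> h h'; apply: (dom_commr h'); apply/esym/(dom_commr h) => //.
Qed.

Lemma domM v w v' w' : dom v w -> dom v' w' -> dom (v * v') (w * w').
Proof.
move=> h h'; elim: h => {v w} [|n|v w v2 w2 _ h _ h2|c v w c0 _ h].
- by rewrite !mul0r; exact: dom0.
- elim: h' => {v' w'} [|m|v w v2 w2 _ h _ h2|c v w c0 _ h].
  + by rewrite !mulr0; exact: dom0.
  + by rewrite -exprD mulr1; exact: domX.
  + by rewrite !mulrDr; exact: domD.
  + by rewrite rscMr mulrCA; exact: domZ.
- by rewrite !mulrDl; exact: domD.
- by rewrite rscMl -mulrA; exact: domZ.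
Qed.

Lemma dom_exp v w n : dom v w -> dom (v ^+ n) (w ^+ n).
Proof.
move=> h; elim: n => [|n IH]; first by rewrite !expr0 -(expr0 x); exact: domX.
by rewrite !exprS; exact: domM.
Qed.

Local Notation Y := sqrt_iter.
Local Notation a := sqrt_wt.

Lemma dom_iter n : dom (Y n) (a n).
Proof.
elim: n => [|n IH]; first exact: dom0.
apply: domZ; first by rewrite invr_ge0.
by apply: domD; [rewrite -(expr1 x); exact: domX|exact: dom_exp].
Qed.

(** Since polynomials in [x] commute, [Y n.+2 - Y n.+1] is half the product of [Y n.+1 - Y n] and
    [Y n.+1 + Y n]; nonnegative coefficients thus pass from one difference to the next. The weights
    obey the same recursion, at [x = 1]. *)
Lemma dom_iterS n : dom (Y n.+1 - Y n) (a n.+1 - a n).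
Proof.
elim: n => [|n IH]; first by rewrite !subr0; exact: dom_iter.
have -> : Y n.+2 - Y n.+1 = 2^-1 *r ((Y n.+1 - Y n) * (Y n.+1 + Y n)).
  have e : (Y n.+1 - Y n) * (Y n.+1 + Y n) = Y n.+1 ^+ 2 - Y n ^+ 2.
    have := dom_comm (dom_iter n.+1) (dom_iter n).
    move: (Y n.+1) (Y n) => u v uv.
    have -> : (u - v) * (u + v) = u ^+ 2 - v ^+ 2 + (u * v - v * u) by ncring.
    by rewrite uv subrr addr0.
  rewrite e -[Y n.+2]/(2^-1 *r (x + Y n.+1 ^+ 2)).
  rewrite -[X in _ - X = _]/(2^-1 *r (x + Y n ^+ 2)) -mulrBr.
  by congr (_ * _); move: (Y n.+1 ^+ 2) (Y n ^+ 2) => u v; ncring.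
have -> : a n.+2 - a n.+1 = 2^-1 * ((a n.+1 - a n) * (a n.+1 + a n)).
  by rewrite [a n.+2]/= [in LHS](_ : a n.+1 = 2^-1 * (1 + a n ^+ 2)) //=; field.
apply: domZ; first by rewrite invr_ge0.
by apply: domM => //; apply: domD; exact: dom_iter.
Qed.

Lemma dom_iterB n m : (n <= m)%N -> dom (Y m - Y n) (a m - a n).
Proof.
move=> /subnK <-; elim: (m - n)%N => [|k IH].
  by rewrite !subrr; exact: dom0.
have -> : Y (k.+1 + n) - Y n = (Y (k.+1 + n) - Y (k + n)) + (Y (k + n) - Y n).
  by rewrite addrA subrK.
have -> : a (k.+1 + n) - a n = (a (k.+1 + n) - a (k + n)) + (a (k + n) - a n).
  by rewrite addrA subrK.
by apply: domD => //; exact: dom_iterS.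
Qed.

Lemma sqrt_wt_bound n : 0 <= a n <= 1.
Proof. by elim: n => [|n]; rewrite /= ?lexx ?ler01 //; set b := a n; nra. Qed.

Lemma sqrt_wt_mono n m : (n <= m)%N -> a n <= a m.
Proof.
move=> /subnK <-; elim: (m - n)%N => [//|k IH]; apply: le_trans IH _.
rewrite addSn /=; have := sqrt_wt_bound (k + n); set b := a _; nra.
Qed.

Lemma sqrt_wt_cauchy e : 0 < e -> exists n0, forall n m,
  (n0 <= n)%N -> (n0 <= m)%N -> a m - a n < e.
Proof.
move=> e0; have hs : has_sup (range a).
  split; first by exists (a 0%N); exists 0%N.
  by exists 1 => _ [n _ <-]; have /andP[] := sqrt_wt_bound n.
have [_ [n0 _ <-] hn0] := sup_adherent e0 hs.
exists n0 => n m hn hm; have hm' : a m <= sup (range a).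
  by apply: (ub_le_sup hs.2); exists m.
have := sqrt_wt_mono hn; lra.
Qed.

Lemma sqrt_bound_ge0 : 0 <= C.
Proof. by apply: le_trans (hC 0); exact: nrm_ge0. Qed.

(** [dom_nrm] compares the differences with those of the bounded increasing real sequence [sqrt_wt];
    dividing by [C + 1] covers [C = 0]. *)
Lemma sqrt_iter_cvg : exists l, lim_to Y l.
Proof.
apply: nrm_complete => e e0.
have C1 : 0 < C + 1 by have := sqrt_bound_ge0; lra.
have d0 : 0 < e / (C + 1) by rewrite divr_gt0.
have [n0 h] := sqrt_wt_cauchy d0.
have key n m : (n0 <= n)%N -> (n <= m)%N -> nrm (Y m - Y n) < e.
  move=> hn nm; have hm := leq_trans hn nm.
  apply: le_lt_trans (dom_nrm (dom_iterB nm)) _.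
  have := h _ _ hn hm; rewrite ltr_pdivlMr //.
  have := sqrt_wt_mono nm; have := sqrt_bound_ge0; nra.
exists n0 => n m hn hm; case/orP: (leq_total n m) => nm; last exact: key.
by rewrite nrmC; exact: key.
Qed.

(** The limit [l] solves [l = (x + l ^+ 2) / 2], that is [(1 - l) ^+ 2 = 1 - x]. The powers of
    [1 - r = l] inherit the bound [C], so the lemma can be applied again, to [1 - r], to give a
    fourth root. *)
Lemma sqrt_one_sub : exists r : V, [/\ r ^+ 2 = 1 - x,
    forall k, nrm ((1 - r) ^+ k) <= C,
    sa x -> sa r, forall z, z * x = x * z -> z * r = r * z
  & forall W, closed_subalg W -> W x -> W r].
Proof.
have [l hl] := sqrt_iter_cvg; exists (1 - l); split.
- have : l = 2^-1 *r (x + l ^+ 2).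
    apply: (lim_unique (lim_shift hl)).
    by apply: limZ; apply: limD (lim_const _) (limX 2 hl).
  move=> /(congr1 (fun v => 2 *r v)); rewrite rscA divff ?pnatr_eq0 // rsc1 rsc2.
  move=> e; have -> : (1 - l) ^+ 2 = 1 - (l + l) + l ^+ 2 by ncring.
  rewrite e; ncring.
- move=> k; rewrite subKr; apply: (lim_nrm_le (limX k hl)) => n.
  apply: le_trans (dom_nrm (dom_exp k (dom_iter n))) _.
  have /andP[p q] := sqrt_wt_bound n.
  by rewrite ler_piMr ?sqrt_bound_ge0 // exprn_ile1.
- move=> sx; apply: saB (sa1 _) _; apply: (lim_unique (lim_st hl)).
  suff e : (fun n => st (Y n)) = Y by rewrite e.
  by apply/funext; elim=> [|n IH] /=; rewrite ?st0 // st_rsc stD stX sx IH.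
- move=> z zx; rewrite mulrBr mulrBl mulr1 mul1r; congr (_ - _).
  apply: (lim_unique (limM (lim_const z) hl)).
  have -> : (fun n => z * Y n) = (fun n => Y n * z).
    by apply/funext => n; exact: dom_commr (dom_iter n) zx.
  exact: limM hl (lim_const z).
- move=> W [W1 Wl Wm Wc] Wx.
  have W0 : W 0 by have := Wl (-1) _ _ W1 W1; rewrite rscN1 addNr.
  have Wlim : W l.
    apply: Wc hl; elim=> [//|n IH] /=.
    rewrite -[_ *r _]addr0; apply: (Wl) => //.
    by rewrite -(rsc1 x); apply: (Wl) => //; rewrite expr2; exact: Wm.
  by have := Wl (-1) _ _ Wlim W1; rewrite rscN1 addrC.
Qed.

End SquareRoot.

(** * Positive elements of a unital C*-algebra *)

HB.mixin Record isUnitalCStar (R : realType) V of BanachStar R V := {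
  nrm_cstar : forall x : V, nrm (st x * x) = nrm x ^+ 2
}.

#[short(type="ucsType")]
HB.structure Definition UnitalCStar (R : realType) :=
  {V of BanachStar R V & isUnitalCStar R V}.

Section Positivity.
Variables (R : realType) (A : ucsType R).
Implicit Types (a p q r x y z : A) (c t : R).

Lemma nrm1_le : nrm (1 : A) <= 1.
Proof.
have := nrm_cstar (1 : A); rewrite st1 mul1r; have := nrm_ge0 (1 : A); nra.
Qed.

Lemma nrm_sa_sq a : sa a -> nrm (a ^+ 2) = nrm a ^+ 2.
Proof. by move=> h; rewrite -nrm_cstar h expr2. Qed.

Lemma nrm_exp_le1 a n : nrm a <= 1 -> nrm (a ^+ n) <= 1.
Proof.
move=> h; elim: n => [|n IH]; first exact: nrm1_le.
rewrite exprS; apply: le_trans (nrmM _ _) _.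
by rewrite mulr_ile1 // nrm_ge0.
Qed.

(* For [s ^+ 2 = 1 - a ^+ 2] the element [u = a + 'i s] is unitary, so [s] and the
   real part [a ^+ 2 - s ^+ 2] of [u ^+ 2] are contractions. *)
Lemma nrm_sa_contraction a : sa a -> nrm a <= 1 ->
  nrm (1 - a ^+ 2) <= 1 /\ nrm (1 - (a ^+ 2 + a ^+ 2)) <= 1.
Proof.
move=> ha na.
have hC n : nrm ((a ^+ 2) ^+ n) <= 1 by rewrite -exprM; exact: nrm_exp_le1.
have [s [s2 _ ss sc _]] := sqrt_one_sub hC.
have {}ss : sa s by apply/ss/saX.
have {}sc : a * s = s * a by apply: sc; rewrite -exprSr -exprS.
pose i : A := bsc 'i%C.
have ii : i * i = -1.
  by rewrite /i -bscM -expr2 sqr_i bscN bsc1.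
have ci z : z * i = i * z by exact: bscC.
have sti : st i = - i.
  by rewrite /i st_sc -bscN; congr bsc; apply/eqP; rewrite eq_complex /= oppr0 !eqxx.
pose u := a + i * s; pose v := a - i * s.
have uv : st u = v by rewrite /u /v stD stM sti ss ha mulrN ci.
have ism : (i * s) * (i * s) = - (s * s).
  by rewrite mulrA -(mulrA i s i) ci mulrA ii mulN1r mulNr.
have isa : i * s * a = a * (i * s) by rewrite !mulrA ci -!mulrA sc.
have vu : v * u = 1.
  have -> : v * u = a * a - (i * s) * (i * s) + (a * (i * s) - i * s * a).
    by rewrite /u /v; move: (i * s) => w; ncring.
  rewrite isa subrr addr0 ism opprK -!expr2 s2; ncring.
have nu : nrm u <= 1.
  have := nrm_cstar u; rewrite uv vu; have := nrm1_le; have := nrm_ge0 u; nra.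
have nv : nrm v <= 1 by rewrite -uv nrm_st.
have ns : nrm s <= 1.
  have h : 2 *r (i * s) = u - v by rewrite rsc2 /u /v; move: (i * s) => w; ncring.
  have := nrmZr 2 (i * s); rewrite h nrmZi ger0_norm //.
  by have := nrmB u v; lra.
split.
  rewrite -s2; exact: nrm_exp_le1.
have h : 2 *r (1 - (a ^+ 2 + a ^+ 2)) = - (u * u + v * v).
  have -> : u * u + v * v = (a * a + (i * s) * (i * s)) + (a * a + (i * s) * (i * s)).
    by rewrite /u /v; move: (i * s) => w; ncring.
  rewrite ism -!expr2 s2 rsc2; ncring.
have := nrmZr 2 (1 - (a ^+ 2 + a ^+ 2)); rewrite h nrmN ger0_norm //.
have := nrmD (u * u) (v * v); have := nrmM u u; have := nrmM v v.
have := nrm_ge0 u; have := nrm_ge0 v; nra.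
Qed.

(** Squares of self-adjoint elements are what the square root series produces from a norm estimate,
    see [npos_pos]; that every [st c * c] is of this form is the harder [pos_stM]. *)
Definition pos p := exists2 r, sa r & p = r ^+ 2.

Lemma pos_sa p : pos p -> sa p.
Proof. by move=> [r hr ->]; exact: saX. Qed.

(** Rescales [nrm_sa_contraction] by [sqrt t]. The first bound is the converse of [npos_pos]; the
    second, with [p] doubled, drives the descent in [pos_nrm_le_gt]. *)
Lemma pos_nrm p t : pos p -> nrm p <= t ->
  nrm (t *r 1 - p) <= t /\ nrm (t *r 1 - (p + p)) <= t.
Proof.
move=> [r hr ->]; rewrite nrm_sa_sq // => ht.
have t0 : 0 <= t by apply: le_trans ht; exact: sqr_ge0.
have [tz|tnz] := eqVneq t 0.
  have : r = 0.
    by apply: nrm0_eq0; apply/eqP; rewrite -sqrf_eq0 eq_le sqr_ge0 -[X in _ <= X]tz ht.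
  by move=> ->; rewrite tz expr0n addr0 rsc0 subrr nrm0.
have tp : 0 < t by rewrite lt_neqAle eq_sym tnz.
pose k := Num.sqrt t.
have kp : 0 < k by rewrite sqrtr_gt0.
have k2 : k ^+ 2 = t by rewrite sqr_sqrtr // ltW.
have hn : nrm (k^-1 *r r) <= 1.
  rewrite nrmZr gtr0_norm ?invr_gt0 // ler_pdivrMl // mulr1.
  by rewrite -(ler_pXn2r (n := 2)) ?nnegrE ?nrm_ge0 ?(ltW kp) // k2.
have [h1 h2] := nrm_sa_contraction (saZ k^-1 hr) hn.
have e : t *r (k^-1 *r r) ^+ 2 = r ^+ 2.
  by rewrite rsc_exp rscA -k2 -exprMn divff ?gt_eqF // expr1n rsc1.
split.
  have -> : t *r 1 - r ^+ 2 = t *r (1 - (k^-1 *r r) ^+ 2) by rewrite mulrBr e.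
  by rewrite nrmZr gtr0_norm // ler_piMr // ltW.
have -> : t *r 1 - (r ^+ 2 + r ^+ 2) =
    t *r (1 - ((k^-1 *r r) ^+ 2 + (k^-1 *r r) ^+ 2)) by rewrite mulrBr mulrDr e.
by rewrite nrmZr gtr0_norm // ler_piMr // ltW.
Qed.

(** The series is applied to the contraction [x = 1 - p / t]. The norm bound on the root makes the
    root positive in turn, by [npos_pos]. *)
Lemma nrm_sqrt p t : sa p -> nrm (t *r 1 - p) <= t -> exists r,
  [/\ sa r, r ^+ 2 = p, nrm (Num.sqrt t *r 1 - r) <= Num.sqrt t,
      forall z, z * p = p * z -> z * r = r * z
    & forall W, closed_subalg W -> W p -> W r].
Proof.
move=> hp ht; have t0 : 0 <= t by apply: le_trans ht; exact: nrm_ge0.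
have [tz|tnz] := eqVneq t 0.
  move: ht; rewrite tz rsc0 sub0r nrmN => ht.
  have -> : p = 0 by apply: nrm0_eq0; apply/eqP; rewrite eq_le nrm_ge0 ht.
  exists 0; split=> //; first exact: sa0.
  - by rewrite expr0n.
  - by rewrite sqrtr0 rsc0 subrr nrm0.
have tp : 0 < t by rewrite lt_neqAle eq_sym tnz.
pose x := 1 - t^-1 *r p.
have xE : x = t^-1 *r (t *r 1 - p) by rewrite mulrBr rscA mulVf // rsc1.
have nx : nrm x <= 1.
  by rewrite xE nrmZr gtr0_norm ?invr_gt0 // ler_pdivrMl // [t * 1]mulr1.
have [r [r2 rn rs rc rW]] := sqrt_one_sub (fun n => nrm_exp_le1 n nx).
have k2 : Num.sqrt t ^+ 2 = t by rewrite sqr_sqrtr.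
exists (Num.sqrt t *r r); split.
- by apply/saZ/rs/saB; [exact: sa1|exact: saZ].
- by rewrite rsc_exp k2 r2 /x subKr rscA divff // rsc1.
- rewrite -mulrBr nrmZr ger0_norm ?sqrtr_ge0 // ler_piMr ?sqrtr_ge0 //.
  by have := rn 1; rewrite expr1.
- move=> z zp; rewrite rscMr rscMl rc // /x mulrBr mulrBl mulr1 mul1r.
  by rewrite rscMr rscMl zp.
- move=> W hW Wp; have [W1 Wl _ _] := hW.
  have W0 : W 0 by have := Wl (-1) _ _ W1 W1; rewrite rscN1 addNr.
  rewrite -[_ *r r]addr0; apply: (Wl) => //; apply: rW => //.
  by rewrite /x addrC -rscNl; apply: (Wl).
Qed.

Lemma npos_pos p t : sa p -> nrm (t *r 1 - p) <= t -> pos p.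
Proof. by move=> hp /(nrm_sqrt hp) [r [hr <- _ _ _]]; exists r. Qed.

Lemma pos_sqrt p : pos p -> exists r,
  [/\ pos r, r ^+ 2 = p, forall z, z * p = p * z -> z * r = r * z
    & forall W, closed_subalg W -> W p -> W r].
Proof.
move=> hp; have [h _] := pos_nrm hp (lexx _).
have [r [h1 h2 h3 h4 h5]] := nrm_sqrt (pos_sa hp) h.
by exists r; split=> //; exact: npos_pos h3.
Qed.

Lemma pos_sq a : sa a -> pos (a ^+ 2).
Proof. by exists a. Qed.

Lemma pos0 : pos 0.
Proof. by exists 0; [exact: sa0|rewrite expr0n]. Qed.

Lemma posD p q : pos p -> pos q -> pos (p + q).
Proof.
move=> hp hq; have [h1 _] := pos_nrm hp (lexx _); have [h2 _] := pos_nrm hq (lexx _).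
apply: (@npos_pos _ (nrm p + nrm q)); first by apply: saD; exact: pos_sa.
have -> : (nrm p + nrm q) *r 1 - (p + q) = (nrm p *r 1 - p) + (nrm q *r 1 - q).
  by rewrite rscDl; ncring.
by apply: le_trans (nrmD _ _) _; rewrite lerD.
Qed.

Lemma pos_sum I (s : seq I) (P : pred I) (F : I -> A) :
  (forall i, P i -> pos (F i)) -> pos (\sum_(i <- s | P i) F i).
Proof. by move=> h; apply: big_ind => //; [exact: pos0|exact: posD]. Qed.

Lemma posZ c p : 0 <= c -> pos p -> pos (c *r p).
Proof.
move=> c0 [r hr ->]; exists (Num.sqrt c *r r); first exact: saZ.
by rewrite rsc_exp sqr_sqrtr.
Qed.

Lemma posZ_inv c p : 0 < c -> pos (c *r p) -> pos p.
Proof.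
move=> c0 /(posZ (c := c^-1)); rewrite invr_ge0 (ltW c0) => /(_ isT).
by rewrite rscA mulVf ?rsc1 // gt_eqF.
Qed.

Lemma pos1 : pos 1.
Proof. by exists 1; [exact: sa1|rewrite expr1n]. Qed.

Lemma pos_cst c : 0 <= c -> pos (c *r 1).
Proof. by move=> h; apply/posZ/pos1. Qed.

Lemma posM p q : pos p -> pos q -> p * q = q * p -> pos (p * q).
Proof.
move=> hp hq pq.
have [r [hr r2 rc _]] := pos_sqrt hp; have [s [hs s2 sc _]] := pos_sqrt hq.
have qr : q * r = r * q by apply: rc.
have rs : r * s = s * r by apply: sc.
exists (r * s); first by apply: saM => //; exact: pos_sa.
by rewrite exprMn_comm // r2 s2.
Qed.

Lemma pos_exp p n : pos p -> pos (p ^+ n).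
Proof.
move=> hp; elim: n => [|n IH]; first exact: pos1.
by rewrite exprS; apply: posM => //; rewrite -exprS -exprSr.
Qed.

Lemma sa_nrm_pos p t : sa p -> nrm p <= t -> pos (t *r 1 - p).
Proof.
move=> hp ht; apply: (@npos_pos _ t); first by apply: saB hp; apply/saZ/sa1.
by rewrite subKr.
Qed.

(** A descent through the scales [s k = 2 ^+ k * t] replaces the spectrum. For [p] shifted by
    [s k.+1 - t], the doubled bound of [pos_nrm] is the norm bound for the shift by [s k - t]; at
    [k = 0] the shift is gone. Positivity of [t - p] provides the starting bound at a large [k]. *)
Lemma pos_nrm_le_gt p t : 0 < t -> pos p -> pos (t *r 1 - p) -> nrm p <= t.
Proof.
move=> t0 hp hq; pose s k : R := 2 ^+ k * t.
have step k : nrm (p + (s k - t) *r 1) <= s k -> nrm p <= t.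
  elim: k => [|k IH]; first by rewrite /s expr0 mul1r subrr rsc0 addr0.
  move=> h; apply: IH.
  have hp' : pos (p + (s k.+1 - t) *r 1).
    apply: posD => //; apply: pos_cst; rewrite subr_ge0 ler_peMl ?(ltW t0) //.
    by rewrite exprn_ege1 // ler1n.
  have [_] := pos_nrm hp' h.
  have -> : s k.+1 *r 1 - (p + (s k.+1 - t) *r 1 + (p + (s k.+1 - t) *r 1)) =
      (- 2) *r (p + (s k - t) *r 1).
    rewrite rscNl rsc2.
    have -> : s k.+1 = s k + s k by rewrite /s exprS; ring.
    rewrite !rscBl !rscDl; ncring.
  rewrite nrmZr normrN ger0_norm //.
  have -> : s k.+1 = 2 * s k by rewrite /s exprS mulrA.
  by rewrite ler_pM2l.
have [k hk] : exists k, nrm (t *r 1 - p) <= s k.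
  have h0 : 0 <= nrm (t *r 1 - p) / t by rewrite divr_ge0 ?nrm_ge0 // ltW.
  have := archi_boundP h0; set k := Num.bound _ => hk; exists k.
  rewrite /s -ler_pdivrMr //; apply: le_trans (ltW hk) _.
  by rewrite -natrX ler_nat ltnW // ltn_expl.
apply: (step k).
have -> : p + (s k - t) *r 1 = s k *r 1 - (t *r 1 - p) by rewrite rscBl; ncring.
by have [] := pos_nrm hq hk.
Qed.

Lemma pos_nrm_le p t : 0 <= t -> pos p -> pos (t *r 1 - p) -> nrm p <= t.
Proof.
move=> t0 hp hq; apply/ler_addgt0Pr => e e0; apply: pos_nrm_le_gt => //.
  by rewrite ltr_wpDl.
have -> : (t + e) *r 1 - p = (t *r 1 - p) + e *r 1 by rewrite rscDl; ncring.
by apply: posD => //; apply/pos_cst/ltW.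
Qed.

Lemma nrm_mono p q : pos p -> pos (q - p) -> nrm p <= nrm q.
Proof.
move=> hp hqp; apply: (pos_nrm_le (nrm_ge0 _) hp).
have -> : nrm q *r 1 - p = (nrm q *r 1 - q) + (q - p) by ncring.
apply: posD => //; apply: sa_nrm_pos => //.
by have := saD (pos_sa hqp) (pos_sa hp); rewrite subrK.
Qed.

Lemma pos_mulrn p n : pos p -> pos (p *+ n).
Proof. by move=> hp; rewrite -rsc_nat; exact: posZ. Qed.

Lemma comm_1sub q n : q * (1 - q) ^+ n = (1 - q) ^+ n * q.
Proof. by apply: commrX; rewrite /GRing.comm; ncring. Qed.

(** As in Bernoulli's inequality, the defect grows from [n] to [n.+1] by a positive term,
    [((1 - q) ^+ n * q ^+ 2) *+ n.+1]. *)
Lemma pos_bernoulli q n : pos q -> pos (1 - q) ->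
  pos (1 - (1 - q) ^+ n * (1 + q *+ n)).
Proof.
move=> hq h1; elim: n => [|n IH].
  by rewrite expr0 mulr0n addr0 mulr1 subrr; exact: pos0.
have -> : 1 - (1 - q) ^+ n.+1 * (1 + q *+ n.+1) =
    (1 - (1 - q) ^+ n * (1 + q *+ n)) + ((1 - q) ^+ n * q ^+ 2) *+ n.+1.
  rewrite exprSr -mulrA -mulrnAr; set P := (1 - q) ^+ n.
  have -> : (1 - q) * (1 + q *+ n.+1) = 1 + q *+ n - q ^+ 2 *+ n.+1.
    rewrite mulrBl mul1r [q * (1 + _)]mulrDr mulr1 mulrnAr -expr2 !mulrSr.
    move: (q *+ n) (q ^+ 2 *+ n) => u v; ncring.
  move: (q *+ n) (q ^+ 2 *+ n.+1) => u v; ncring.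
apply: posD => //; apply: pos_mulrn; apply: posM; [exact: pos_exp|exact: pos_exp|].
by apply/esym/commr_sym/commrX/commr_sym; rewrite /GRing.comm comm_1sub.
Qed.

Lemma nrm_mul_exp q n : pos q -> pos (1 - q) -> n%:R * nrm (q * (1 - q) ^+ n) <= 1.
Proof.
move=> hq h1; have hp : pos (q * (1 - q) ^+ n).
  by apply: posM => //; [exact: pos_exp|exact: comm_1sub].
suff : nrm (n%:R *r (q * (1 - q) ^+ n)) <= 1 by rewrite nrmZr ger0_norm.
apply: pos_nrm_le => //; first exact: posZ.
have -> : 1 *r 1 - n%:R *r (q * (1 - q) ^+ n) =
    (1 - (1 - q) ^+ n * (1 + q *+ n)) + (1 - q) ^+ n.
  rewrite rsc1 rsc_nat comm_1sub -mulrnAr; move: (q *+ n) ((1 - q) ^+ n) => u v; ncring.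
by apply: posD; [exact: pos_bernoulli|exact: pos_exp].
Qed.

Lemma small_of_nat (c d : R) : 0 <= d -> (forall n, n%:R * c <= d) -> c <= 0.
Proof.
move=> d0 h; rewrite leNgt; apply/negP => c0.
have := archi_boundP (divr_ge0 d0 (ltW c0)); set k := Num.bound _.
by rewrite ltr_pdivrMr // ltNge h.
Qed.

(** Write [1 + p] as [(1 + nrm p) - (nrm p - p)], where the bracket has norm at most [nrm p]; so a
    factor [1 + p] never shrinks a norm. *)
Lemma nrm_mul_1pos p z n : pos p -> nrm z <= nrm ((1 + p) ^+ n * z).
Proof.
move=> hp; elim: n => [|n IH]; first by rewrite mul1r.
apply: le_trans IH _; rewrite exprS -mulrA; move: ((1 + p) ^+ n * z) => {}z.
have [h _] := pos_nrm hp (lexx _).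
have -> : (1 + p) * z = (1 + nrm p) *r z - (nrm p *r 1 - p) * z.
  by rewrite rscDl rsc1 mulrBl rscMl mul1r mulrDl mul1r; ncring.
have := nrmBge ((1 + nrm p) *r z) ((nrm p *r 1 - p) * z).
rewrite nrmZr ger0_norm ?addr_ge0 ?nrm_ge0 //.
have := nrmM (nrm p *r 1 - p) z; have := nrm_ge0 z; nra.
Qed.

(* With [h = y + st y] and [k = 'i (y - st y)] one has
   [h ^+ 2 + k ^+ 2 = 2 (st y * y + y * st y)]. *)
Lemma pos_stM_swap y : pos (- (st y * y)) -> pos (y * st y).
Proof.
move=> hq; pose i : A := bsc 'i%C.
have ii : i * i = -1 by rewrite /i -bscM -expr2 sqr_i bscN bsc1.
have ci z : z * i = i * z by exact: bscC.
have sti : st i = - i.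
  by rewrite /i st_sc -bscN; congr bsc; apply/eqP; rewrite eq_complex /= oppr0 !eqxx.
have hh : sa (y + st y) by rewrite /sa stD stK addrC.
have hk : sa (i * (y - st y)) by rewrite /sa stM stB stK sti mulrN ci -mulrN opprB.
apply: (@posZ_inv 2) => //.
have -> : 2 *r (y * st y) =
    (y + st y) ^+ 2 + (i * (y - st y)) ^+ 2 + 2 *r (- (st y * y)).
  have -> : (i * (y - st y)) ^+ 2 = - ((y - st y) * (y - st y)).
    by rewrite expr2 mulrA -(mulrA i _ i) ci mulrA ii mulN1r mulNr.
  rewrite !rsc2; ncring.
by apply: posD; [apply: posD; apply: pos_sq|apply: posZ].
Qed.

(** Replaces the comparison of the spectra of [st y * y] and [y * st y]. After scaling, put
    [q = - st z * z] and [p = z * st z], both positive by [pos_stM_swap]. From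
    [z (1 - q) = (1 + p) z] one gets [nrm (z q) <= nrm ((1 + p) ^+ n z q) = nrm (z q (1 - q) ^+ n)],
    which is at most [nrm z / n]. Hence [z q = 0], then [q ^+ 2 = 0]. *)
Lemma pos_neg_stM y : pos (- (st y * y)) -> y = 0.
Proof.
have main z : nrm z <= 1 -> pos (- (st z * z)) -> z = 0.
  move=> hz hq; have hp := pos_stM_swap hq; set q := - _ in hq; set p := z * _ in hp.
  have h1 : pos (1 - q).
    rewrite -(rsc1 1); apply: sa_nrm_pos; first exact: pos_sa.
    rewrite /q nrmN nrm_cstar; have := nrm_ge0 z; nra.
  have zq n : z * (1 - q) ^+ n = (1 + p) ^+ n * z.
    elim: n => [|n IH]; first by rewrite mulr1 mul1r.
    have e : z * (1 - q) = (1 + p) * z by rewrite /p /q; ncring.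
    by rewrite exprSr mulrA IH -mulrA e mulrA -exprSr.
  have z0 : z * q = 0.
    apply: nrm0_eq0; apply/eqP; rewrite eq_le nrm_ge0 andbT.
    apply: (@small_of_nat _ (nrm z)) => [|n]; first exact: nrm_ge0.
    have := nrm_mul_1pos (z * q) n hp; rewrite mulrA -zq -mulrA -comm_1sub => h.
    apply: le_trans (ler_wpM2l (ler0n _ _) h) _.
    apply: le_trans (ler_wpM2l (ler0n _ _) (nrmM _ _)) _.
    by rewrite mulrCA ler_piMr ?nrm_ge0 // nrm_mul_exp.
  have q2 : q ^+ 2 = 0 by rewrite expr2 {1}/q mulNr -mulrA z0 mulr0 oppr0.
  have q0 : q = 0.
    by apply: nrm0_eq0; apply/eqP; rewrite -sqrf_eq0 -nrm_sa_sq ?q2 ?nrm0 //; exact: pos_sa.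
  apply: nrm0_eq0; apply/eqP; rewrite -sqrf_eq0 -nrm_cstar.
  by rewrite -nrmN -/q q0 nrm0.
move=> hy; pose c := (1 + nrm y)^-1.
have c0 : 0 < 1 + nrm y by have := nrm_ge0 y; lra.
have : c *r y = 0.
  apply: main.
    by rewrite nrmZr gtr0_norm ?invr_gt0 // ler_pdivrMl // mulr1; lra.
  have -> : - (st (c *r y) * (c *r y)) = (c ^+ 2) *r (- (st y * y)).
    by rewrite st_rsc rscMl rscMr rscA -expr2 mulrN.
  by apply: posZ; rewrite ?sqr_ge0.
move=> /(congr1 (fun z => (1 + nrm y) *r z)).
by rewrite rscA divff ?gt_eqF // rsc1 mulr0.
Qed.

(* Kaplansky: if [m] is the absolute value of [a = st c * c] and [b = m - a], then
   [b a b = - b m b] is minus a square, so [c b = 0] and hence [b = 0]. *)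
Lemma pos_stM (c : A) : pos (st c * c).
Proof.
set a := st c * c; have ha : sa a by exact: sa_stM.
have [m [hm m2 mc _]] := pos_sqrt (pos_sq ha).
have am : a * m = m * a by apply: mc; rewrite -exprSr -exprS.
have [r [hr r2 rc _]] := pos_sqrt hm.
set b := m - a; have hb : sa b by apply: saB => //; exact: pos_sa.
have bm : b * m = m * b by rewrite /b mulrBl mulrBr am.
have ab : a * b = - (m * b).
  by rewrite /b !mulrBr am -expr2 -m2 expr2 opprB.
have rb : r * b = b * r by apply/esym/rc.
have cb0 : c * b = 0.
  apply: pos_neg_stM; rewrite stM hb.
  have -> : - (b * st c * (c * b)) = (r * b) ^+ 2.
    rewrite mulrA -(mulrA b) -/a -mulrA ab mulrN opprK -r2.
    by rewrite [in RHS]expr2 {1}rb expr2 !mulrA.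
  by apply: pos_sq; apply: saM => //; exact: pos_sa.
have mb0 : m * b = 0 by rewrite -[LHS]opprK -ab -mulrA cb0 mulr0 oppr0.
have b2 : b ^+ 2 = 0.
  by rewrite expr2 {1}/b mulrBl ab mb0 oppr0 subrr.
have b0 : b = 0.
  by apply: nrm0_eq0; apply/eqP; rewrite -sqrf_eq0 -nrm_sa_sq // b2 nrm0.
by move/eqP: b0; rewrite subr_eq0 => /eqP <-.
Qed.

Lemma pos_conj p y : pos p -> pos (st y * p * y).
Proof.
move=> [r hr ->]; have -> : st y * r ^+ 2 * y = st (r * y) * (r * y).
  by rewrite stM hr expr2 !mulrA.
exact: pos_stM.
Qed.

Lemma nrm_stM_le t y : 0 <= t -> pos (t ^+ 2 *r 1 - st y * y) -> nrm y <= t.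
Proof.
move=> t0 h; rewrite -(ler_pXn2r (n := 2)) ?nnegrE ?nrm_ge0 // -nrm_cstar.
by apply: pos_nrm_le => //; [exact: sqr_ge0|exact: pos_stM].
Qed.

Lemma pos_sub_stM t y : nrm y <= t -> pos (t ^+ 2 *r 1 - st y * y).
Proof.
move=> h; apply: sa_nrm_pos; first exact: sa_stM.
by rewrite nrm_cstar lerXn2r ?nnegrE ?nrm_ge0 // (le_trans _ h) ?nrm_ge0.
Qed.

End Positivity.

(** * Matrices over a unital C*-algebra *)

Section MatrixBanachStar.
Variables (R : realType) (A : banStarType R) (k : nat).
Implicit Types (M N : 'M[A]_k).

Definition mx_bsc (c : R[i]) : 'M[A]_k := (bsc c)%:M.
Definition mx_st M : 'M[A]_k := \matrix_(i, j) st (M j i).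
(** Complete and submultiplicative, but not a C*-norm; matrices are therefore [banStarType] only,
    and their positivity is handled through sums of squares. *)
Definition mx_nrm M : R := \sum_i \sum_j nrm (M i j).

Lemma mx_bscD : {morph mx_bsc : c d / c + d}.
Proof. by move=> c d; rewrite /mx_bsc bscD raddfD. Qed.
Lemma mx_bscM : {morph mx_bsc : c d / c * d}.
Proof. by move=> c d; rewrite /mx_bsc bscM; exact: scalar_mxM. Qed.
Lemma mx_bsc1 : mx_bsc 1 = 1.
Proof. by rewrite /mx_bsc bsc1. Qed.
Lemma mx_bscE c M i j : (mx_bsc c * M) i j = bsc c * M i j.
Proof. by rewrite [_ * M]mul_scalar_mx mxE. Qed.
Lemma mx_bscC c M : M * mx_bsc c = mx_bsc c * M.
Proof.
apply/matrixP => i j; rewrite mx_bscE -bscC.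
rewrite -[_ * _]/(M *m _) /mx_bsc -diag_const_mx mul_mx_diag !mxE //.
Qed.
Lemma mx_stK : involutive mx_st.
Proof. by move=> M; apply/matrixP => i j; rewrite !mxE stK. Qed.
Lemma mx_stD : {morph mx_st : M N / M + N}.
Proof. by move=> M N; apply/matrixP => i j; rewrite !mxE stD. Qed.
Lemma mx_st_sc c : mx_st (mx_bsc c) = mx_bsc (conjc c).
Proof.
apply/matrixP => i j; rewrite !mxE eq_sym.
by case: eqP => _; rewrite ?mulr1n ?mulr0n ?st0 // st_sc.
Qed.
Lemma mx_stM M N : mx_st (M * N) = mx_st N * mx_st M.
Proof.
apply/matrixP => i j; rewrite !mxE st_sum; apply: eq_bigr => l _.
by rewrite stM !mxE.
Qed.
Lemma mx_nrm_entry M i j : nrm (M i j) <= mx_nrm M.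
Proof.
rewrite /mx_nrm (bigD1 i) //= (bigD1 j) //= -addrA lerDl addr_ge0 //.
  by apply: sumr_ge0 => l _; exact: nrm_ge0.
by apply: sumr_ge0 => l _; apply: sumr_ge0 => l' _; exact: nrm_ge0.
Qed.
Lemma mx_nrm0_eq0 M : mx_nrm M = 0 -> M = 0.
Proof.
move=> h; apply/matrixP => i j; rewrite mxE; apply: nrm0_eq0; apply/eqP.
by rewrite eq_le nrm_ge0 andbT -h mx_nrm_entry.
Qed.
Lemma mx_nrmD M N : mx_nrm (M + N) <= mx_nrm M + mx_nrm N.
Proof.
rewrite -big_split; apply: ler_sum => i _; rewrite -big_split.
by apply: ler_sum => j _; rewrite mxE; exact: nrmD.
Qed.
Lemma mx_nrmZr (c : R) M : mx_nrm (mx_bsc c%:C%C * M) = `|c| * mx_nrm M.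
Proof.
rewrite mulr_sumr; apply: eq_bigr => i _; rewrite mulr_sumr.
by apply: eq_bigr => j _; rewrite mx_bscE nrmZr.
Qed.
Lemma mx_nrmZi M : mx_nrm (mx_bsc 'i%C * M) = mx_nrm M.
Proof.
by apply: eq_bigr => i _; apply: eq_bigr => j _; rewrite mx_bscE nrmZi.
Qed.
Lemma mx_nrmM M N : mx_nrm (M * N) <= mx_nrm M * mx_nrm N.
Proof.
rewrite /mx_nrm mulr_suml; apply: ler_sum => i _.
rewrite mulr_suml [X in _ <= X](eq_bigr (fun l => \sum_j nrm (M i l) * \sum_l' nrm (N l' j))).
  rewrite exchange_big; apply: ler_sum => j _; rewrite mxE.
  apply: le_trans (nrm_sum _ _ _) _; apply: ler_sum => l _.
  apply: le_trans (nrmM _ _) _; apply: ler_wpM2l; first exact: nrm_ge0.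
  rewrite (bigD1 l) //= lerDl; apply: sumr_ge0 => l' _; exact: nrm_ge0.
by move=> l _; rewrite -mulr_sumr [in RHS]exchange_big.
Qed.
Lemma mx_nrm_st M : mx_nrm (mx_st M) = mx_nrm M.
Proof.
rewrite /mx_nrm exchange_big; apply: eq_bigr => i _.
by apply: eq_bigr => j _; rewrite mxE nrm_st.
Qed.
Lemma mx_nrm_complete (u : nat -> 'M[A]_k) :
  (forall e : R, 0 < e -> exists n0, forall n m,
    (n0 <= n)%N -> (n0 <= m)%N -> mx_nrm (u n - u m) < e) ->
  exists l, forall e : R, 0 < e -> exists n0, forall n,
    (n0 <= n)%N -> mx_nrm (u n - l) < e.
Proof.
move=> hu.
have hl (p : 'I_k * 'I_k) : exists l, lim_to (fun n => u n p.1 p.2) l.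
  apply: nrm_complete => e /hu [n0 h]; exists n0 => n m hn hm.
  apply: le_lt_trans (h n m hn hm).
  by have := mx_nrm_entry (u n - u m) p.1 p.2; rewrite !mxE.
have [L hL] := choice hl.
exists (\matrix_(i, j) L (i, j)) => e e0.
(* The successor avoids a zero denominator when [k = 0] and makes the final inequality strict. *)
pose d := e / (k * k).+1%:R.
have d0 : 0 < d by rewrite divr_gt0 ?ltr0n.
have hn (p : 'I_k * 'I_k) : exists n0, forall n,
    (n0 <= n)%N -> nrm (u n p.1 p.2 - L p) < d by exact: hL.
have [F hF] := choice hn.
exists (\max_p F p)%N => n hmax.
apply: (@le_lt_trans _ _ ((k * k)%:R * d)); last first.
  by rewrite /d mulrCA -[ltRHS]mulr1 ltr_pM2l // ltr_pdivrMr ?ltr0n // mul1r ltr_nat.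
rewrite /mx_nrm pair_big /=.
apply: le_trans (ler_sum (G := fun=> d) _ _) _ => [[i j] _|] /=.
  rewrite !mxE; apply: ltW; apply: (hF (i, j)).
  exact: leq_trans (leq_bigmax (i, j)) hmax.
by rewrite sumr_const card_prod card_ord mulr_natl.
Qed.

HB.instance Definition _ := isBanachStar.Build R 'M[A]_k
  mx_bscD mx_bscM mx_bsc1 mx_bscC mx_stK mx_stD mx_st_sc mx_stM mx_nrm0_eq0
  mx_nrmD mx_nrmZr mx_nrmZi mx_nrmM mx_nrm_st mx_nrm_complete.

Lemma st_mxE M i j : (st M) i j = st (M j i).
Proof. by rewrite mxE. Qed.
Lemma bsc_mxE c M i j : (bsc c * M) i j = bsc c * M i j.
Proof. exact: mx_bscE. Qed.
Lemma mulr_mxE M N i j : (M * N) i j = \sum_l M i l * N l j.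
Proof. by rewrite mxE. Qed.

Lemma subr_mxE M N i j : (M - N) i j = M i j - N i j.
Proof. by rewrite !mxE. Qed.

Lemma lim_mx_entry u M i j : lim_to u M -> lim_to (fun n => u n i j) (M i j).
Proof.
move=> h e /h [n0 hn]; exists n0 => n /hn; apply: le_lt_trans.
by have := mx_nrm_entry (u n - M) i j; rewrite !mxE.
Qed.

Lemma closed_subalg_mx (W : set A) :
  closed_subalg W -> closed_subalg [set M : 'M[A]_k | forall i j, W (M i j)].
Proof.
move=> [W1 Wl Wm Wc].
have W0 : W 0 by have := Wl (-1) _ _ W1 W1; rewrite rscN1 addNr.
have WD x y : W x -> W y -> W (x + y).
  by move=> hx hy; have := Wl 1 _ _ hx hy; rewrite rsc1.
split=> /=.
- by move=> i j; rewrite mxE; case: (i == j).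
- by move=> c x y hx hy i j; rewrite mxE bsc_mxE; exact: Wl.
- move=> x y hx hy i j; rewrite mulr_mxE.
  by elim/big_ind: _ => // l _; exact: Wm.
- move=> u l hu hl i j; apply: (Wc _ _ _ (lim_mx_entry i j hl)) => n; exact: hu.
Qed.

End MatrixBanachStar.

(** * Sums of squares and order boundedness *)

Section SumsOfSquares.
Variables (R : realType) (V : banStarType R).
Implicit Types (x y z : V).

(** Closure under addition is built in; that such a sum is a single square in a matrix algebra is
    only known after [mx_sqrt]. *)
Definition sos x := exists s : seq V, x = \sum_(z <- s) st z * z.

Lemma sos0 : sos 0. Proof. by exists [::]; rewrite big_nil. Qed.
Lemma sos_stM y : sos (st y * y).
Proof. by exists [:: y]; rewrite big_seq1. Qed.
Lemma sosD x y : sos x -> sos y -> sos (x + y).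
Proof. by move=> [s ->] [s' ->]; exists (s ++ s'); rewrite big_cat. Qed.
Lemma sos_conj x y : sos x -> sos (st y * x * y).
Proof.
move=> [s ->]; exists [seq z * y | z <- s]; rewrite big_map mulr_sumr mulr_suml.
by apply: eq_bigr => z _; rewrite stM !mulrA.
Qed.
Lemma sosZ (c : R) x : 0 <= c -> sos x -> sos (c *r x).
Proof.
move=> c0 [s ->]; exists [seq Num.sqrt c *r z | z <- s]; rewrite big_map mulr_sumr.
apply: eq_bigr => z _.
by rewrite st_rsc rscMl rscMr rscA -expr2 sqr_sqrtr.
Qed.
Lemma sos_sq x : sa x -> sos (x ^+ 2).
Proof. by move=> hx; rewrite expr2 -{1}hx; exact: sos_stM. Qed.
Lemma sos1 : sos 1.
Proof. by rewrite -(expr1n _ 2); apply/sos_sq/sa1. Qed.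
Lemma sos_sa x : sos x -> sa x.
Proof.
move=> [s ->]; apply: big_ind => [|y z|z _]; [exact: sa0|exact: saD|exact: sa_stM].
Qed.

(** [1 - x * x] is half the sum of [(1 - x)(1 + x)(1 - x)] and [(1 + x)(1 - x)(1 + x)], and the
    induction conjugates by [x]. With [sos_mx_entry] this is the power-boundedness that the square
    root series requires. *)
Lemma sos_1sub_exp x n : sa x -> sos (1 - x) -> sos (1 + x) ->
  sos (1 - x ^+ n * x ^+ n).
Proof.
move=> hx h1 h2.
have hq : sos (1 - x * x).
  have -> : 1 - x * x =
      2^-1 *r (st (1 - x) * (1 + x) * (1 - x) + st (1 + x) * (1 - x) * (1 + x)).
    rewrite stB stD st1 hx.
    have -> : (1 - x) * (1 + x) * (1 - x) + (1 + x) * (1 - x) * (1 + x) =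
      2 *r (1 - x * x) by rewrite rsc2; ncring.
    by rewrite rscA mulVf // rsc1.
  by apply: sosZ; [rewrite invr_ge0|apply: sosD; exact: sos_conj].
elim: n => [|n IH]; first by rewrite mulr1 subrr; exact: sos0.
have -> : 1 - x ^+ n.+1 * x ^+ n.+1 = (1 - x * x) + st x * (1 - x ^+ n * x ^+ n) * x.
  by rewrite hx {1}exprS exprSr; move: (x ^+ n) => u; ncring.
by apply: sosD => //; exact: sos_conj.
Qed.

(** Boundedness measured by the order of sums of squares, in place of a C*-norm. *)
Definition obounded y := exists2 t : R, 0 <= t & sos (t *r 1 - st y * y).

Lemma obounded0 : obounded 0.
Proof. by exists 0 => //; rewrite rsc0 mulr0 subrr; exact: sos0. Qed.

(** Parallelogram law: the squares of [y + z] and [y - z] add up to twice those of [y] and [z]. *)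
Lemma oboundedD y z : obounded y -> obounded z -> obounded (y + z).
Proof.
move=> [t t0 ht] [u u0 hu]; exists (2 * (t + u)); first by rewrite mulr_ge0 ?addr_ge0.
have -> : (2 * (t + u)) *r 1 - st (y + z) * (y + z) =
   (t *r 1 - st y * y) + (t *r 1 - st y * y) + ((u *r 1 - st z * z) + (u *r 1 - st z * z))
   + st (y - z) * (y - z).
  rewrite -rscA rsc2 rscDl stB stD; ncring.
by do 3?apply: sosD => //; exact: sos_stM.
Qed.

(** The constant comes from [2 x <= 1 + x ^+ 2 <= 1 + t]. *)
Lemma obounded_sa x : sa x -> obounded x -> exists2 t : R, 0 < t & sos (t *r 1 - x).
Proof.
move=> hx [t t0 ht]; exists (2^-1 * (1 + t)).
  by rewrite mulr_gt0 ?invr_gt0 // ltr_pwDl.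
have -> : (2^-1 * (1 + t)) *r 1 - x =
    2^-1 *r (st (1 - x) * (1 - x) + (t *r 1 - st x * x)).
  have -> : st (1 - x) * (1 - x) + (t *r 1 - st x * x) = (1 + t) *r 1 - 2 *r x.
    by rewrite stB st1 hx rscDl rsc1 rsc2; ncring.
  by rewrite mulrBr !rscA mulVf // rsc1.
by apply: sosZ; [rewrite invr_ge0|apply: sosD => //; exact: sos_stM].
Qed.

End SumsOfSquares.

(** * Square roots of positive matrices *)

Section MatrixPositivity.
Variables (R : realType) (A : ucsType R) (k : nat).
Implicit Types (M N : 'M[A]_k).

Lemma sos_mx_diag M j : sos M -> pos (M j j).
Proof.
move=> [s ->]; rewrite summxE; apply: pos_sum => z _.
rewrite mulr_mxE; apply: pos_sum => l _; rewrite st_mxE; exact: pos_stM.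
Qed.

(** The diagonal entry of [st M * M] in column [j] dominates [st (M i j) * M i j]. *)
Lemma sos_mx_entry M i j : sos (1 - st M * M) -> nrm (M i j) <= 1.
Proof.
move=> /(@sos_mx_diag _ j) h; apply: nrm_stM_le => //.
have -> : 1 ^+ 2 *r 1 - st (M i j) * M i j =
   (1 - st M * M) j j + \sum_(l | l != i) st (M l j) * M l j.
  rewrite expr1n rsc1 !mxE eqxx (bigD1 i) //= mxE.
  under eq_bigr do rewrite mxE.
  move: (\sum_(_ | _) _) => s; rewrite ?mulr1n /=; ncring.
by apply: posD => //; apply: pos_sum => l _; exact: pos_stM.
Qed.

(** By additivity a single nonzero entry [a] at [(i, j)] is enough. Then [t ^+ 2 - st D * D] is
    diagonal, with [t ^+ 2 - st a * a = r ^+ 2] at [j] and [t ^+ 2] elsewhere, so it is the square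
    of a diagonal matrix. *)
Lemma obounded_mx M : obounded M.
Proof.
pose D i j (a : A) : 'M[A]_k := \matrix_(p, q) (if (p == i) && (q == j) then a else 0).
have -> : M = \sum_i \sum_j D i j (M i j).
  apply/matrixP => p q; rewrite summxE (bigD1 p) //= summxE (bigD1 q) //= mxE !eqxx /=.
  rewrite !big1 ?addr0 // => [i ip|j jq].
    by rewrite summxE big1 // => j _; rewrite mxE eq_sym (negbTE ip).
  by rewrite mxE eq_sym (negbTE jq) andbF.
apply: big_ind => [||i _]; [exact: obounded0|exact: oboundedD|].
apply: big_ind => [||j _]; [exact: obounded0|exact: oboundedD|].
move: (M i j) => a; set t := nrm a; exists (t ^+ 2); first exact: sqr_ge0.
have [r hr r2] := pos_sub_stM (lexx (nrm a)).
pose C : 'M[A]_k := diag_mx (\row_q (if q == j then r else t *r 1)).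
have -> : (t ^+ 2) *r 1 - st (D i j a) * D i j a = st C * C; last exact: sos_stM.
have stC : st C = C.
  apply/matrixP => p q; rewrite st_mxE !mxE.
  have [->|pq] := eqVneq p q; last by rewrite ?mulr0n st0.
  by rewrite ?eqxx ?mulr1n; case: eqP => _; rewrite ?st_rsc ?st1.
rewrite stC [C * C]mulmx_diag; apply/matrixP => p q.
rewrite subr_mxE bsc_mxE mulr_mxE !mxE (bigD1 i) //= big1 ?addr0; last first.
  by move=> l li; rewrite !mxE (negbTE li) /= mulr0.
rewrite !mxE !eqxx /=; have [->|pq] := eqVneq p q; last first.
  rewrite mulr0n mulr0 sub0r; case: eqP => [pj|_]; last by rewrite st0 mul0r oppr0.
  by case: eqP => [qj|_]; [rewrite pj qj eqxx in pq|rewrite mulr0 oppr0].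
rewrite !mulr1n; case: eqP => _; first by rewrite -expr2 -r2.
by rewrite mulr0 subr0 rscMl rscMr mul1r rscA -expr2.
Qed.

(** For an order bound [t] of [M], [x = 1 - M / t] lies between -1 and 1, so all its powers have
    entries of norm at most 1 and the series converges. The second root [s] exhibits [r] as a
    square, hence as positive. *)
Lemma mx_sqrt M : sos M -> exists r s : 'M[A]_k, [/\ sa r /\ sa s, r ^+ 2 = M, s ^+ 2 = r,
    (forall z, z * M = M * z -> z * r = r * z) /\
    (forall z, z * M = M * z -> z * s = s * z)
  & forall W, closed_subalg W -> W M -> W r].
Proof.
move=> hM; have sM := sos_sa hM.
have [t t0 ht] := obounded_sa sM (obounded_mx M).
pose x : 'M[A]_k := 1 - t^-1 *r M.
have sx : sa x by apply: saB; [exact: sa1|exact: saZ].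
have ti0 : 0 <= t^-1 by rewrite invr_ge0 ltW.
have tn0 : t != 0 by rewrite gt_eqF.
have h1 : sos (1 - x) by rewrite /x subKr; exact: sosZ.
have h2 : sos (1 + x).
  have -> : 1 + x = 1 + t^-1 *r (t *r 1 - M).
    by rewrite mulrBr rscA mulVf // rsc1.
  by apply: sosD; [exact: sos1|exact: sosZ].
have hC n : nrm (x ^+ n) <= \sum_(i < k) \sum_(j < k) 1.
  apply: ler_sum => i _; apply: ler_sum => j _; apply: sos_mx_entry.
  by rewrite stX sx; exact: sos_1sub_exp.
have [r [r2 rn /(_ sx) rs rc rW]] := sqrt_one_sub hC.
have [s [s2 _ ss sc _]] := sqrt_one_sub rn.
have {}ss : sa s by apply: ss; apply: saB => //; exact: sa1.
rewrite subKr in s2.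
have q2 : Num.sqrt t ^+ 2 = t by rewrite sqr_sqrtr // ltW.
have cx z : z * M = M * z -> z * x = x * z.
  by move=> zM; rewrite /x mulrBr mulrBl mulr1 mul1r rscMr rscMl zM.
exists (Num.sqrt t *r r), (Num.sqrt (Num.sqrt t) *r s); split.
- by split; exact: saZ.
- by rewrite rsc_exp q2 r2 /x subKr rscA divff // rsc1.
- by rewrite rsc_exp sqr_sqrtr ?sqrtr_ge0 // s2.
- split=> z zM; first by rewrite rscMr rscMl rc // cx.
  rewrite rscMr rscMl sc // mulrBr mulrBl mulr1 mul1r rc //; exact: cx.
- move=> W hW WM; have [W1 Wl _ _] := hW.
  have W0 : W 0 by have := Wl (-1) _ _ W1 W1; rewrite rscN1 addNr.
  rewrite -[_ *r r]addr0; apply: (Wl) => //; apply: rW => //.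
  by rewrite /x addrC -rscNl; apply: (Wl).
Qed.

End MatrixPositivity.

(** * Finite-dimensional C*-algebras *)

Section FiniteDimension.
Variables (K : fieldType) (V : lmodType K).

Definition evr n (e : 'I_n -> V) (u : 'rV[K]_n) : V := \sum_i u 0 i *: e i.

Lemma evrP n (e : 'I_n -> V) c u v : evr e (c *: u + v) = c *: evr e u + evr e v.
Proof.
rewrite /evr scaler_sumr -big_split; apply: eq_bigr => i _.
by rewrite !mxE scalerDl scalerA.
Qed.

Lemma evr0 n (e : 'I_n -> V) : evr e 0 = 0.
Proof. by rewrite /evr big1 // => i _; rewrite mxE scale0r. Qed.

Lemma evrB n (e : 'I_n -> V) u v : evr e (u - v) = evr e u - evr e v.
Proof. by have := evrP e (-1) v u; rewrite !scaleN1r addrC => ->; rewrite addrC. Qed.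

Lemma evr_delta n (e : 'I_n -> V) i : evr e (delta_mx 0 i) = e i.
Proof.
rewrite /evr (bigD1 i) //= mxE !eqxx scale1r big1 ?addr0 // => j ji.
by rewrite mxE eqxx (negbTE ji) scale0r.
Qed.

Lemma linear_span_evr n (e : 'I_n -> V) :
  linear_span (range e) = [set: V] -> forall x, exists u, x = evr e u.
Proof.
move=> h x; have : linear_span (range e) x by rewrite h.
move=> [m [c [y [hy ->]]]].
elim/big_ind: _ => [|_ _ [u ->] [v ->]|i _].
- by exists 0; rewrite evr0.
- by exists (1 *: u + v); rewrite evrP scale1r.
- by have [j _ <-] := hy i; exists (c i *: delta_mx 0 j + 0); rewrite evrP evr_delta evr0 addr0.
Qed.

Lemma ex_basis n (e : 'I_n -> V) : (forall x, exists u, x = evr e u) ->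
  exists m (f : 'I_m -> V), (forall x, exists u, x = evr f u) /\
    (forall u, evr f u = 0 -> u = 0).
Proof.
elim: n e => [|n IH] e he.
  by exists 0, e; split=> // u _; apply/rowP => -[].
have [h|] := pselect (forall u, evr e u = 0 -> u = 0); first by exists n.+1, e.
move=> /existsNP [u /not_implyP [u0 /eqP/rV0Pn [i ui]]].
apply: (IH (e \o lift i)) => x; have [w ->] := he x.
exists (\row_j (w 0 (lift i j) - w 0 i / u 0 i * u 0 (lift i j))).
have hi : e i = - ((u 0 i)^-1 *: \sum_j u 0 (lift i j) *: e (lift i j)).
  apply: (scalerI ui); rewrite scalerN scalerA divff // scale1r; apply/eqP.
  by rewrite -addr_eq0 -[X in _ == X]u0 /evr (bigD1_ord i).
rewrite /evr (bigD1_ord i) //= hi scalerN scalerA scaler_sumr.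
rewrite addrC -sumrB; apply: eq_bigr => j _.
by rewrite mxE scalerBl !scalerA.
Qed.

Lemma ex_matrix_of n (e : 'I_n -> V) (f : V -> V) :
  (forall x, exists u, x = evr e u) ->
  (forall c x y, f (c *: x + y) = c *: f x + f y) ->
  exists M : 'M[K]_n, forall u, evr e (u *m M) = f (evr e u).
Proof.
move=> he fl.
have [g hg] := choice (fun i => he (f (e i))).
exists (\matrix_i g i) => u.
have f0 : f 0 = 0 by have := fl (-1) 0 0; rewrite !scaleN1r oppr0 addr0 addNr.
have fs (s : seq 'I_n) : f (\sum_(i <- s) u 0 i *: e i) = \sum_(i <- s) u 0 i *: f (e i).
  by elim: s => [|i s IH]; rewrite ?big_nil // !big_cons fl IH.
rewrite [in RHS]/evr fs.
have -> : u *m (\matrix_i g i) = \sum_i u 0 i *: g i.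
  by rewrite mulmx_sum_row; apply: eq_bigr => i _; rewrite rowK.
have es (s : seq 'I_n) : evr e (\sum_(i <- s) u 0 i *: g i) = \sum_(i <- s) u 0 i *: evr e (g i).
  by elim: s => [|i s IH]; rewrite ?big_nil ?evr0 // !big_cons evrP IH.
by rewrite es; apply: eq_bigr => i _; rewrite hg.
Qed.

(** Equal kernels give [M] and its cube the same rank, hence the same row space. *)
Lemma mx_cube_range n (M : 'M[K]_n) :
  (forall u : 'rV_n, u *m M *m M *m M = 0 -> u *m M = 0) ->
  forall v : 'rV_n, exists u : 'rV_n, v *m M = u *m M *m M *m M.
Proof.
move=> h v.
have kk : (kermx (M *m M *m M) <= kermx M)%MS.
  apply/sub_kermxP/row_matrixP => i; rewrite row0 row_mul; apply: h.
  have /sub_kermxP e := submx_refl (kermx (M *m M *m M)).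
  by rewrite -2!mulmxA (mulmxA M) -row_mul e row0.
have rk : (\rank M <= \rank (M *m M *m M))%N.
  have := mxrankS kk; rewrite !mxrank_ker.
  have := rank_leq_row M; have := rank_leq_row (M *m M *m M); lia.
have sub : (M *m M *m M <= M)%MS by exact: submxMl.
have sub' : (M <= M *m M *m M)%MS by rewrite -(geq_leqif (mxrank_leqif_sup sub)).
have /submxP [u ->] : (v *m M <= M *m M *m M)%MS by apply: submx_trans sub'; exact: submxMl.
by exists u; rewrite !mulmxA.
Qed.

End FiniteDimension.

(** * Units of finite-dimensional C*-algebras *)

Section Unit.
Variables (R : realType) (F : cstarAlgType R).
Implicit Types (x y h g : F).

Lemma cmul0l x : (0 : F) ** x = 0.
Proof. by have := cmulZl 0 (0 : F) x; rewrite !scale0r. Qed.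
Lemma cmul0r x : x ** (0 : F) = 0.
Proof. by have := cmulZr 0 x (0 : F); rewrite !scale0r. Qed.
Lemma cmulNl x y : (- x) ** y = - (x ** y).
Proof. by rewrite -scaleN1r cmulZl scaleN1r. Qed.
Lemma cmulNr x y : x ** (- y) = - (x ** y).
Proof. by rewrite -scaleN1r cmulZr scaleN1r. Qed.
Lemma cmulBl x y z : (x - y) ** z = x ** z - y ** z.
Proof. by rewrite cmulDl cmulNl. Qed.
Lemma cmulBr x y z : x ** (y - z) = x ** y - x ** z.
Proof. by rewrite cmulDr cmulNr. Qed.
Lemma star0 : star (0 : F) = 0.
Proof. by have := starZ 0 (0 : F); rewrite conjc0 !scale0r. Qed.
Lemma starN x : star (- x) = - star x.
Proof. by apply/eqP; rewrite -addr_eq0 -starD addNr star0. Qed.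
Lemma starB x y : star (x - y) = star x - star y.
Proof. by rewrite starD starN. Qed.
Lemma star_mul_eq0 x : star x ** x = 0 -> x = 0.
Proof.
move=> h; apply/eqP; rewrite -normr_eq0 -sqrf_eq0 -cstar_identity h normr0 //.
Qed.

(** With [z = y - p ** y], all four terms of [z ** star z] equal [y ** star y] up to sign and
    cancel. *)
Lemma support_fix p y : star p = p -> p ** (y ** star y) = y ** star y ->
  p ** y = y.
Proof.
set h := y ** star y => ps ph.
have hst : star h = h by rewrite /h starM starK.
have hp : h ** p = h by rewrite -[LHS]starK starM ps hst ph hst.
suff z0 : star (y - p ** y) = 0.
  by apply/eqP; rewrite eq_sym -subr_eq0 -[_ - _]starK z0 star0.
apply: star_mul_eq0; rewrite starK starB starM ps cmulBl !cmulBr.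
have e1 : y ** (star y ** p) = h by rewrite cmulA.
have e2 : p ** y ** star y = h by rewrite -cmulA.
have e3 : p ** y ** (star y ** p) = h by rewrite -cmulA e1.
by rewrite e1 e2 e3 !subrr.
Qed.

Hypothesis F_fin : finite_dimensional F.

(** For self-adjoint [h] the C*-identity lets one factor [h] be cancelled from [h ** (h ** y) = 0],
    so left multiplication by [h] and its cube have the same range. The second disjunct covers the
    other [h]. *)
Lemma fin_cube h : exists x, h ** h = h ** (h ** (h ** x)) \/ star h <> h.
Proof.
have [hs|hs] := pselect (star h = h); last by exists 0; right.
have cancel y : h ** (h ** y) = 0 -> h ** y = 0.
  by move=> e; apply: star_mul_eq0; rewrite starM hs -cmulA e cmul0r.
have [n [e /linear_span_evr /ex_basis [m [f [fs fi]]]]] := F_fin.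
have hl c x y : h ** (c *: x + y) = c *: (h ** x) + h ** y by rewrite cmulDr cmulZr.
have [M hM] := ex_matrix_of fs hl.
have [u hu] := fs h.
have [|v hv] := @mx_cube_range _ _ M _ u.
  move=> w /(congr1 (evr f)); rewrite !hM evr0 => /cancel /cancel; rewrite -hM; exact: fi.
exists (evr f v); left; rewrite -!hM -hv hM -hu //.
Qed.

(** [g] is the support projection of [h]. The form [h ** w] ensures that whatever annihilates [h]
    from the left annihilates [g]. *)
Lemma fin_support h : star h = h -> exists g w,
  [/\ g = h ** w, star g = g, g ** g = g & g ** h = h].
Proof.
move=> hs; have [w [hw|/(_ hs)//]] := fin_cube h.
have e0 : h ** (h - h ** (h ** w)) = 0.
  by rewrite cmulBr -hw subrr.
have y0 : h - h ** (h ** w) = 0.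
  apply: star_mul_eq0; set y := h - _.
  have -> : star y = (star h - star (h ** w) ** h).
    by rewrite /y starB !starM hs.
  by rewrite hs cmulBl -cmulA e0 cmul0r subr0.
move/eqP: y0; rewrite subr_eq0 => /eqP hhw.
exists (h ** w), w.
have ggh : star (h ** w) ** h = h by rewrite -{2}hs -starM -hhw hs.
have gg : star (h ** w) ** (h ** w) = h ** w by rewrite cmulA ggh.
have gs : star (h ** w) = h ** w by rewrite -gg starM starK.
by split=> //; rewrite -{1}gs.
Qed.

(** A projection acting as a left unit on the first [k] generators is enlarged by the support
    projection of [y ** star y], where [y] is the part of the next generator not yet fixed; the two
    projections are orthogonal. A self-adjoint left unit is two-sided. *)
Lemma fin_unital : is_unital F.
Proof.
have [n [e he]] := F_fin; have hs := linear_span_evr he.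
have step (k : nat) : (k <= n)%N -> exists g : F,
    [/\ star g = g, g ** g = g & forall i : 'I_n, (i < k)%N -> g ** e i = e i].
  elim: k => [|k IH] kn; first by exists 0; rewrite star0 cmul0l.
  have [g [gs gg ge]] := IH (ltnW kn); pose i0 := Ordinal kn.
  pose y := e i0 - g ** e i0; pose h := y ** star y.
  have gy : g ** y = 0 by rewrite /y cmulBr cmulA gg subrr.
  have hst : star h = h by rewrite /h starM starK.
  have [p [w [pw ps pp ph]]] := fin_support hst.
  have gp : g ** p = 0 by rewrite pw !cmulA gy !cmul0l.
  have pg : p ** g = 0 by rewrite -ps -gs -starM gp star0.
  have py := support_fix ps ph.
  exists (g + p); split.
  - by rewrite starD gs ps.
  - by rewrite cmulDl !cmulDr gg gp pg pp addr0 add0r.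
  - move=> i; rewrite ltnS leq_eqVlt => /orP[/eqP ik|ik].
      have -> : i = i0 by exact: val_inj.
      have ey : g ** e i0 + y = e i0 by rewrite addrC subrK.
      by rewrite cmulDl -{2}ey cmulDr cmulA pg cmul0l add0r py ey.
    by rewrite cmulDl -{2}(ge i ik) cmulA pg cmul0l addr0 ge.
have [g [gs _ ge]] := step n (leqnn n); exists g => x.
have gl z : g ** z = z.
  have [u ->] := hs z; rewrite /evr.
  elim/big_ind: _ => [|a b ha hb|i _]; first exact: cmul0r.
    by rewrite cmulDr ha hb.
  by rewrite cmulZr ge.
by split=> //; rewrite -[LHS]starK starM gs gl starK.
Qed.

End Unit.

(* The structure of [A] has no unit: the alias carries it. *)
Definition ucs_of (R : realType) (A : cstarAlgType R) (u : A)
  (hu : forall x, u ** x = x /\ x ** u = x) : Type := A.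

Section UcsOf.
Variables (R : realType) (A : cstarAlgType R) (u : A).
Hypothesis hu : forall x, u ** x = x /\ x ** u = x.
Local Notation U := (ucs_of hu).

HB.instance Definition _ := GRing.Lmodule.copy U A.

Definition cnrm (x : A) : R := complex.Re `|x|.

Lemma cnrmE (x : A) : `|x| = (cnrm x)%:C%C.
Proof. by rewrite /cnrm RRe_real // normr_real. Qed.

Let umul1 : left_id (u : U) (@cmul R A : U -> U -> U).
Proof. by move=> x; have [] := hu x. Qed.
Let umulr1 : right_id (u : U) (@cmul R A : U -> U -> U).
Proof. by move=> x; have [] := hu x. Qed.

HB.instance Definition _ := GRing.Zmodule_isPzRing.Build U
  (@cmulA R A : associative (@cmul R A : U -> U -> U))
  umul1 umulr1
  (@cmulDl R A : left_distributive (@cmul R A : U -> U -> U) +%R)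
  (@cmulDr R A : right_distributive (@cmul R A : U -> U -> U) +%R).

Definition usc (c : R[i]) : U := c *: (u : U).

Lemma uscE c (x : U) : usc c * x = c *: x.
Proof. by rewrite /usc; have := cmulZl c u (x : A); rewrite (hu x).1. Qed.
Lemma uscEr c (x : U) : x * usc c = c *: x.
Proof. by rewrite /usc; have := cmulZr c (x : A) u; rewrite (hu x).2. Qed.
Lemma uscD : {morph usc : c d / c + d}.
Proof. by move=> c d; rewrite /usc scalerDl. Qed.
Lemma uscM : {morph usc : c d / c * d}.
Proof. by move=> c d; rewrite uscE scalerA. Qed.
Lemma usc1 : usc 1 = 1.
Proof. exact: scale1r. Qed.
Lemma uscC c (x : U) : x * usc c = usc c * x.
Proof. by rewrite uscE uscEr. Qed.

Definition ust (x : U) : U := star (x : A).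
Lemma ustD : {morph ust : x y / x + y}.
Proof. exact: starD. Qed.
Lemma ust_sc c : ust (usc c) = usc (conjc c).
Proof.
rewrite /ust /usc starZ; congr (_ *: _).
have : star u = star u ** u by rewrite (hu _).2.
by move=> /(congr1 star); rewrite starM !starK (hu _).2 => <-.
Qed.

Lemma cnrm0_eq0 (x : U) : cnrm x = 0 -> x = 0.
Proof. by move=> h; apply/eqP; rewrite -normr_eq0 cnrmE h. Qed.
Lemma cnrmD (x y : U) : cnrm (x + y) <= cnrm x + cnrm y.
Proof. by have := ler_normD (x : A) y; rewrite !cnrmE -rmorphD lecR. Qed.
Lemma cnrmZr (c : R) (x : U) : cnrm (usc c%:C%C * x) = `|c| * cnrm x.
Proof.
rewrite uscE; apply: (@complexI R); rewrite rmorphM /= -!cnrmE normrZ.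
by congr (_ * _); rewrite normc_def /= expr0n addr0 sqrtr_sqr.
Qed.
Lemma cnrmZi (x : U) : cnrm (usc 'i%C * x) = cnrm x.
Proof.
rewrite uscE; apply: (@complexI R); rewrite -!cnrmE normrZ.
by rewrite normc_def /= expr0n expr1n add0r sqrtr1 mul1r.
Qed.
Lemma cnrmM (x y : U) : cnrm (x * y) <= cnrm x * cnrm y.
Proof. by have := norm_cmul (x : A) y; rewrite !cnrmE -rmorphM lecR. Qed.
(** Isometry of the involution comes from the C*-identity: the square of the norm of [x] is at most
    [cnrm (star x) * cnrm x]. *)
Lemma cnrm_star_le (x : A) : cnrm x <= cnrm (star x).
Proof.
have h : cnrm x ^+ 2 <= cnrm (star x) * cnrm x.
  have := norm_cmul (star x) x; rewrite cstar_identity !cnrmE.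
  by rewrite -rmorphM -rmorphXn lecR.
have x0 : 0 <= cnrm x by have := normr_ge0 x; rewrite cnrmE lecR.
have y0 : 0 <= cnrm (star x) by have := normr_ge0 (star x); rewrite cnrmE lecR.
have [->//|xn] := eqVneq (cnrm x) 0.
have xp : 0 < cnrm x by rewrite lt_neqAle eq_sym xn.
by rewrite -(ler_pM2r xp) -expr2.
Qed.
Lemma cnrm_st (x : U) : cnrm (ust x) = cnrm x.
Proof.
apply/eqP; rewrite eq_le cnrm_star_le andbT.
by have := cnrm_star_le (star x); rewrite starK.
Qed.
Lemma cnrm_complete (v : nat -> U) :
    (forall e : R, 0 < e -> exists n0, forall n m,
      (n0 <= n)%N -> (n0 <= m)%N -> cnrm (v n - v m) < e) ->
    exists l, forall e : R, 0 < e -> exists n0, forall n,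
      (n0 <= n)%N -> cnrm (v n - l) < e.
Proof.
move=> hv; pose w : nat -> A := v.
have eC (e : R[i]) : 0 < e -> e = (complex.Re e)%:C%C.
  by move=> e0; rewrite RRe_real // gtr0_real.
have /cauchy_cvg : cauchy (w @ \oo).
  apply: cauchy_exP => e e0; have ee := eC _ e0; move: e0; rewrite ee ltcR => e0.
  have [n0 h] := hv _ e0; exists (w n0); exists n0 => // n /= hn.
  by rewrite -ball_normE /= cnrmE ltcR; exact: h.
move=> /cvg_ex [l hl]; exists l => e e0.
have e0' : 0 < e%:C%C by rewrite ltcR.
move: hl => /cvgrPdist_lt /(_ _ e0') [n0 _ h]; exists n0 => n hn.
by have := h n hn; rewrite distrC cnrmE ltcR.
Qed.
Lemma ucs_cstar (x : U) : cnrm (ust x * x) = cnrm x ^+ 2.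
Proof.
apply: (@complexI R); rewrite rmorphXn /= -!cnrmE; exact: cstar_identity.
Qed.

HB.instance Definition _ := isBanachStar.Build R U
  uscD uscM usc1 uscC (@starK R A : involutive ust) ustD ust_sc
  (@starM R A : forall x y : U, ust (x * y) = ust y * ust x)
  cnrm0_eq0 cnrmD cnrmZr cnrmZi cnrmM cnrm_st cnrm_complete.
HB.instance Definition _ := isUnitalCStar.Build R U ucs_cstar.

End UcsOf.

(** * Faithful traces and Parseval frames *)

Section RealSpectrum.
Variables (R : realType) (n : nat) (M : 'M[R[i]]_n).
Hypothesis Mreal : forall a, eigenvalue M a -> conjc a = a.

Lemma conjc_real_sq_ge0 (a : R[i]) : conjc a = a -> 0 <= a * a.
Proof.
case: a => x y /eqP; rewrite eq_complex /= eqxx /= => /eqP yy.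
have -> : y = 0 by lra.
by rewrite -[Complex x 0]/(x%:C%C) -rmorphM lecR -expr2 sqr_ge0.
Qed.

(** Schur triangularisation puts the real eigenvalues on the diagonal, so the trace is a sum of real
    squares; if it vanishes, Cayley-Hamilton gives nilpotence. [M] is not taken Hermitian because it
    will be written in an arbitrary basis. *)
Lemma mxtrace_sq_real_spectrum :
  0 <= \tr (M *m M) /\ (\tr (M *m M) = 0 -> exists k, M ^+ k = 0).
Proof.
move: Mreal; case: n M => [|m] N hN.
  by rewrite mxtrace_mulC /mxtrace big_ord0; split=> // _; exists 0%N; apply/matrixP => -[].
have [P Pu Ptrig] := Schur N (ltn0Sn m).
have {}Pu : P \in unitmx by exact: unitarymx_unit.
move: Ptrig; rewrite /similar_to conjumx //; set T := P *m N *m invmx P => Ttrig.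
have /is_trig_mxP Tz := Ttrig.
have PN : P *m N = T *m P by rewrite /T mulmxKV.
have tr2 : \tr (N *m N) = \tr (T *m T).
  have -> : T *m T = P *m (N *m N) *m invmx P.
    by rewrite {2}/T !mulmxA -PN -!mulmxA.
  by rewrite [RHS]mxtrace_mulC mulmxA mulVmx // mul1mx.
have Teig i : conjc (T i i) = T i i.
  apply: hN.
  have : eigenvalue T (T i i).
    rewrite eigenvalue_root_char char_poly_trig // rootE horner_prod (bigD1 i) //=.
    by rewrite hornerXsubC subrr mul0r.
  move=> /eigenvalueP [v vT v0]; apply/eigenvalueP; exists (v *m P).
    by rewrite -mulmxA PN mulmxA vT scalemxAl.
  apply: contra v0 => /eqP /(congr1 (mulmx^~ (invmx P))).
  by rewrite mul0mx mulmxK // => ->.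
have trT : \tr (T *m T) = \sum_i T i i * T i i.
  apply: eq_bigr => i _; rewrite mxE (bigD1 i) //= big1 ?addr0 // => j ji.
  have [ij|ij] := ltnP i j; first by rewrite Tz // mul0r.
  by rewrite (Tz j i) ?mulr0 // ltn_neqAle ji ij.
rewrite tr2 trT; split; first by apply: sumr_ge0 => i _; exact: conjc_real_sq_ge0.
move=> /eqP; rewrite psumr_eq0; last by move=> i _; exact: conjc_real_sq_ge0.
move=> /allP h0.
have T0 i : T i i = 0.
  by have /eqP := h0 i (mem_index_enum i); move=> /eqP /=; rewrite mulf_eq0 orbb => /eqP.
have := Cayley_Hamilton T; rewrite char_poly_trig //.
under eq_bigr do rewrite T0 subr0.
rewrite prodr_const card_ord rmorphXn /= horner_mx_X => Tn.
exists m.+1.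
have PNk k : P *m N ^+ k = T ^+ k *m P.
  elim: k => [|k IH]; first by rewrite !expr0 mulmx1 mul1mx.
  by rewrite !exprS -[N * _]/(N *m _) mulmxA PN -mulmxA IH mulmxA.
by have := PNk m.+1; rewrite Tn mul0mx => /(congr1 (mulmx (invmx P))); rewrite mulmx0 mulKmx.
Qed.

End RealSpectrum.

Lemma complex_ge0_Im (R : realType) (z : R[i]) : 0 <= z -> complex.Im z = 0.
Proof. by rewrite lecE => /andP[/eqP]. Qed.

Section Trace.
Variables (R : realType) (A : ucsType R) (tau : A -> R[i]).

Definition is_trace :=
  [/\ forall x y, tau (x + y) = tau x + tau y,
      forall c x, tau (bsc c * x) = c * tau x,
      forall x y, tau (x * y) = tau (y * x),
      forall x, 0 <= tau (st x * x)
    & forall x, tau (st x * x) = 0 -> x = 0].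

Hypothesis tauP : is_trace.

Lemma trD x y : tau (x + y) = tau x + tau y. Proof. by case: tauP. Qed.
Lemma trZ c x : tau (bsc c * x) = c * tau x. Proof. by case: tauP. Qed.
Lemma trC x y : tau (x * y) = tau (y * x). Proof. by case: tauP. Qed.
Lemma tr_ge0 x : 0 <= tau (st x * x). Proof. by case: tauP. Qed.
Lemma tr_eq0 x : tau (st x * x) = 0 -> x = 0. Proof. by case: tauP => _ _ _ _; apply. Qed.
Lemma tr0 : tau 0 = 0. Proof. by have := trZ 0 0; rewrite mulr0 mul0r. Qed.
Lemma trN x : tau (- x) = - tau x.
Proof. by apply/eqP; rewrite -addr_eq0 -trD addNr tr0. Qed.
Lemma trB x y : tau (x - y) = tau x - tau y. Proof. by rewrite trD trN. Qed.
Lemma tr_sum I (s : seq I) (P : pred I) (F : I -> A) :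
  tau (\sum_(i <- s | P i) F i) = \sum_(i <- s | P i) tau (F i).
Proof. exact: (big_morph tau trD tr0). Qed.

(** Polarisation writes [4 x] as a difference of two elements [st y * y], on which [tau] is real. *)
Lemma tr_sa x : sa x -> complex.Im (tau x) = 0.
Proof.
move=> hx; have e : 4 *r x = st (1 + x) * (1 + x) - st (1 - x) * (1 - x).
  rewrite stB stD st1 hx (_ : 4 = 2 + 2 :> R) ?rscDl ?rsc2; last by ring.
  rewrite rsc1; ncring.
have := congr1 (fun z => complex.Im (tau z)) e; rewrite trZ trB.
have := complex_ge0_Im (tr_ge0 (1 + x)); have := complex_ge0_Im (tr_ge0 (1 - x)).
case: (tau (st (1 - x) * _)) => a1 b1; case: (tau (st (1 + x) * _)) => a2 b2.
case: (tau x) => a b /=; lra.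
Qed.

Lemma tr_st x : tau (st x) = conjc (tau x).
Proof.
have h1 : sa (x + st x) by rewrite /sa stD stK addrC.
have h2 : sa (bsc 'i%C * (x - st x)).
  rewrite /sa stM stB stK st_sc bscC -[in RHS]opprB mulrN -mulNr -bscN.
  by congr (bsc _ * _); apply/eqP; rewrite eq_complex /= oppr0 !eqxx.
have := tr_sa h1; have := tr_sa h2; rewrite trZ trB trD.
case: (tau x) => a b; case: (tau (st x)) => a' b' /= p q.
apply/eqP; rewrite eq_complex /=; apply/andP; split; apply/eqP; lra.
Qed.

(** The frame operator of [t] for the inner product [tau (st v * x)]; [t] is a Parseval frame when
    it is the identity. *)
Definition frame_expand (t : seq A) x := \sum_(v <- t) bsc (tau (st v * x)) * v.

Lemma frame_expandP t c x y : frame_expand t (bsc c * x + y) =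
  bsc c * frame_expand t x + frame_expand t y.
Proof.
rewrite /frame_expand mulr_sumr -big_split; apply: eq_bigr => v _.
by rewrite mulrDr trD mulrA bscC -mulrA trZ bscD mulrDl bscM mulrA.
Qed.

Lemma frame_expand0 t : frame_expand t 0 = 0.
Proof. by rewrite /frame_expand big1 // => v _; rewrite mulr0 tr0 bsc0 mul0r. Qed.

(* Gram-Schmidt; vectors that become zero are kept, as normalising them is harmless. *)
Lemma ex_frame_seq s : exists t, forall x, x \in s ++ t -> frame_expand t x = x.
Proof.
elim: s => [|e s [t ht]].
  by exists [::].
pose y := e - frame_expand t e.
have ort v : v \in t -> tau (st v * y) = 0.
  move=> vt; have hv := ht v _; rewrite mem_cat vt orbT in hv.
  rewrite mulrBr trB -{1}(hv isT) /frame_expand mulr_sumr tr_sum st_sum mulr_suml tr_sum.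
  rewrite -sumrB big1_seq // => w _.
  rewrite stM st_sc -tr_st stM stK bscC -mulrA trZ.
  by rewrite mulrA bscC -mulrA trZ mulrC subrr.
pose a : R := (Num.sqrt (complex.Re (tau (st y * y))))^-1.
have yy : tau (st y * y) = (complex.Re (tau (st y * y)))%:C%C.
  by rewrite RRe_real // ger0_real // tr_ge0.
have yy0 : 0 <= complex.Re (tau (st y * y)) by rewrite -lecR -yy tr_ge0.
pose w := a *r y.
have ww z : bsc (tau (st w * z)) * w = bsc ((a * a)%:C%C * tau (st y * z)) * y.
  by rewrite /w st_rsc -mulrA trZ mulrA -bscM mulrAC -rmorphM.
have wyy : bsc ((a * a)%:C%C * tau (st y * y)) * y = y.
  have [z|nz] := eqVneq (tau (st y * y)) 0.
    by rewrite (tr_eq0 z) mulr0.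
  rewrite yy -rmorphM /a -invfM -expr2 sqr_sqrtr // mulVf ?bsc1 ?mul1r //.
  by apply: contra nz => /eqP h; rewrite yy h.
have exw z : z \in s ++ t -> frame_expand (w :: t) z = z.
  move=> hz; rewrite /frame_expand big_cons ww -/(frame_expand t z) ht //.
  suff -> : tau (st y * z) = 0 by rewrite mulr0 bsc0 mul0r add0r.
  rewrite -(ht z hz) /frame_expand mulr_sumr tr_sum big1_seq // => v /= vt.
  rewrite mulrA bscC -mulrA trZ; have : conjc (tau (st v * y)) = 0.
    by rewrite ort // conjc0.
  by rewrite -tr_st stM stK => ->; rewrite mulr0.
have exy : frame_expand (w :: t) y = y.
  rewrite /frame_expand big_cons ww wyy big1_seq ?addr0 // => v /= vt.
  by rewrite ort // bsc0 mul0r.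
have exe : frame_expand (w :: t) e = e.
  rewrite -[in RHS](subrK (frame_expand t e) e) -/y.
  rewrite -[in LHS](subrK (frame_expand t e) e) -/y.
  rewrite -[X in frame_expand _ (X + _)]mul1r -bsc1 frame_expandP bsc1 mul1r exy.
  congr (_ + _).
  have sub (r : seq A) : {subset r <= t} ->
      frame_expand (w :: t) (\sum_(v <- r) bsc (tau (st v * e)) * v) =
      \sum_(v <- r) bsc (tau (st v * e)) * v.
    elim: r => [|v r IH] rt.
      by rewrite !big_nil frame_expand0.
    rewrite !big_cons frame_expandP IH => [|z zr]; last by rewrite rt // inE zr orbT.
    by rewrite exw // mem_cat rt ?inE ?eqxx ?orbT.
  exact: sub.
exists (w :: t) => x; rewrite mem_cat !inE.
case/orP => [/orP[/eqP -> //|xs]|/orP[/eqP ->|xt]].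
- by apply: exw; rewrite mem_cat xs.
- by have := frame_expandP (w :: t) a%:C%C y 0; rewrite !addr0 frame_expand0 addr0 exy.
- by apply: exw; rewrite mem_cat xt orbT.
Qed.

End Trace.

Section ExTrace.
Variables (R : realType) (F : cstarAlgType R) (u : F).
Hypothesis hu : forall x, u ** x = x /\ x ** u = x.
Hypothesis F_fin : finite_dimensional F.
Local Notation U := (ucs_of hu).

(** [tau x] is the trace of left multiplication by [x]. If it vanishes at [st x * x = r ^+ 2], left
    multiplication by [r] is nilpotent, hence so is [r], and the C*-identity gives [r = 0]. The last
    formula is the same trace computed in the frame; it fixes the normalisation of [tau]. *)
Lemma ex_trace : exists tau : U -> R[i], is_trace tau /\
  exists t : seq U, (forall x, frame_expand tau t x = x) /\
    (forall x, tau x = \sum_(v <- t) tau (st v * x * v)).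
Proof.
have [n [e /linear_span_evr /ex_basis [m [f [fs fi]]]]] := F_fin.
pose g : 'I_m -> U := f.
have {}fs (x : U) : exists w, x = evr g w by exact: fs.
have {}fi w : evr g w = 0 -> w = 0 by exact: fi.
have sc c (x : U) : c *: x = bsc c * x by rewrite -[bsc c]/(usc hu c) uscE.
have evr_inj w w' : evr g w = evr g w' -> w = w'.
  by move=> h; apply/eqP; rewrite -subr_eq0; apply/eqP/fi; rewrite evrB h subrr.
have hM (x : U) : exists M : 'M[R[i]]_m, forall w, evr g (w *m M) = x * evr g w.
  apply: ex_matrix_of => // c y z.
  by rewrite !sc mulrDr !mulrA bscC.
have [M MP] := choice hM.
have mat_ext (N N' : 'M[R[i]]_m) : (forall w : 'rV_m, evr g (w *m N) = evr g (w *m N')) -> N = N'.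
  by move=> h; apply/row_matrixP => i; rewrite !rowE; apply: evr_inj.
have MD x y : M (x + y) = M x + M y.
  apply: mat_ext => w; rewrite MP mulmxDr -[w *m M x]scale1r evrP scale1r !MP.
  by rewrite mulrDl.
have MZ c x : M (bsc c * x) = c *: M x.
  apply: mat_ext => w; rewrite MP -scalemxAr -[_ *: _]addr0 evrP evr0 addr0 MP sc.
  by rewrite mulrA.
have MM x y : M (x * y) = M y *m M x.
  by apply: mat_ext => w; rewrite MP mulmxA !MP mulrA.
have tr_pos x : 0 <= \tr (M (st x * x)) /\ (\tr (M (st x * x)) = 0 -> x = 0).
  have [r hr xr] := pos_stM x.
  rewrite xr expr2 MM.
  (* For an eigenvector [w] of left multiplication by [r], evaluating [st w * (r * w)] in two ways
     gives [a (st w * w) = conjc a (st w * w)]. *)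
  have real a : eigenvalue (M r) a -> conjc a = a.
    move=> /eigenvalueP [v va v0]; pose w := evr g v.
    have rw : r * w = bsc a * w.
      by rewrite -MP va -[_ *: _]addr0 evrP evr0 addr0 sc.
    have w0 : w <> 0 by move=> /fi v00; rewrite v00 eqxx in v0.
    apply: contrapT => na; apply: w0; apply: nrm0_eq0; apply/eqP.
    rewrite -sqrf_eq0 -nrm_cstar.
    have e1 : st w * (r * w) = bsc a * (st w * w) by rewrite rw mulrA bscC mulrA.
    have e2 : st w * (r * w) = bsc (conjc a) * (st w * w).
      have := congr1 (@st R U) e1; rewrite !stM !st_sc !stK hr bscC mulrA => <-.
      by rewrite mulrA.
    have e3 : bsc (a - conjc a) * (st w * w) = 0.
      by rewrite bscD bscN mulrDl mulNr -e1 -e2 subrr.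
    have : bsc (a - conjc a)^-1 * (bsc (a - conjc a) * (st w * w)) = 0 by rewrite e3 mulr0.
    rewrite mulrA -bscM mulVf ?bsc1 ?mul1r => [->|]; first by rewrite nrm0.
    by rewrite subr_eq0; apply/eqP => h; apply: na.
  have [h1 h2] := mxtrace_sq_real_spectrum real; split=> // /h2 [k Mk].
  have Mr j w : evr g (w *m M r ^+ j) = r ^+ j * evr g w.
    elim: j w => [|j IH] w; first by rewrite !expr0 mulmx1 mul1r.
    by rewrite exprSr mulmxA MP IH exprS mulrA.
  have rk : r ^+ k = 0.
    have [w hw] := fs 1; rewrite -[LHS]mulr1 hw -Mr Mk mulmx0; exact: evr0.
  have r0 : r = 0.
    elim: k rk {Mk} => [|k IH] rk.
      by rewrite -[r]mul1r -(expr0 r) rk mul0r.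
    case: k IH rk => [_ |k IH rk]; first by rewrite expr1.
    apply: IH; apply: nrm0_eq0; apply/eqP; rewrite -sqrf_eq0 -nrm_sa_sq; last exact: saX.
    by rewrite -exprM muln2 -addnn addSn -addnS exprD rk mulr0 nrm0.
  apply: nrm0_eq0; apply/eqP; rewrite -sqrf_eq0 -nrm_cstar xr r0.
  by rewrite expr0n nrm0.
pose tau x := \tr (M x).
have tauP : is_trace tau.
  split=> [x y|c x|x y|x|x].
  - by rewrite /tau MD raddfD.
  - by rewrite /tau MZ linearZ.
  - by rewrite /tau !MM mxtrace_mulC.
  - by have [] := tr_pos x.
  - by have [_] := tr_pos x.
exists tau; split=> //.
have [t ht] := ex_frame_seq tauP [seq g i | i <- enum 'I_m].
have tx x : frame_expand tau t x = x.
  have [w ->] := fs x; rewrite /evr; elim: (index_enum _) => [|i r IH].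
    by rewrite big_nil frame_expand0.
  rewrite big_cons sc (frame_expandP tauP) IH ht // mem_cat.
  by apply/orP; left; apply: map_f; rewrite mem_enum.
exists t; split=> // x.
have [co hco] := choice fs.
have coD y z : co (y + z) = co y + co z.
  by apply: evr_inj; rewrite -hco -[co y]scale1r evrP scale1r -!hco.
have coZ c y : co (bsc c * y) = c *: co y.
  by apply: evr_inj; rewrite -hco -[_ *: _]addr0 evrP evr0 addr0 sc -!hco.
have co0 : co 0 = 0 by have := coZ 0 0; rewrite bsc0 mulr0 scale0r.
have diag i : M x i i = \sum_(v <- t) tau (st v * x * g i) * co v 0 i.
  have -> : M x i i = co (x * g i) 0 i.
    suff -> : co (x * g i) = delta_mx 0 i *m M x by rewrite -rowE mxE.
    by apply: evr_inj; rewrite -hco MP evr_delta.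
  rewrite -[in LHS](tx (x * g i)) /frame_expand (big_morph co coD co0) summxE.
  by apply: eq_bigr => v _; rewrite coZ mxE mulrA.
rewrite {1}/tau /mxtrace; under eq_bigr do rewrite diag.
rewrite exchange_big; apply: eq_bigr => v _.
have /= -> := congr1 (fun z => tau (st v * x * z)) (hco v).
rewrite /evr mulr_sumr (tr_sum tauP); apply: eq_bigr => i _.
by rewrite sc [in RHS]mulrA bscC -[in RHS]mulrA (trZ tauP) mulrC.
Qed.

End ExTrace.

(** * Extension of positive functionals and Arveson's theorem *)

Section RieszExtension.
Variables (R : realType) (V : banStarType R) (W P : set V) (f : V -> R).
Hypothesis W0 : W 0.
Hypothesis WL : forall (c : R) x y, W x -> W y -> W (c *r x + y).
Hypothesis fL : forall (c : R) x y, W x -> W y -> f (c *r x + y) = c * f x + f y.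
Hypothesis PD : forall x y, P x -> P y -> P (x + y).
Hypothesis PZ : forall (c : R) x, 0 <= c -> P x -> P (c *r x).
Hypothesis majorized : forall v, exists2 w, W w & P (w - v).
Hypothesis f_pos : forall x, W x -> P x -> 0 <= f x.

Let P0 : P 0.
Proof. by have [w _ /(PZ (lexx 0))] := majorized 0; rewrite rsc0. Qed.

(** Partial extensions as graphs. The last clause is conditional because the union of the empty
    chain is empty; single-valuedness follows from positivity, as [P] contains 0. *)
Let pext (G : set (V * R)) :=
  [/\ forall (c : R) x a y b, G (x, a) -> G (y, b) -> G (c *r x + y, c * a + b),
      forall x a, G (x, a) -> P x -> 0 <= a
    & (exists p, G p) -> forall x, W x -> G (x, f x)].

Let pext_chain (C : set (set (V * R))) :
  C `<=` pext -> total_on C subset -> pext (\bigcup_(G in C) G).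
Proof.
move=> hC tC; split.
- move=> c x a y b [G CG Gx] [G' CG' Gy].
  have [s|s] := tC _ _ CG CG'.
    by exists G' => //; have [h _ _] := hC _ CG'; apply: h => //; exact: s.
  by exists G => //; have [h _ _] := hC _ CG; apply: h => //; exact: s.
- by move=> x a [G CG Gx]; have [_ h _] := hC _ CG; exact: h.
- by move=> [p [G CG Gp]] x Wx; exists G => //; have [_ _ h] := hC _ CG; apply: h => //; exists p.
Qed.

Let graph_f : set (V * R) := [set p | W p.1 /\ p.2 = f p.1].

Let pext_graph : pext graph_f.
Proof.
split=> [c x a y b [/= Wx ->] [/= Wy ->]|x a [/= Wx ->]|_ x Wx] //=.
- by split=> /=; [exact: WL|rewrite fL].
- exact: f_pos.
Qed.

Section OneStep.
Variables (G : set (V * R)) (v : V).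
Hypothesis hG : pext G.
Hypothesis Gne : exists p, G p.
Hypothesis Gv : forall a, ~ G (v, a).

Let GW x : W x -> G (x, f x). Proof. by case: hG => _ _; apply. Qed.
Let GL (c : R) x a y b : G (x, a) -> G (y, b) -> G (c *r x + y, c * a + b).
Proof. by case: hG => h _ _; exact: h. Qed.
Let GP x a : G (x, a) -> P x -> 0 <= a. Proof. by case: hG => _ h _; exact: h. Qed.

Let G00 : G (0, 0).
Proof.
have := GW W0; have := fL (-1) W0 W0; rewrite mulr0 addr0 => ->.
by rewrite mulN1r addNr.
Qed.

(** The lower bounds that positivity imposes on a value at [v]; by [L_ub] they lie below all the
    upper bounds, so their supremum is admissible. *)
Let L := [set a | exists2 x, G (x, a) & P (v - x)].

Let L_ub x a b : L b -> G (x, a) -> P (x - v) -> b <= a.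
Proof.
move=> [y Gy Py] Gx Px; rewrite -subr_ge0; apply: (@GP (x - y)).
  by have := GL (-1) Gy Gx; rewrite rscN1 mulN1r addrC (addrC _ a).
by have := PD Px Py; rewrite addrA subrK.
Qed.

Let L_has_sup : has_sup L.
Proof.
split.
  have [w Ww Pw] := majorized (- v); rewrite opprK in Pw.
  exists (f ((-1) *r w + 0)); exists ((-1) *r w + 0).
    by apply: GW; exact: WL.
  by rewrite addr0 rscN1 opprK addrC.
have [w Ww Pw] := majorized v; exists (f w) => a La.
exact: L_ub La (GW Ww) Pw.
Qed.

Let t := sup L.

Let G' : set (V * R) :=
  [set p | exists x a (c : R), G (x, a) /\ p = (x + c *r v, a + c * t)].

Let pext_step : pext G'.
Proof.
split.
- move=> d x a y b [x1 [a1 [c1 [G1 [-> ->]]]]] [x2 [a2 [c2 [G2 [-> ->]]]]].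
  exists (d *r x1 + x2), (d * a1 + a2), (d * c1 + c2); split; first exact: GL.
  congr (_, _); last by ring.
  rewrite mulrDr rscA rscDl; ncring.
- move=> _ _ [x [a [c [Gx [-> ->]]]]] Px.
  have [c0|c0|c0] := ltrgtP c 0.
  + have nc0 : 0 < - c by rewrite oppr_gt0.
    have Gx' : G ((- c)^-1 *r x + 0, (- c)^-1 * a + 0).
      by apply: GL => //; exact: G00.
    have Px' : P (((- c)^-1 *r x + 0) - v).
      have := PZ (ltW (etrans (invr_gt0 _) nc0)) Px.
      rewrite addr0 mulrDr rscA invrN mulNr mulVf ?lt_eqF // rscN1; exact.
    have : t <= (- c)^-1 * a + 0.
      by apply: sup_le_ub; [have [] := L_has_sup|move=> b Lb; exact: L_ub Lb Gx' Px'].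
    rewrite addr0 -(ler_pM2l nc0) mulrA divff ?gt_eqF // mul1r; lra.
  + have Lx : L ((- c^-1) * a + 0).
      exists ((- c^-1) *r x + 0).
        by apply: GL => //; exact: G00.
      have ci : 0 <= c^-1 by rewrite invr_ge0 ltW.
      have := PZ ci Px; rewrite mulrDr rscA mulVf ?gt_eqF // rsc1.
      by rewrite addr0 rscNl opprK addrC.
    have := ub_le_sup (L_has_sup.2) Lx; rewrite -/t addr0 -(ler_pM2l c0).
    rewrite mulrA mulrN divff ?gt_eqF //; lra.
  + by move: Px; rewrite c0 rsc0 mul0r !addr0; exact: GP.
- move=> _ x Wx; exists x, (f x), 0; split; first exact: GW.
  by rewrite rsc0 mul0r !addr0.
Qed.

Lemma riesz_step : exists G2, G `<` G2 /\ pext G2.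
Proof.
exists G'; split=> //; split.
  by move=> [x a] Gx; exists x, a, 0; rewrite rsc0 mul0r !addr0.
move=> h; apply: (Gv (a := t)); apply: h; exists 0, 0, 1; split=> //.
by rewrite rsc1 mul1r !add0r.
Qed.

End OneStep.

Lemma riesz_extension : exists g : V -> R,
  [/\ forall (c : R) x y, g (c *r x + y) = c * g x + g y,
      forall x, W x -> g x = f x & forall x, P x -> 0 <= g x].
Proof.
have [G [hG maxG]] := Zorn_bigcup pext_chain.
have Gne : exists p, G p.
  apply: contrapT => /forallNP ne; apply: (maxG graph_f) => //; split.
    by move=> p /ne.
  by move=> /(_ (0, f 0)) h; apply: (ne (0, f 0)); exact: h.
have tot x : exists a, G (x, a).
  apply: contrapT => /forallNP nx.
  have [G2 [lt hG2]] := riesz_step hG Gne nx.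
  exact: maxG lt hG2.
have [GL GP GW] := hG.
have fct x a b : G (x, a) -> G (x, b) -> a = b.
  have le a' b' : G (x, a') -> G (x, b') -> a' <= b'.
    move=> h1 h2; have := GL (-1) _ _ _ _ h1 h2.
    by rewrite rscN1 addNr mulN1r addrC => /GP /(_ P0); rewrite subr_ge0.
  by move=> h1 h2; apply/eqP; rewrite eq_le !le.
have [g hg] := choice tot; exists g; split.
- by move=> c x y; apply: fct (hg _) _; exact: GL.
- by move=> x Wx; apply: fct (hg _) _; exact: GW.
- by move=> x; exact: GP (hg x).
Qed.

End RieszExtension.

(** * Positivity of matrices tested by a faithful trace *)

Section PositiveMatrices.
Variables (R : realType) (F : ucsType R) (tau : F -> R[i]).
Hypothesis tauP : is_trace tau.

Lemma mx_tr_stM_eq0 k (b : 'M[F]_k) : (forall j, tau ((st b * b) j j) = 0) -> b = 0.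
Proof.
move=> h; apply/matrixP => i j; rewrite mxE; apply: (tr_eq0 tauP).
have := h j; rewrite mulr_mxE (tr_sum tauP) => /eqP; rewrite psumr_eq0.
  by move=> /allP /(_ i (mem_index_enum i)) /eqP; rewrite st_mxE.
by move=> l _; rewrite st_mxE; exact: tr_ge0.
Qed.

(* The columns of [b = |G| - G] test the form on the negative part of [G]. *)
Lemma mx_form_pos k (G : 'M[F]_k) : sa G ->
  (forall f : 'I_k -> F, 0 <= tau (\sum_i \sum_j st (f i) * G i j * f j)) ->
  exists E, G = st E * E.
Proof.
move=> hG hf.
have [m [s [[ms ss] m2 s2 [mc sc] _]]] := mx_sqrt (sos_sq hG).
have cG : G * G ^+ 2 = G ^+ 2 * G by rewrite -exprSr -exprS.
have {}mc := mc _ cG; have {}sc := sc _ cG.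
pose b := m - G; have bs : sa b by exact: saB.
have sb : s * b = b * s by rewrite /b mulrBl mulrBr sc -s2 -exprSr -exprS.
have Gb : G * b = - (m * b).
  by rewrite /b !mulrBr -!expr2 m2 mc opprB.
have bGb : st b * G * b = - (st (s * b) * (s * b)).
  rewrite bs -mulrA Gb mulrN stM bs ss -s2; congr (- _).
  by rewrite expr2 !mulrA.
have sb0 : s * b = 0.
  apply: mx_tr_stM_eq0 => j; apply/eqP; rewrite eq_le; apply/andP; split; last first.
    rewrite mulr_mxE (tr_sum tauP); apply: sumr_ge0 => i _.
    by rewrite st_mxE; exact: tr_ge0.
  rewrite -oppr_ge0 -(trN tauP).
  have -> : - ((st (s * b) * (s * b)) j j) = (st b * G * b) j j by rewrite bGb [RHS]mxE.
  have := hf (fun i => b i j); congr (0 <= tau _).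
  rewrite mulr_mxE exchange_big; apply: eq_bigr => l _.
  by rewrite mulr_mxE mulr_suml; apply: eq_bigr => i _; rewrite st_mxE.
have mb : m * b = 0 by rewrite -s2 expr2 -mulrA sb0 mulr0.
have b2 : b * b = 0 by rewrite {1}/b mulrBl Gb mb oppr0 subrr.
have b0 : b = 0.
  by apply: mx_tr_stM_eq0 => j; rewrite bs b2 mxE (tr0 tauP).
by exists s; rewrite ss -expr2 s2; apply/eqP; rewrite eq_sym -subr_eq0 -/b b0.
Qed.

End PositiveMatrices.

(** * Arveson's theorem with a finite-dimensional target *)

Definition cp_on (R : realType) (A F : banStarType R) (D : set A) (psi : A -> F) :=
  forall k (C : 'M[A]_k), (forall i j, D (C i j)) ->
    exists E : 'M[F]_k, map_mx psi (st C * C) = st E * E.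

Section Arveson.
Variables (R : realType) (A F : ucsType R) (D : set A) (psi : A -> F).
Variables (tau : F -> R[i]) (t : seq F).
Hypothesis DP : closed_subalg D.
Hypothesis Dst : forall x, D x -> D (st x).
Hypothesis Dsc : forall c x, D x -> D (bsc c * x).
Hypothesis psiL : forall c x y, D x -> D y ->
  psi (bsc c * x + y) = bsc c * psi x + psi y.
Hypothesis psi_cp : cp_on D psi.
Hypothesis tauP : is_trace tau.
Hypothesis t_frame : forall x, frame_expand tau t x = x.
Hypothesis t_tr : forall x, tau x = \sum_(v <- t) tau (st v * x * v).

Let n := size t.
Let v (j : 'I_n) : F := tnth (in_tuple t) j.

Let D1 : D 1. Proof. by case: DP. Qed.
Let DM x y : D x -> D y -> D (x * y). Proof. by case: DP => _ _ h _; exact: h. Qed.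
Let DD x y : D x -> D y -> D (x + y).
Proof. by case: DP => _ h _ _ Dx Dy; have := h 1 _ _ Dx Dy; rewrite rsc1. Qed.
Let D0 : D 0. Proof. by have := Dsc 0 D1; rewrite bsc0 mul0r. Qed.
Let DN x : D x -> D (- x).
Proof. by move=> /(Dsc (-1)); rewrite bscN bsc1 mulN1r. Qed.

Let psi0 : psi 0 = 0.
Proof. by have := psiL (-1) D0 D0; rewrite !bscN !bsc1 !mulN1r !addNr. Qed.
Let psiD x y : D x -> D y -> psi (x + y) = psi x + psi y.
Proof. by move=> Dx Dy; have := psiL 1 Dx Dy; rewrite !bsc1 !mul1r. Qed.
Let psiZ c x : D x -> psi (bsc c * x) = bsc c * psi x.
Proof. by move=> Dx; have := psiL c Dx D0; rewrite psi0 !addr0. Qed.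
Let psiB x y : D x -> D y -> psi (x - y) = psi x - psi y.
Proof.
by move=> Dx Dy; have := psiL (-1) Dy Dx; rewrite !bscN !bsc1 !mulN1r addrC => ->; rewrite addrC.
Qed.

Let frame x : x = \sum_j bsc (tau (st (v j) * x)) * v j.
Proof. by rewrite -[LHS](t_frame x) /frame_expand big_tnth. Qed.

Let trE x : tau x = \sum_j tau (st (v j) * x * v j).
Proof. by rewrite t_tr big_tnth. Qed.

(** The adjoints of the frame vectors serve equally well: both sides are expanded in the frame and
    agree by traciality. *)
Let trE' x : \sum_j tau (v j * x * st (v j)) = tau x.
Proof.
rewrite trE.
under eq_bigr => j _ do rewrite [X in tau (_ * X)](frame (st (v j))) mulr_sumr (tr_sum tauP).
rewrite exchange_big; apply: eq_bigr => l _ /=.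
rewrite [in RHS](frame (st (v l))) !mulr_suml (tr_sum tauP); apply: eq_bigr => j _.
rewrite [in LHS]mulrA bscC -!mulrA !(trZ tauP); congr (_ * _); exact: trC.
Qed.

(* [s (a (x) rho f) = tau (psi a * f)] for the right multiplication [rho f] by [f],
   written in the frame [v]; [s] is positive because [psi] is completely positive. *)
Let s (M : 'M[A]_n) : R[i] := \sum_i \sum_j tau (v i * psi (M i j) * st (v j)).
Let W : set 'M[A]_n := [set M | forall i j, D (M i j)].
(** Positivity of the self-adjoint part. Skew-adjoint matrices lie in [P] with both signs, so a
    functional nonnegative on [P] vanishes on them; this makes its complexification Hermitian. *)
Let P : set 'M[A]_n := [set M | sos (M + st M)].

Let WP : closed_subalg W. Proof. exact: closed_subalg_mx. Qed.
Let WZ c M : W M -> W (bsc c * M).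
Proof. by move=> h i j; rewrite bsc_mxE; exact: Dsc. Qed.
Let Wst M : W M -> W (st M). Proof. by move=> h i j; rewrite st_mxE; exact: Dst. Qed.
Let WD M N : W M -> W N -> W (M + N).
Proof. by move=> h h' i j; rewrite mxE; exact: DD. Qed.

Let sL c M N : W M -> W N -> s (bsc c * M + N) = c * s M + s N.
Proof.
move=> hM hN; rewrite /s mulr_sumr -big_split; apply: eq_bigr => i _ /=.
rewrite mulr_sumr -big_split; apply: eq_bigr => j _ /=.
rewrite mxE bsc_mxE psiL // mulrDr mulrDl (trD tauP); congr (_ + _).
by rewrite mulrA bscC -!mulrA (trZ tauP).
Qed.

Let psi_sa x : D x -> sa x -> sa (psi x).
Proof.
have sq c : D c -> sa (psi (st c * c)).
  move=> Dc; pose C : 'M[A]_1 := const_mx c.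
  have CD i j : D (C i j) by rewrite mxE.
  have [E hE] := psi_cp CD.
  have /(congr1 (fun M : 'M[F]_1 => M 0 0)) := hE.
  rewrite mxE mulr_mxE big_ord1 st_mxE !mxE big_ord1 st_mxE => ->.
  exact: sa_stM.
move=> Dx hx; have D1p : D (1 + x) by exact: DD.
have D1m : D (1 - x) by apply: DD => //; exact: DN.
have e : 4 *r x = st (1 + x) * (1 + x) - st (1 - x) * (1 - x).
  rewrite stB stD st1 hx (_ : 4 = 2 + 2 :> R) ?rscDl ?rsc2; last by ring.
  rewrite rsc1; ncring.
have := saB (sq _ D1p) (sq _ D1m).
rewrite -(psiB (DM (Dst D1p) D1p) (DM (Dst D1m) D1m)) -e psiZ // => h.
have : sa (4^-1 *r (4 *r psi x)) by exact: saZ.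
by rewrite rscA mulVf ?pnatr_eq0 // rsc1.
Qed.

Let psi_st x : D x -> psi (st x) = st (psi x).
Proof.
move=> Dx; have Dsx := Dst Dx.
have h1 : sa (psi (x + st x)).
  by apply: psi_sa; [exact: DD|rewrite /sa stD stK addrC].
have h2 : sa (psi (bsc 'i%C * (x - st x))).
  apply: psi_sa; first by apply: Dsc; apply: DD => //; exact: DN.
  rewrite /sa stM stB stK st_sc bscC -[in RHS]opprB mulrN -mulNr -bscN.
  by congr (bsc _ * _); apply/eqP; rewrite eq_complex /= oppr0 !eqxx.
move: h1 h2; rewrite psiD // psiZ ?psiB //; last by apply: DD => //; exact: DN.
move: (psi x) (psi (st x)) => p q; rewrite /sa stD stM stB st_sc bscC => e1 e2.
have e3 : st p - st q = q - p.
  have : bsc 'i%C * (bsc (conjc 'i%C) * (st p - st q)) = bsc 'i%C * (bsc 'i%C * (p - q)).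
    by rewrite e2.
  rewrite !mulrA -!bscM -expr2 sqr_i (_ : 'i%C * conjc 'i%C = 1 :> R[i]).
    by rewrite bscN bsc1 mul1r mulN1r opprB.
  by apply/eqP; rewrite eq_complex /=; apply/andP; split; apply/eqP; ring.
have : 2 *r q = 2 *r st p.
  rewrite !rsc2; have -> : q + q = (p + q) + (q - p) by ncring.
  by rewrite -e1 -e3; ncring.
by move=> /(congr1 (fun z => 2^-1 *r z)); rewrite !rscA mulVf ?pnatr_eq0 // !rsc1.
Qed.

Let s_st M : W M -> s (st M) = conjc (s M).
Proof.
move=> hM; rewrite /s rmorph_sum exchange_big; apply: eq_bigr => i _ /=.
rewrite rmorph_sum; apply: eq_bigr => j _ /=.
by rewrite -(tr_st tauP) st_mxE psi_st // !stM stK mulrA.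
Qed.

(** The square root of [M] keeps its entries in the closed subalgebra [D], so complete positivity of
    [psi] applies and gives a matrix [st E * E]; then [s M] is a sum of terms [tau (st w * w)]. *)
Let s_pos M : W M -> sos M -> 0 <= s M.
Proof.
move=> hM /mx_sqrt [r [_ [[hr _] r2 _ _ rW]]].
have [E hE] := psi_cp (rW W WP hM); rewrite hr -expr2 r2 in hE.
have -> : s M = \sum_l tau (st (\sum_j E l j * st (v j)) * (\sum_j E l j * st (v j))).
  rewrite -(tr_sum tauP).
  under [in RHS]eq_bigr => l _.
    rewrite st_sum mulr_suml; under eq_bigr => i _ do rewrite mulr_sumr; over.
  rewrite exchange_big (tr_sum tauP); apply: eq_bigr => i _ /=.
  rewrite exchange_big (tr_sum tauP); apply: eq_bigr => j _ /=.
  have -> : psi (M i j) = \sum_l st (E l i) * E l j.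
    have := congr1 (fun N : 'M[F]_n => N i j) hE; rewrite mxE => ->.
    by rewrite mulr_mxE; apply: eq_bigr => l _; rewrite st_mxE.
  rewrite mulr_sumr mulr_suml; congr tau; apply: eq_bigr => l _.
  by rewrite stM stK !mulrA.
by apply: sumr_ge0 => l _; exact: tr_ge0.
Qed.

Let PD M N : P M -> P N -> P (M + N).
Proof.
move=> hM hN; rewrite /P /= stD.
have -> : M + N + (st M + st N) = (M + st M) + (N + st N) by ncring.
exact: sosD.
Qed.
Let PZ (c : R) M : 0 <= c -> P M -> P (c *r M).
Proof. by move=> c0 hM; rewrite /P /= st_rsc -mulrDr; exact: sosZ. Qed.

Let majorized M : exists2 N, W N & P (N - M).
Proof.
have hs : sa (M + st M) by rewrite /sa stD stK addrC.
have [c _ hc] := obounded_sa hs (obounded_mx _).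
(* Halved, since membership in [P] looks at the sum of a matrix and its adjoint. *)
exists ((2^-1 * c) *r 1).
  by have [W1 Wl _ _] := WP; rewrite -[_ *r 1]addr0; apply: Wl => // i j; rewrite mxE.
rewrite /P /= stB st_rsc st1.
have -> : (2^-1 * c) *r 1 - M + ((2^-1 * c) *r 1 - st M) =
   ((2^-1 * c) *r 1 + (2^-1 * c) *r 1) - (M + st M) by ncring.
by rewrite -rscDl (_ : 2^-1 * c + _ = c) //; field.
Qed.

Let ex_ext : exists g : 'M[A]_n -> R,
  [/\ forall (c : R) x y, g (c *r x + y) = c * g x + g y,
      forall x, W x -> g x = complex.Re (s x) & forall x, P x -> 0 <= g x].
Proof.
apply: riesz_extension => //.
- by move=> i j; rewrite mxE.
- by have [_ h _ _] := WP.
- move=> c x y Wx Wy; rewrite sL //; case: (s x) => a b; case: (s y) => a' b' /=.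
  by rewrite mul0r subr0.
- move=> x Wx Px; have := s_pos (WD Wx (Wst Wx)) Px.
  have -> : s (x + st x) = s x + s (st x).
    by have := sL 1 Wx (Wst Wx); rewrite bsc1 !mul1r.
  rewrite s_st //; case: (s x) => a b; rewrite lecE /= => /andP[_ h]; lra.
Qed.

Let ii : bsc 'i%C * bsc 'i%C = -1 :> 'M[A]_n.
Proof. by rewrite -bscM -expr2 sqr_i bscN bsc1. Qed.
Let st_i : st (bsc 'i%C) = - bsc 'i%C :> 'M[A]_n.
Proof.
by rewrite st_sc -bscN; congr bsc; apply/eqP; rewrite eq_complex /= oppr0 !eqxx.
Qed.

(** The usual complexification [g M - 'i g ('i M)] of a real extension [g] of the real part of
    [s]. *)
Lemma ex_positive_ext : exists S : 'M[A]_n -> R[i],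
  [/\ forall c M N, S (bsc c * M + N) = c * S M + S N,
      forall M, W M -> S M = s M,
      forall M, S (st M) = conjc (S M) & forall M, 0 <= S (st M * M)].
Proof.
have [g [gL gW gP]] := ex_ext.
have gZ c M : g (c *r M) = c * g M.
  have g0 : g 0 = 0 by have := gL (-1) 0 0; rewrite mulr0 addr0 mulN1r addNr.
  by have := gL c M 0; rewrite g0 !addr0.
have gD M N : g (M + N) = g M + g N by have := gL 1 M N; rewrite rsc1 mul1r.
have gN M : g (- M) = - g M by have := gZ (-1) M; rewrite rscN1 mulN1r.
have gskew M : st M = - M -> g M = 0.
  move=> h; have := gP M; rewrite /P /= h subrr => /(_ (sos0 _)).
  have := gP (- M); rewrite /P /= stN h opprK addNr gN => /(_ (sos0 _)); lra.
pose i : 'M[A]_n := bsc 'i%C.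
have ci M : M * i = i * M by exact: bscC.
have gsti M : g (i * st M) = - g (i * M).
  apply/eqP; rewrite -subr_eq0 opprK -gD; apply/eqP/gskew.
  by rewrite stD !stM stK st_i !mulrN !ci opprD addrC.
have gst M : g (st M) = g M.
  apply/eqP; rewrite -subr_eq0 -gN -gD; apply/eqP/gskew.
  by rewrite stB stK opprB.
exists (fun M => Complex (g M) (- g (i * M))); split.
- move=> c M N; case: c => a b.
  have cE : bsc (Complex a b) = a *r 1 + b *r i :> 'M[A]_n.
    rewrite mulr1 /i -bscM -bscD; congr bsc; apply/eqP; rewrite eq_complex /=.
    by apply/andP; split; apply/eqP; ring.
  have e1 : bsc (Complex a b) * M = a *r M + b *r (i * M).
    by rewrite cE mulrDl !rscMl mul1r.
  have e2 : i * (a *r M + b *r (i * M) + N) = a *r (i * M) + b *r (- M) + i * N.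
    by rewrite !mulrDr !rscMr (mulrA i i) ii mulN1r.
  apply/eqP; rewrite eq_complex /= e1 e2 !gD !gZ gN.
  by apply/andP; split; apply/eqP; ring.
- move=> M hM; have hiM : W (i * M) by exact: WZ.
  rewrite !gW //; have -> : s (i * M) = 'i%C * s M.
    have s0 : s 0 = 0.
      rewrite /s big1 // => a _; rewrite big1 // => b _.
      by rewrite mxE psi0 mulr0 mul0r (tr0 tauP).
    have W00 : W 0 by move=> a b; rewrite mxE.
    by have := sL 'i%C hM W00; rewrite s0 !addr0.
  case: (s M) => a b /=; apply/eqP; rewrite eq_complex /=.
  by apply/andP; split; apply/eqP; ring.
- move=> M; apply/eqP; rewrite eq_complex /= gst gsti.
  by rewrite !eqxx.
- move=> M; rewrite lecE /=; apply/andP; split.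
    rewrite oppr_eq0; apply/eqP/gskew.
    by rewrite !stM stK st_i mulrN ci.
  apply: gP; rewrite /P /= sa_stM; apply: sosD; exact: sos_stM.
Qed.

(** [a] tensored with right multiplication by [f], in frame coordinates: the scalar factor is the
    inner product of [v j * f] with [v i]. *)
Let T (a : A) (f : F) : 'M[A]_n := \matrix_(i, j) (bsc (tau (st (v i) * v j * f)) * a).

Let TD a f g : T a (f + g) = T a f + T a g.
Proof.
by apply/matrixP => i j; rewrite !mxE mulrDr (trD tauP) bscD mulrDl.
Qed.
Let TZ c a f : T a (bsc c * f) = bsc c * T a f.
Proof.
apply/matrixP => i j; rewrite bsc_mxE !mxE.
by rewrite (bscMr c _ f) (trZ tauP) bscM [RHS]mulrA.
Qed.
Let T0 a : T a 0 = 0.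
Proof. by have := TZ 0 a 0; rewrite !bsc0 !mul0r. Qed.
Let TDl c a b f : T (bsc c * a + b) f = bsc c * T a f + T b f.
Proof.
apply/matrixP => i j; rewrite mxE [RHS]mxE bsc_mxE !mxE mulrDr; congr (_ + _).
by rewrite mulrA bscC mulrA.
Qed.
Let st_T a f : st (T a f) = T (st a) (st f).
Proof.
apply/matrixP => i j; rewrite st_mxE !mxE stM st_sc -(tr_st tauP) bscC.
by congr (bsc _ * _); rewrite !stM stK (trC tauP).
Qed.
(** Parseval's identity collapses the middle sum, and right multiplications compose in reverse
    order: this is the product of A (x) F^op. *)
Let TM a b f g : st (T a f) * T b g = T (st a * b) (g * st f).
Proof.
rewrite st_T; apply/matrixP => i j; rewrite mulr_mxE mxE.
have -> : st (v i) * v j * (g * st f) = st (v i) * (v j * g) * st f by rewrite !mulrA.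
rewrite (frame (v j * g)) mulr_sumr mulr_suml (tr_sum tauP).
rewrite (big_morph _ (@bscD R A) (bsc0 A)) mulr_suml; apply: eq_bigr => l _.
rewrite !mxE bscMM; set q := tau (st (v l) * (v j * g)).
have -> : st (v i) * (bsc q * v l) * st f = bsc q * (st (v i) * v l * st f).
  by rewrite (bscMr q (st (v i)) (v l)) -!mulrA.
by rewrite (trZ tauP) /q !mulrA.
Qed.

(** [phi a] is the element that represents [f |-> S (T a f)] through the faithful [tau]. On [D] this
    functional is [tau (psi a * f)], whence the agreement with [psi]. *)
Lemma arveson : exists phi : A -> F,
  [/\ forall c x y, phi (bsc c * x + y) = bsc c * phi x + phi y,
      forall x, D x -> phi x = psi x & cp_on setT phi].
Proof.
have [S [SL SW Sst Spos]] := ex_positive_ext.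
have S0 : S 0 = 0 by have := SL (-1) 0 0; rewrite mulr0 addr0 mulN1r addNr.
have SD M N : S (M + N) = S M + S N by have := SL 1 M N; rewrite bsc1 !mul1r.
have SZ c M : S (bsc c * M) = c * S M by have := SL c M 0; rewrite S0 !addr0.
pose phi a := \sum_j bsc (S (T a (v j))) * st (v j).
have phiE a f : tau (phi a * f) = S (T a f).
  rewrite {2}(frame f) /phi mulr_suml (tr_sum tauP).
  rewrite (big_morph (T a) (TD a) (T0 a)) (big_morph S SD S0).
  by apply: eq_bigr => j _; rewrite -mulrA (trZ tauP) TZ SZ mulrC.
have tau_inj x y : (forall f, tau (x * f) = tau (y * f)) -> x = y.
  move=> h; apply/eqP; rewrite -subr_eq0 -[_ - _]stK; apply/eqP.
  rewrite (_ : st (x - y) = 0) ?st0 //; apply: (tr_eq0 tauP).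
  by rewrite stK mulrBl (trB tauP) h subrr.
have phi_st a : phi (st a) = st (phi a).
  apply: tau_inj => f; rewrite phiE -{1}(stK f) -st_T Sst -phiE -(tr_st tauP).
  by rewrite stM stK (trC tauP).
exists phi; split.
- move=> c x y; apply: tau_inj => f.
  by rewrite phiE TDl SL mulrDl (trD tauP) -mulrA (trZ tauP) !phiE.
- move=> x Dx; apply: tau_inj => f; rewrite phiE SW; last first.
    by move=> i j; rewrite mxE; exact: Dsc.
  rewrite /s exchange_big (trC tauP) -trE'; apply: eq_bigr => j _ /=.
  have -> : v j * (f * psi x) * st (v j) = (v j * f) * (psi x * st (v j)).
    by rewrite !mulrA.
  rewrite (frame (v j * f)) mulr_suml (tr_sum tauP); apply: eq_bigr => i _.
  rewrite mxE psiZ // (bscMr _ (v i) (psi x)) -!mulrA !(trZ tauP).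
  by congr (_ * _); rewrite !mulrA.
- move=> k C _; apply: (mx_form_pos tauP).
    apply/matrixP => i j; rewrite st_mxE mxE [RHS]mxE -phi_st; congr phi.
    by rewrite -[in RHS](sa_stM C) st_mxE.
  (* By [TM], the form to be tested at [f] is a sum of values of [S] at the squares
     [st (Z l) * Z l]. *)
  move=> f; pose Z l := \sum_j T (C l j) (f j).
  have phiD x y : phi (x + y) = phi x + phi y.
    apply: tau_inj => g; rewrite phiE -[x]mul1r -bsc1 TDl SL mulrDl (trD tauP).
    by rewrite !phiE bsc1 !mul1r.
  have phi0 : phi 0 = 0.
    by apply: (addrI (phi 0)); rewrite -phiD !addr0.
  have -> : tau (\sum_i \sum_j st (f i) * (map_mx phi (st C * C)) i j * f j) =
      \sum_l S (st (Z l) * Z l).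
    under [RHS]eq_bigr => l _.
      rewrite /Z st_sum mulr_suml (big_morph S SD S0).
      under eq_bigr => i _ do rewrite mulr_sumr (big_morph S SD S0).
      over.
    rewrite [RHS]exchange_big (tr_sum tauP); apply: eq_bigr => i _ /=.
    rewrite [RHS]exchange_big (tr_sum tauP); apply: eq_bigr => j _ /=.
    rewrite mxE mulr_mxE (big_morph phi phiD phi0) mulr_sumr mulr_suml (tr_sum tauP).
    apply: eq_bigr => l _; rewrite st_mxE TM -phiE.
    by rewrite -[X in tau X = _]mulrA [LHS](trC tauP) -mulrA.
  by apply: sumr_ge0 => l _; exact: Spos.
Qed.

End Arveson.

(** * Contractions and approximate units *)

Section Contractions.
Variables (R : realType) (A F : ucsType R) (phi : A -> F).
Hypothesis phiL : forall c x y, phi (bsc c * x + y) = bsc c * phi x + phi y.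
Hypothesis phi_cp : cp_on setT phi.

(** Contractivity of [a] is encoded in the positive matrix with rows [1, a] and [st a, 1]; its image
    under [phi] is a Gram matrix, and a Schwarz-type inequality follows. *)
Lemma cp_contraction a : nrm a <= 1 -> pos (1 - phi 1) -> nrm (phi a) <= 1.
Proof.
move=> na hq; have [r hr r2] := pos_sub_stM na.
rewrite expr1n rsc1 in r2.
(* An upper triangular square root of that matrix, its last entry satisfying
   [r ^+ 2 = 1 - st a * a]. *)
pose C : 'M[A]_2 := \matrix_(i, j)
  (if i == 0 then (if j == 0 then 1 else a) else (if j == 0 then 0 else r)).
have [//|E hE] := phi_cp (C := C).
have entry i j : phi ((st C * C) i j) = \sum_l st (E l i) * E l j.
  have := congr1 (fun N : 'M[F]_2 => N i j) hE; rewrite mxE => ->.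
  by rewrite mulr_mxE; apply: eq_bigr => l _; rewrite st_mxE.
have C00 : (st C * C) 0 0 = 1.
  by rewrite mulr_mxE !big_ord_recl big_ord0 !st_mxE !mxE /= st1 st0 mulr1 mulr0 !addr0.
have C01 : (st C * C) 0 1 = a.
  by rewrite mulr_mxE !big_ord_recl big_ord0 !st_mxE !mxE /= st1 st0 mul1r mul0r !addr0.
have C11 : (st C * C) 1 1 = 1.
  rewrite mulr_mxE !big_ord_recl big_ord0 !st_mxE !mxE /= hr -expr2 -r2 addr0.
  by rewrite addrC subrK.
have e00 := entry 0 0; have e01 := entry 0 1; have e11 := entry 1 1.
rewrite C00 in e00; rewrite C01 in e01; rewrite C11 in e11.
set z := phi a in e01 *; set q := phi 1 in hq e00 e11.
(* The Gram matrix evaluated at the vector [(z, -1)]. *)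
have key : pos (st z * q * z - st z * z - st z * z + q).
  have -> : st z * q * z - st z * z - st z * z + q =
      \sum_l st (E l 0 * z - E l 1) * (E l 0 * z - E l 1).
    have stz : st z = \sum_l st (E l 1) * E l 0.
      by rewrite e01 st_sum; apply: eq_bigr => l _; rewrite stM stK.
    have t1 : st z * q * z = \sum_l st z * (st (E l 0) * E l 0) * z.
      by rewrite e00 mulr_sumr mulr_suml.
    have t2 : st z * z = \sum_l st z * (st (E l 0) * E l 1).
      by rewrite -mulr_sumr -e01.
    have t3 : st z * z = \sum_l st (E l 1) * E l 0 * z.
      by rewrite -mulr_suml -stz.
    rewrite t1 {1}t2 t3 e11 -!sumrB -big_split /=.
    apply: eq_bigr => l _; rewrite stB stM; ncring.
  by apply: pos_sum => l _; exact: pos_stM.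
apply: nrm_stM_le => //.
have -> : 1 ^+ 2 *r 1 - st z * z =
    (1 - q) + st z * (1 - q) * z + (st z * q * z - st z * z - st z * z + q).
  by rewrite expr1n rsc1; ncring.
by apply: posD => //; apply: posD => //; exact: pos_conj.
Qed.

Lemma cp_nrm_le a : pos (1 - phi 1) -> nrm (phi a) <= nrm a.
Proof.
move=> hq; have phi0 : phi 0 = 0.
  by have := phiL (-1) 0 0; rewrite !bscN !bsc1 !mulN1r !addNr.
have [/nrm0_eq0 ->|na] := eqVneq (nrm a) 0; first by rewrite phi0 !nrm0.
have ap : 0 < nrm a by rewrite lt_neqAle eq_sym na nrm_ge0.
have : nrm (phi ((nrm a)^-1 *r a)) <= 1.
  apply: cp_contraction => //.
  by rewrite nrmZr gtr0_norm ?invr_gt0 // mulVf.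
have := phiL (nrm a)^-1%:C%C a 0; rewrite phi0 !addr0 => ->.
by rewrite nrmZr gtr0_norm ?invr_gt0 // ler_pdivrMl // mulr1.
Qed.

End Contractions.

(** * Approximate units of a subalgebra *)

Section ApproximateUnit.
Variables (R : realType) (A : ucsType R) (B : set A).
Hypothesis B0 : B 0.
Hypothesis BD : forall x y, B x -> B y -> B (x + y).
Hypothesis BZ : forall c x, B x -> B (bsc c * x).
Hypothesis BM : forall x y, B x -> B y -> B (x * y).
Hypothesis Bst : forall x, B x -> B (st x).

(** [u = 1 - (1 - q) ^+ m], with [q] the normalised sum [h] of all [y * st y + st y * y], has no
    constant term and so lies in [B]. For [w = 1 - u], [nrm (w y) ^+ 2] is at most [nrm (w h w)],
    which [nrm_mul_exp] bounds by [T / m]; likewise for [y w]. *)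
Lemma approximate_unit (s : seq A) (e : R) : 0 < e -> (forall y, y \in s -> B y) ->
  exists u, [/\ B u, sa u, nrm u <= 1 & forall y, y \in s -> nrm (u * y * u - y) < e].
Proof.
move=> e0 sB.
pose h := \sum_(y <- s) (y * st y + st y * y).
have sq_pos y : pos (y * st y + st y * y).
  by apply: posD; [rewrite -{1}(stK y)|]; exact: pos_stM.
have hpos : pos h by apply: pos_sum => y _.
have Bh : B h.
  rewrite /h big_seq; apply: big_ind => // y ys.
  have By := sB _ ys; have Bsy := Bst By; apply: (BD); exact: (BM).
pose T := 1 + nrm h; have T0 : 0 < T by rewrite ltr_pwDl // nrm_ge0.
pose q := T^-1 *r h; have hT : h = T *r q by rewrite rscA divff ?gt_eqF // rsc1.
have qpos : pos q by apply: posZ => //; rewrite invr_ge0 ltW.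
have q1 : pos (1 - q).
  rewrite -[X in X - _]rsc1; apply: sa_nrm_pos; first exact: pos_sa.
  rewrite nrmZr gtr0_norm ?invr_gt0 // ler_pdivrMl // mulr1 /T; lra.
have nq1 : nrm (1 - q) <= 1 by apply: pos_nrm_le => //; rewrite rsc1 subKr.
(* Chosen so that [T / m < (e / 2) ^+ 2]; the errors [y w] and [w y u] then stay below [e / 2]
   each. *)
pose m := Num.bound (4 * T / e ^+ 2).
have hm : 4 * T < m%:R * e ^+ 2.
  by rewrite -ltr_pdivrMr ?exprn_gt0 // archi_boundP // divr_ge0 ?mulr_ge0 ?sqr_ge0 // ltW.
pose w := (1 - q) ^+ m; have wpos : pos w by exact: pos_exp.
have ws : sa w by exact: pos_sa.
have nw : nrm w <= 1 by exact: nrm_exp_le1.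
have upos : pos (1 - w) by rewrite -[X in X - _]rsc1; exact: sa_nrm_pos.
have nu : nrm (1 - w) <= 1 by apply: pos_nrm_le => //; rewrite rsc1 subKr.
have BN x : B x -> B (- x) by move=> /(BZ (-1)); rewrite bscN bsc1 mulN1r.
have Bq : B q by exact: BZ.
have Bu : B (1 - w).
  rewrite /w; elim: m {w wpos ws nw upos nu hm} => [|m IH]; first by rewrite expr0 subrr.
  have -> : 1 - (1 - q) ^+ m.+1 = (1 - (1 - q) ^+ m) + (1 - q) ^+ m * q.
    by rewrite exprSr; move: ((1 - q) ^+ m) => v; ncring.
  apply: (BD) => //; elim: m {IH} => [|m IH]; first by rewrite mul1r.
  rewrite exprS -mulrA mulrBl mul1r; apply: (BD) => //; apply: BN; exact: BM.
have nqw : m%:R * nrm (w * h * w) <= T.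
  rewrite hT rscMr rscMl nrmZr gtr0_norm // mulrCA ler_piMr ?(ltW T0) //.
  rewrite /w -comm_1sub -/w.
  apply: le_trans (ler_wpM2l (ler0n _ _) (nrmM _ _)) _.
  apply: le_trans (nrm_mul_exp m qpos q1); rewrite mulrA -/w.
  by rewrite ler_piMr // mulr_ge0 // nrm_ge0.
have small x : pos (x * st x) -> pos (h - x * st x) -> nrm (w * x) < e / 2.
  move=> xp hx; have e2 : 0 < e / 2 by lra.
  rewrite -(ltr_pXn2r (n := 2)) ?nnegrE ?nrm_ge0 ?(ltW e2) //.
  have -> : nrm (w * x) ^+ 2 = nrm (w * (x * st x) * w).
    by rewrite -nrm_st -nrm_cstar stK stM ws !mulrA.
  have mono : nrm (w * (x * st x) * w) <= nrm (w * h * w).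
    apply: nrm_mono; first by rewrite -{1}ws; exact: pos_conj.
    have -> : w * h * w - w * (x * st x) * w = st w * (h - x * st x) * w.
      by rewrite ws; ncring.
    exact: pos_conj.
  have m0 : 0 < m%:R :> R.
    have : 0 < 4 * T by rewrite mulr_gt0.
    have := sqr_ge0 e; have := ler0n R m; nra.
  apply: le_lt_trans mono _; rewrite -(ltr_pM2l m0); apply: le_lt_trans nqw _.
  move: hm; rewrite -[(e / 2) ^+ 2]/((e / 2) * (e / 2)) expr2; lra.
have split_h y : y \in s -> pos (h - (y * st y + st y * y)).
  move=> ys; rewrite /h (big_rem y ys) /= addrAC subrr add0r; exact: pos_sum.
exists (1 - w); split=> //; first by apply: saB => //; exact: sa1.
move=> y ys.
have h1 : nrm (w * y) < e / 2.
  apply: small; first by rewrite -{1}(stK y); exact: pos_stM.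
  have -> : h - y * st y = (h - (y * st y + st y * y)) + st y * y by ncring.
  by apply: posD; [exact: split_h|exact: pos_stM].
have h2 : nrm (y * w) < e / 2.
  rewrite -nrm_st stM ws; apply: small; first by rewrite stK; exact: pos_stM.
  rewrite stK.
  have -> : h - st y * y = (h - (y * st y + st y * y)) + y * st y by ncring.
  by apply: posD; [exact: split_h|rewrite -{1}(stK y); exact: pos_stM].
have -> : (1 - w) * y * (1 - w) - y = - (y * w) - w * y * (1 - w) by ncring.
apply: le_lt_trans (nrmB _ _) _; rewrite nrmN.
have := nrmM (w * y) (1 - w); have := nrm_ge0 (w * y); have := nrm_ge0 (1 - w); nra.
Qed.

End ApproximateUnit.

(** * Transfer between [A] and its unital alias *)

Section Bridge.
Variables (R : realType) (A : cstarAlgType R) (e : A).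
Hypothesis he : forall x, e ** x = x /\ x ** e = x.
Local Notation U := (ucs_of he).

Lemma ucs_bscE c (x : U) : bsc c * x = c *: x.
Proof. exact: uscE. Qed.

Lemma mxmul_mxstarE k (C : 'M[U]_k) : mxmul (mxstar C : 'M[A]_k) C = st C * C.
Proof.
apply/matrixP => i j; rewrite [LHS]mxE [RHS]mxE; apply: eq_bigr => l _.
by rewrite !mxE.
Qed.

Lemma ucs_closed (B : set A) (v : nat -> U) (l : U) : closed B ->
  (forall n, B (v n)) -> lim_to v l -> B l.
Proof.
move=> cB Bv vl; pose w : nat -> A := v.
suff wl : w @ \oo --> (l : A) by apply: (closed_cvg B cB _ l wl); exact: nearW.
apply/cvgrPdist_lt => d d0.
have dE : d = (complex.Re d)%:C%C by rewrite RRe_real // gtr0_real.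
move: d0; rewrite dE ltcR => /vl [n0 hn]; exists n0 => // n /= /hn.
by rewrite distrC cnrmE ltcR.
Qed.

End Bridge.

Lemma contractive_cnrm (R : realType) (A F : cstarAlgType R) (D : set A) (f : A -> F) :
  contractive D f <-> forall x, D x -> cnrm (f x) <= cnrm x.
Proof.
by split=> h x /h; rewrite !cnrmE lecR.
Qed.

(** * Extending completely positive contractions from a subalgebra *)

Section Extension.
Variables (R : realType) (A F : cstarAlgType R) (e : A) (B : set A).
Hypothesis he : forall x, e ** x = x /\ x ** e = x.
Hypothesis F_fin : finite_dimensional F.
Hypothesis hB : is_cstar_subalgebra B.
Variables (psi : A -> F) (u : A).
Hypothesis psi_cp : completely_positive B [set: F] psi.
Hypothesis psi_contr : contractive B psi.
Hypothesis Bu : B u.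
Hypothesis u_sa : star u = u.
Hypothesis u_contr : cnrm u <= 1.
Local Notation U := (ucs_of he).

Let BM x y : B x -> B y -> B (x ** y). Proof. by case: hB => _ _ _ h _; exact: h. Qed.
Let BL c x y : B x -> B y -> B (c *: x + y). Proof. by case: hB => _ _ h _ _; exact: h. Qed.
Let Bst x : B x -> B (star x). Proof. by case: hB => _ _ _ _ h; exact: h. Qed.
Let B0 : B 0. Proof. by case: hB. Qed.

(* The idealizer of [B] is a closed unital subalgebra, which replaces [B + C 1]. *)
Let D : set U := [set x | forall b : A, B b -> B ((x : A) ** b) /\ B (b ** (x : A))].

Let D_closed_subalg : closed_subalg D.
Proof.
split.
- move=> b Bb; change (B (e ** b) /\ B (b ** e)).
  by rewrite (he b).1 (he b).2.
- move=> c x y Dx Dy b Bb; have [x1 x2] := Dx b Bb; have [y1 y2] := Dy b Bb.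
  rewrite ucs_bscE; split.
    by have := BL c%:C%C x1 y1; rewrite -cmulZl -cmulDl.
  by have := BL c%:C%C x2 y2; rewrite -cmulZr -cmulDr.
- move=> x y Dx Dy b Bb; have [x1 x2] := Dx b Bb; have [y1 y2] := Dy b Bb.
  rewrite -[x * y]/((x : A) ** (y : A)); split.
    by rewrite -cmulA; have [] := Dx _ y1.
  by rewrite cmulA; have [] := Dy _ x2.
- move=> v l Dv vl b Bb; have [cB _ _ _ _] := hB; split.
    apply: (ucs_closed (he := he) (v := fun n => v n * (b : U)) cB).
      by move=> n; have [] := Dv n b Bb.
    exact: limM vl (lim_const _).
  apply: (ucs_closed (he := he) (v := fun n => (b : U) * v n) cB).
    by move=> n; have [] := Dv n b Bb.
  exact: limM (lim_const _) vl.
Qed.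

Let D_st (x : U) : D x -> D (st x).
Proof.
move=> Dx b Bb; have [x1 x2] := Dx _ (Bst Bb).
by split; [have := Bst x2|have := Bst x1]; rewrite starM starK.
Qed.

Let D_sc c (x : U) : D x -> D (bsc c * x).
Proof.
move=> Dx b Bb; have [x1 x2] := Dx b Bb; rewrite ucs_bscE; split.
  by have := BL c x1 B0; rewrite addr0 -cmulZl.
by have := BL c x2 B0; rewrite addr0 -cmulZr.
Qed.

Let DB x : B x -> D x. Proof. by move=> Bx b Bb; split; exact: BM. Qed.

(** [x |-> psi (u x u)] makes sense on [D], where [x u] falls in [B]. Its extension is contractive
    because its value at 1, [psi (u u)], has norm at most 1. *)
Lemma ex_cp_extension : exists phi : A -> F,
  [/\ completely_positive [set: A] [set: F] phi, contractive [set: A] phi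
    & forall x, B x -> phi x = psi (u ** x ** u)].
Proof.
have [eF hF] := fin_unital F_fin.
have [tau [tauP [t [t_frame t_tr]]]] := ex_trace hF F_fin.
have [_ psiL psiP] := psi_cp.
have Duu (x : U) : D x -> B (u ** x ** u).
  by move=> Dx; exact: BM (Dx u Bu).2 Bu.
pose psi' (x : U) : ucs_of hF := psi (u ** (x : A) ** u).
have psi'L c (x y : U) : D x -> D y -> psi' (bsc c * x + y) = bsc c * psi' x + psi' y.
  move=> Dx Dy; rewrite !ucs_bscE.
  apply: etrans (psiL c _ _ (Duu _ Dx) (Duu _ Dy)); apply: (congr1 psi).
  by rewrite -cmulZl -cmulZr -cmulDl -cmulDr.
have psi'_cp : cp_on D psi'.
  (* Compressing [st C * C] by [u] gives the square of [C u], whose entries lie in [B], while those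
     of [C] lie only in [D]. *)
  move=> k C DC; pose C' : 'M[A]_k := \matrix_(i, j) ((C i j : A) ** u).
  have BC' : mx_over B C' by move=> i j; rewrite mxE; have [] := DC i j u Bu.
  have [E _ hE] := psiP k _ (ex_intro2 _ _ C' BC' erefl).
  exists E; rewrite -(mxmul_mxstarE (he := hF)) -hE; apply/matrixP => i j.
  rewrite [LHS]mxE [RHS]mxE; apply: (congr1 psi).
  change ((u : U) * (st C * C) i j * (u : U) = mxmul (mxstar C') C' i j).
  rewrite mulr_mxE mulr_sumr mulr_suml [RHS]mxE; apply: eq_bigr => l _.
  rewrite st_mxE !mxE starM u_sa.
  change (u ** (star (C l i) ** C l j) ** u = u ** star (C l i) ** (C l j ** u)).
  by rewrite !cmulA.
have [phi [phiL phiE phi_cp]] :=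
  arveson D_closed_subalg D_st D_sc psi'L psi'_cp tauP t_frame t_tr.
exists phi; split.
- split=> // [c x y _ _|k M [C _ ->]].
    by have := phiL c x y; rewrite !ucs_bscE.
  have [E hE] := phi_cp k C (fun _ _ => I).
  by exists E => //; rewrite (mxmul_mxstarE (he := he)) hE (mxmul_mxstarE (he := hF)).
- apply/contractive_cnrm => x _; apply: (cp_nrm_le phiL phi_cp).
  have D1 : D 1 by case: D_closed_subalg.
  rewrite -[X in X - _]rsc1; apply: sa_nrm_pos.
    have [//|E hE] := phi_cp 1%N (const_mx 1).
    have := congr1 (fun N : 'M[ucs_of hF]_1 => N 0 0) hE.
    rewrite mxE mulr_mxE big_ord1 st_mxE !mxE st1 mulr1 => ->.
    by rewrite big_ord1 st_mxE; exact: sa_stM.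
  rewrite phiE // /psi' -[(u ** _) ** u]/((u : U) * 1 * (u : U)) mulr1.
  have /contractive_cnrm h := psi_contr.
  apply: le_trans (h _ (BM Bu Bu)) _.
  apply: le_trans (nrmM (u : U) u) _; rewrite mulr_ile1 // ?nrm_ge0 //; exact: nrm_ge0.
- by move=> x Bx; rewrite phiE //; exact: DB.
Qed.

End Extension.

(** * Direct sums of decompositions *)

Section ProductAlgebra.
Variables (R : realType) (F1 F2 : cstarAlgType R).
Local Notation F := (F1 * F2)%type.

HB.instance Definition _ := Pointed.on F.

Let prod_complete (G : set_system F) : ProperFilter G -> cauchy G -> cvg G.
Proof.
move=> GF /cauchyP Gc.
have /cauchy_cvg /cvg_ex [l1 h1] : cauchy (fst @ G).
  apply/cauchyP => d /Gc [x hx]; exists x.1.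
  apply: (@filterS _ G _ (ball x d)) hx => y hy.
  by have [] : ball x.1 d y.1 /\ ball x.2 d y.2 := hy.
have /cauchy_cvg /cvg_ex [l2 h2] : cauchy (snd @ G).
  apply/cauchyP => d /Gc [x hx]; exists x.2.
  apply: (@filterS _ G _ (ball x d)) hx => y hy.
  by have [] : ball x.1 d y.1 /\ ball x.2 d y.2 := hy.
apply/cvg_ex; exists (l1, l2).
have eid : (fun x : F => (x.1, x.2)) = id by apply/funext => -[].
have := cvg_pair h1 h2; rewrite eid => h P hP.
exact: (h _ (nbhs_filter l1) (nbhs_filter l2) P hP).
Qed.

HB.instance Definition _ := Uniform_isComplete.Build F prod_complete.

Definition pmul (x y : F) : F := (x.1 ** y.1, x.2 ** y.2).
Definition pstar (x : F) : F := (star x.1, star x.2).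

Lemma pair_normE (x : F) : `|x| = (Num.max (cnrm x.1) (cnrm x.2))%:C%C.
Proof.
rewrite prod_normE !cnrmE.
by case: leP => h; [rewrite max_r ?lecR|rewrite max_l ?lecR // ltW].
Qed.

Let pmulA : associative pmul.
Proof. by move=> x y z; rewrite /pmul /= !cmulA. Qed.
Let pmulDl : left_distributive pmul +%R.
Proof. by move=> x y z; rewrite /pmul /= !cmulDl. Qed.
Let pmulDr : right_distributive pmul +%R.
Proof. by move=> x y z; rewrite /pmul /= !cmulDr. Qed.
Let pmulZl (c : R[i]) x y : pmul (c *: x) y = c *: pmul x y.
Proof. by rewrite /pmul /= !cmulZl. Qed.
Let pmulZr (c : R[i]) x y : pmul x (c *: y) = c *: pmul x y.
Proof. by rewrite /pmul /= !cmulZr. Qed.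
Let pstarK : involutive pstar.
Proof. by move=> [x y]; rewrite /pstar /= !starK. Qed.
Let pstarD : {morph pstar : x y / x + y}.
Proof. by move=> x y; rewrite /pstar /= !starD. Qed.
Let pstarZ (c : R[i]) x : pstar (c *: x) = conjc c *: pstar x.
Proof. by rewrite /pstar /= !starZ. Qed.
Let pstarM x y : pstar (pmul x y) = pmul (pstar y) (pstar x).
Proof. by rewrite /pstar /= !starM. Qed.
Let cnrm_ge0 (A : cstarAlgType R) (x : A) : 0 <= cnrm x.
Proof. by have := normr_ge0 x; rewrite cnrmE lecR. Qed.
Let pnorm_mul (x y : F) : `|pmul x y| <= `|x| * `|y|.
Proof.
rewrite !pair_normE -rmorphM lecR ge_max; apply/andP; split.
  have : `|x.1 ** y.1| <= `|x.1| * `|y.1| by exact: norm_cmul.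
  rewrite !cnrmE -rmorphM lecR => /le_trans; apply.
  by apply: ler_pM; rewrite ?cnrm_ge0 // le_max lexx.
have : `|x.2 ** y.2| <= `|x.2| * `|y.2| by exact: norm_cmul.
rewrite !cnrmE -rmorphM lecR => /le_trans; apply.
by apply: ler_pM; rewrite ?cnrm_ge0 // le_max lexx orbT.
Qed.
Let pcstar (x : F) : `|pmul (pstar x) x| = `|x| ^+ 2.
Proof.
have cs (A : cstarAlgType R) (y : A) : cnrm (star y ** y) = cnrm y ^+ 2.
  by apply: (@complexI R); rewrite rmorphXn /= -!cnrmE; exact: cstar_identity.
rewrite !pair_normE -rmorphXn /= !cs; congr (_%:C%C).
have [h|h] := leP (cnrm x.1) (cnrm x.2).
  by rewrite max_r // lerXn2r ?nnegrE ?cnrm_ge0.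
by rewrite max_l // lerXn2r ?nnegrE ?cnrm_ge0 // ltW.
Qed.

HB.instance Definition _ := isCStarAlgebra.Build R F
  pmulA pmulDl pmulDr pmulZl pmulZr pstarK pstarD pstarZ pstarM pnorm_mul pcstar.

End ProductAlgebra.

Section SpanLemmas.
Variables (K : pzRingType) (V W : lmodType K).

Lemma linear_span_add (X : set V) y z :
  linear_span X y -> linear_span X z -> linear_span X (y + z).
Proof.
move=> [n [c [x [hx ->]]]] [m [d [w [hw ->]]]].
exists (n + m)%N.
exists (fun i => match fintype.split i with inl j => c j | inr j => d j end).
exists (fun i => match fintype.split i with inl j => x j | inr j => w j end).
split; first by move=> i; case: fintype.split.
rewrite big_split_ord /=; congr (_ + _); apply: eq_bigr => i _.
  by rewrite (unsplitK (inl i)).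
by rewrite (unsplitK (inr i)).
Qed.

Lemma linear_span_image (X : set V) (Y : set W) (f : V -> W) y :
  (forall c x y, f (c *: x + y) = c *: f x + f y) ->
  (forall x, X x -> Y (f x)) -> linear_span X y -> linear_span Y (f y).
Proof.
move=> fl XY [n [c [x [hx ->]]]]; exists n, c, (f \o x); split=> [i|]; first exact: XY.
have f0 : f 0 = 0 by have := fl (-1) 0 0; rewrite !scaleN1r !addNr.
elim: (index_enum _) => [|i s IH]; first by rewrite !big_nil.
by rewrite !big_cons fl IH.
Qed.

End SpanLemmas.

(** * Maps that factor through order zero summands *)

Section Decompositions.
Variables (R : realType) (A : cstarAlgType R) (e : A).
Hypothesis he : forall x, e ** x = x /\ x ** e = x.

(** Exact factorisations, counted by their number of summands, so that they can be added;
    approximation enters later, through the choice of [T]. *)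
Definition decomposable (k : nat) (T : A -> A) : Prop :=
  exists (F : cstarAlgType R) (Fj : 'I_k -> set F) (psi : A -> F) (phi : F -> A),
    [/\ finite_dimensional F /\ is_direct_sum Fj,
        completely_positive [set: A] [set: F] psi /\ contractive [set: A] psi,
        completely_positive [set: F] [set: A] phi,
        forall j, contractive (Fj j) phi /\ order_zero (Fj j) phi
      & forall a, phi (psi a) = T a].

(** Positivity means being one square, so adding two of them takes a square root in the matrix
    algebra. *)
Lemma mx_positive_add k (M N : 'M[A]_k) : mx_positive_in [set: A] M ->
  mx_positive_in [set: A] N -> mx_positive_in [set: A] (M + N).
Proof.
move=> [C _ hM] [C' _ hN].
have hM' : M = st (C : 'M[ucs_of he]_k) * C :> 'M[ucs_of he]_k.
  by rewrite hM; exact: (mxmul_mxstarE (he := he)).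
have hN' : N = st (C' : 'M[ucs_of he]_k) * C' :> 'M[ucs_of he]_k.
  by rewrite hN; exact: (mxmul_mxstarE (he := he)).
have : sos (M + N : 'M[ucs_of he]_k).
  by apply: sosD; rewrite ?hM' ?hN'; exact: sos_stM.
move=> /mx_sqrt [r [_ [[hr _] r2 _ _ _]]]; exists r => //.
apply: etrans (esym r2) _.
by have := mxmul_mxstarE (he := he) r; rewrite hr -expr2 => ->.
Qed.

Section Add.
Variables (k1 k2 : nat) (F1 F2 : cstarAlgType R).
Variables (S1 : 'I_k1 -> set F1) (S2 : 'I_k2 -> set F2).
Local Notation F := (F1 * F2)%type.

Definition sum_set (i : 'I_(k1 + k2)) : set F :=
  match fintype.split i with
  | inl j => [set p | S1 j p.1 /\ p.2 = 0]
  | inr j => [set p | p.1 = 0 /\ S2 j p.2]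
  end.

Lemma pair_mulE (x y : F) : x ** y = (x.1 ** y.1, x.2 ** y.2). Proof. by []. Qed.
Lemma pair_starE (x : F) : star x = (star x.1, star x.2). Proof. by []. Qed.

Lemma finite_dimensional_prod :
  finite_dimensional F1 -> finite_dimensional F2 -> finite_dimensional F.
Proof.
move=> [n [f hf]] [m [g hg]]; exists (n + m)%N.
exists (fun i => match fintype.split i with inl j => (f j, 0) | inr j => (0, g j) end).
apply/seteqP; split=> // -[y1 y2] _.
have -> : (y1, y2) = (y1, 0) + (0, y2) :> F by rewrite -[RHS]/(y1 + 0, 0 + y2) addr0 add0r.
apply: linear_span_add.
  apply: (@linear_span_image _ F1 F (range f) _ (fun y => (y, 0))).
  - by move=> c x y; rewrite -[RHS]/(c *: x + y, c *: 0 + 0) scaler0 addr0.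
  - by move=> _ [j _ <-]; exists (lshift m j) => //; rewrite (unsplitK (inl j)).
  - by rewrite hf.
apply: (@linear_span_image _ F2 F (range g) _ (fun y => (0, y))).
- by move=> c x y; rewrite -[RHS]/(c *: 0 + 0, c *: x + y) scaler0 addr0.
- by move=> _ [j _ <-]; exists (rshift n j) => //; rewrite (unsplitK (inr j)).
- by rewrite hg.
Qed.


Lemma closed_fst (B : set F1) : closed B -> closed [set p : F | B p.1].
Proof. by apply: preimage_closed => p _; exact: cvg_fst. Qed.
Lemma closed_snd (B : set F2) : closed B -> closed [set p : F | B p.2].
Proof. by apply: preimage_closed => p _; exact: cvg_snd. Qed.

Lemma is_direct_sum_prod :
  is_direct_sum S1 -> is_direct_sum S2 -> is_direct_sum sum_set.
Proof.
move=> [sub1 ort1 dec1] [sub2 ort2 dec2]; split.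
- move=> i; rewrite /sum_set; case: (fintype.split i) => j.
    have [cB B0 BL BM Bst] := sub1 j; split=> /=.
    + apply: closedI; [exact: closed_fst|apply: (@closed_snd [set 0])].
      by apply: compact_closed; [exact: norm_hausdorff|exact: compact_set1].
    + by split.
    + move=> c x y [x1 x2] [y1 y2]; split=> /=; first exact: BL.
      by rewrite x2 y2 scaler0 addr0.
    + move=> x y [x1 x2] [y1 y2]; split=> /=; first exact: BM.
      by rewrite x2 cmul0l.
    + by move=> x [x1 x2]; split=> /=; [exact: Bst|rewrite x2 star0].
  have [cB B0 BL BM Bst] := sub2 j; split=> /=.
  + apply: closedI; [apply: (@closed_fst [set 0])|exact: closed_snd].
    by apply: compact_closed; [exact: norm_hausdorff|exact: compact_set1].
  + by split.
  + move=> c x y [x1 x2] [y1 y2]; split=> /=; last exact: BL.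
    by rewrite x1 y1 scaler0 addr0.
  + move=> x y [x1 x2] [y1 y2]; split=> /=; last exact: BM.
    by rewrite x1 cmul0l.
  + by move=> x [x1 x2]; split=> /=; [rewrite x1 star0|exact: Bst].
- move=> i i' x y ii'; rewrite /sum_set pair_mulE.
  rewrite -(splitK i) -(splitK i') in ii' *.
  case: (fintype.split i) ii' => j; case: (fintype.split i') => j' /= ii'.
  + rewrite !(unsplitK (inl _)) /= => -[x1 x2] [y1 y2].
    by rewrite x2 cmul0l (ort1 j j').
  + rewrite (unsplitK (inl _)) (unsplitK (inr _)) /= => -[x1 x2] [y1 y2].
    by rewrite x2 y1 cmul0l cmul0r.
  + rewrite (unsplitK (inl _)) (unsplitK (inr _)) /= => -[x1 x2] [y1 y2].
    by rewrite x1 y2 cmul0l cmul0r.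
  + rewrite !(unsplitK (inr _)) /= => -[x1 x2] [y1 y2].
    rewrite x1 cmul0l (ort2 j j') //.
    by apply: contra ii' => /eqP ->.
- move=> [a1 a2]; have [s1 [[s1S s1E] s1u]] := dec1 a1.
  have [s2 [[s2S s2E] s2u]] := dec2 a2.
  pose s (i : 'I_(k1 + k2)) : F :=
    match fintype.split i with inl j => (s1 j, 0) | inr j => (0, s2 j) end.
  have sum_pair n (f : 'I_n -> F) : \sum_i f i = (\sum_i (f i).1, \sum_i (f i).2).
    elim: (index_enum _) => [|i r IH]; first by rewrite !big_nil.
    by rewrite !big_cons IH.
  exists s; split.
    split.
      by move=> i; rewrite /sum_set /s; case: (fintype.split i) => j.
    rewrite sum_pair !big_split_ord /=.
    congr (_, _).
      rewrite [X in _ + X]big1 ?addr0 => [|j _]; last by rewrite /s (unsplitK (inr j)).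
      by rewrite s1E; apply: eq_bigr => j _; rewrite /s (unsplitK (inl j)).
    rewrite [X in X + _]big1 ?add0r => [|j _]; last by rewrite /s (unsplitK (inl j)).
    by rewrite s2E; apply: eq_bigr => j _; rewrite /s (unsplitK (inr j)).
  move=> s' [s'S]; rewrite sum_pair !big_split_ord /= => -[e1 e2].
  have L j : S1 j (s' (lshift k2 j)).1 /\ (s' (lshift k2 j)).2 = 0.
    by have := s'S (lshift k2 j); rewrite /sum_set (unsplitK (inl j)).
  have L' j : (s' (rshift k1 j)).1 = 0 /\ S2 j (s' (rshift k1 j)).2.
    by have := s'S (rshift k1 j); rewrite /sum_set (unsplitK (inr j)).
  have u1 : s1 = fun j => (s' (lshift k2 j)).1.
    apply: s1u; split=> [j|]; first by have [] := L j.
    by rewrite {1}e1 [X in _ + X]big1 ?addr0 // => j _; have [] := L' j.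
  have u2 : s2 = fun j => (s' (rshift k1 j)).2.
    apply: s2u; split=> [j|]; first by have [] := L' j.
    by rewrite {1}e2 [X in X + _]big1 ?add0r // => j _; have [] := L j.
  apply/funext => i; rewrite /s -(splitK i); case: (fintype.split i) => j /=.
    rewrite (unsplitK (inl j)) u1; case: (s' (lshift k2 j)) (L j) => x y /= [_ ->] //.
  rewrite (unsplitK (inr j)) u2; case: (s' (rshift k1 j)) (L' j) => x y /= [-> _] //.
Qed.

Lemma completely_positive_pair (psi1 : A -> F1) (psi2 : A -> F2) :
  completely_positive [set: A] [set: F1] psi1 ->
  completely_positive [set: A] [set: F2] psi2 ->
  completely_positive [set: A] [set: F] (fun a => (psi1 a, psi2 a)).
Proof.
move=> [_ l1 p1] [_ l2 p2]; split=> // [c x y _ _|k M hM].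
  by rewrite l1 // l2.
have [E1 _ h1] := p1 k M hM; have [E2 _ h2] := p2 k M hM.
exists (\matrix_(i, j) (E1 i j, E2 i j)) => //; apply/matrixP => i j.
have := congr1 (fun N : 'M[F1]_k => N i j) h1.
have := congr1 (fun N : 'M[F2]_k => N i j) h2; rewrite !mxE => -> ->.
elim: (index_enum _) => [|l r IH]; first by rewrite !big_nil.
by rewrite !big_cons -IH !mxE.
Qed.

Lemma completely_positive_sum (phi1 : F1 -> A) (phi2 : F2 -> A) :
  completely_positive [set: F1] [set: A] phi1 ->
  completely_positive [set: F2] [set: A] phi2 ->
  completely_positive [set: F] [set: A] (fun p => phi1 p.1 + phi2 p.2).
Proof.
move=> [_ l1 p1] [_ l2 p2]; split=> // [c x y _ _|k M [C _ ->]].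
  by rewrite l1 // l2 //= scalerDr addrACA.
pose C1 := map_mx fst C; pose C2 := map_mx snd C.
have := mx_positive_add (p1 k _ (ex_intro2 _ _ C1 (fun _ _ => I) erefl))
  (p2 k _ (ex_intro2 _ _ C2 (fun _ _ => I) erefl)).
congr mx_positive_in; apply/matrixP => i j; rewrite !mxE.
congr (phi1 _ + phi2 _).
  elim: (index_enum _) => [|l r IH]; first by rewrite !big_nil.
  by rewrite !big_cons IH !mxE.
elim: (index_enum _) => [|l r IH]; first by rewrite !big_nil.
by rewrite !big_cons IH !mxE.
Qed.

End Add.

Lemma cp_0 (F : cstarAlgType R) (phi : F -> A) :
  completely_positive [set: F] [set: A] phi -> phi 0 = 0.
Proof. by move=> [_ h _]; have := h (-1) 0 0 I I; rewrite !scaleN1r !addNr. Qed.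

(** The maximum norm keeps the pair of [psi1] and [psi2] contractive. Each summand lives in one
    coordinate, so only one of [phi1], [phi2] acts on it, and contractivity and order zero are
    inherited. *)
Lemma decomposable_add k1 k2 (T1 T2 : A -> A) : decomposable k1 T1 ->
  decomposable k2 T2 -> decomposable (k1 + k2) (fun a => T1 a + T2 a).
Proof.
move=> [F1 [S1 [psi1 [phi1 [[f1 d1] [p1 c1] q1 o1 t1]]]]].
move=> [F2 [S2 [psi2 [phi2 [[f2 d2] [p2 c2] q2 o2 t2]]]]].
exists (F1 * F2)%type, (sum_set S1 S2), (fun a => (psi1 a, psi2 a)),
  (fun p => phi1 p.1 + phi2 p.2); split.
- by split; [exact: finite_dimensional_prod|exact: is_direct_sum_prod].
- split; first exact: completely_positive_pair.
  move=> a _; rewrite pair_normE cnrmE lecR ge_max.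
  by move/contractive_cnrm : c1 => -> //; move/contractive_cnrm : c2 => ->.
- exact: completely_positive_sum.
- have z1 := cp_0 q1; have z2 := cp_0 q2.
  move=> i; rewrite /sum_set; case: (fintype.split i) => j.
    have [cj oj] := o1 j; split.
      move=> [x y] /= [Sx ->]; rewrite z2 addr0; apply: le_trans (cj _ Sx) _.
      by rewrite pair_normE cnrmE lecR le_max lexx.
    move=> a b [c [c1' c2'] ->] [d [d1' d2'] ->]; rewrite !pair_mulE !pair_starE /=.
    rewrite c2' d2' !star0 !cmul0l z2 !addr0 => /(congr1 fst) /= ab.
    by apply: (oj (star c.1 ** c.1) (star d.1 ** d.1)) => //; [exists c.1|exists d.1].
  have [cj oj] := o2 j; split.
    move=> [x y] /= [-> Sy]; rewrite z1 add0r; apply: le_trans (cj _ Sy) _.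
    by rewrite pair_normE cnrmE lecR le_max lexx orbT.
  move=> a b [c [c1' c2'] ->] [d [d1' d2'] ->]; rewrite !pair_mulE !pair_starE /=.
  rewrite c1' d1' !star0 !cmul0l z1 !add0r => /(congr1 snd) /= ab.
  by apply: (oj (star c.2 ** c.2) (star d.2 ** d.2)) => //; [exists c.2|exists d.2].
- by move=> a /=; rewrite t1 t2.
Qed.

End Decompositions.

(** * Norm control and assembly *)

Section Approximation.
Variables (R : realType) (A : cstarAlgType R) (e : A).
Hypothesis he : forall x, e ** x = x /\ x ** e = x.
Local Notation U := (ucs_of he).

Lemma direct_sum_nrm_le (F : cstarAlgType R) k (Fj : 'I_k -> set F) (s : 'I_k -> F) j :
  finite_dimensional F -> is_direct_sum Fj -> (forall i, Fj i (s i)) ->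
  cnrm (s j) <= cnrm (\sum_i s i).
Proof.
move=> /fin_unital [u hu] [sub ort _] hs.
pose r i : ucs_of hu := s i.
have diag : st (\sum_i r i) * (\sum_i r i) = \sum_i st (r i) * r i.
  rewrite st_sum mulr_suml; apply: eq_bigr => i _.
  rewrite mulr_sumr (bigD1 i) //= big1 ?addr0 // => l li.
  apply: (ort i l) => //; first by rewrite eq_sym.
  by have [_ _ _ _ h] := sub i; apply: h.
suff h : nrm (r j) <= nrm (\sum_i r i) by exact: h.
rewrite -(ler_pXn2r (n := 2)) ?nnegrE ?nrm_ge0 // -!nrm_cstar diag.
apply: nrm_mono; first exact: pos_stM.
rewrite (bigD1 j) //= addrAC subrr add0r.
by apply: pos_sum => i _; exact: pos_stM.
Qed.

Lemma decomposable_linear k (T : A -> A) : decomposable k T ->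
  forall c x y, T (c *: x + y) = c *: T x + T y.
Proof.
move=> [F [Fj [psi [phi [_ [[_ l1 _] _] [_ l2 _] _ hT]]]]] c x y.
by rewrite -!hT l1 // l2.
Qed.

(** [phi] is contractive on each summand only, so the [k] components of [psi a] contribute at most
    [cnrm a] each. *)
Lemma decomposable_bound k (T : A -> A) : decomposable k T ->
  forall a, cnrm (T a) <= k%:R * cnrm a.
Proof.
move=> [F [Fj [psi [phi [[fF dF] [_ c1] cphi oj hT]]]]] a; rewrite -hT.
have [_ _ dec] := dF; have [s [[sS sE] _]] := dec (psi a).
have phi0 := cp_0 cphi.
have [_ lphi _] := cphi.
have -> : phi (psi a) = \sum_j phi (s j).
  rewrite {1}sE; elim: (index_enum _) => [|i r IH]; first by rewrite !big_nil.
  by rewrite !big_cons -IH; have := lphi 1 (s i) (\sum_(j <- r) s j) I I; rewrite !scale1r.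
apply: le_trans (nrm_sum (V := U) _ _ _) _.
apply: (@le_trans _ _ (\sum_(j < k) cnrm a)); last by rewrite sumr_const card_ord mulr_natl.
apply: ler_sum => j _.
have [/contractive_cnrm cj _] := oj j.
apply: le_trans (cj _ (sS j)) _.
apply: le_trans (direct_sum_nrm_le j fF dF sS) _.
by rewrite -sE; move/contractive_cnrm : c1 => ->.
Qed.

Lemma decomposable_sum m k (T : 'I_m.+1 -> A -> A) :
  (forall i, decomposable k (T i)) ->
  decomposable (m.+1 * k) (fun a => \sum_i T i a).
Proof.
elim: m T => [|m IH] T hT.
  rewrite mul1n; have -> : (fun a => \sum_i T i a) = T ord0 by apply/funext => a; rewrite big_ord1.
  exact: hT.
rewrite mulSn.
have -> : (fun a => \sum_i T i a) = fun a => T ord0 a + \sum_i T (lift ord0 i) a.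
  by apply/funext => a; rewrite big_ord_recl.
apply: (decomposable_add he) => //; exact: IH.
Qed.

(** The approximation in [B] is requested at [u y u] for [y = b x (star b)], since the extended map
    takes the value [psi (u y u)] at [y]. Half of [eps] pays for it and half for replacing [u y u]
    by [y]. *)
Lemma compression_decomposable (B : set A) (b : A) N (s : seq A) (eps : R) :
  is_cstar_subalgebra B -> nuclear_dim_le N B -> cnrm b <= 1 ->
  (forall x, x \in s -> B (b ** x ** star b)) -> 0 < eps ->
  exists T, decomposable N.+1 T /\
    forall x, x \in s -> cnrm (T x - b ** x ** star b) < eps.
Proof.
move=> hB nB nb sB eps0; have [cB B0 BL BM Bst] := hB.
have e2 : 0 < eps / 2 by lra.
pose s1 : seq U := [seq b ** x ** star b | x <- s].
have s1B y : y \in s1 -> B y by move=> /mapP [x xs ->]; exact: sB.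
have BD (x y : U) : B x -> B y -> B (x + y).
  by move=> hx hy; have := BL 1 x y hx hy; rewrite scale1r.
have BZ c (x : U) : B x -> B (bsc c * x).
  by move=> hx; have := BL c x 0 hx B0; rewrite ucs_bscE addr0.
have [u [Bu us nu hu]] :=
  approximate_unit (A := U) B0 BD BZ (fun x y => BM x y) (fun x => Bst x) e2 s1B.
pose s2 : set A := [set` [seq u ** y ** u | y <- s1]].
have s2B : s2 `<=` B.
  by move=> _ /= /mapP [y ys ->]; apply: (BM) => //; apply: (BM) => //; exact: s1B.
have e2C : 0 < (eps / 2)%:C%C by rewrite ltcR.
have [|F [Fj [psi [phi [[fF dF] [psi_cp psi_c] phi_cp oj happ]]]]] := nB s2 _ _ s2B e2C.
  by apply/finite_seqP; eexists.
have [psi2 [cp2 c2 hpsi2]] := ex_cp_extension he fF hB psi_cp psi_c Bu us nu.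
exists (fun a => phi (psi2 (b ** a ** star b))); split.
  exists F, Fj, (fun a => psi2 (b ** a ** star b)), phi; split=> //.
  - have [_ l2 p2] := cp2; split.
      split=> // [c x y _ _|k M [C _ ->]].
        by rewrite cmulDr cmulDl cmulZr cmulZl l2.
      pose C' := map_mx (fun x => x ** star b) C.
      have [E _ hE] := p2 k _ (ex_intro2 _ _ C' (fun _ _ => I) erefl).
      exists E => //; rewrite -hE; apply/matrixP => i j; rewrite [LHS]mxE [RHS]mxE.
      congr psi2; rewrite !mxE.
      change ((b : U) * (\sum_l (mxstar C i l : U) * C l j) * star b =
        \sum_l (mxstar C' i l : U) * C' l j).
      rewrite mulr_sumr mulr_suml; apply: eq_bigr => l _; rewrite !mxE starM starK.
      change (b ** (star (C l i) ** C l j) ** star b =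
        b ** star (C l i) ** (C l j ** star b)).
      by rewrite !cmulA.
    apply/contractive_cnrm => a _; move/contractive_cnrm : c2 => h.
    apply: le_trans (h _ I) _.
    apply: le_trans (nrmM (b ** a : U) (star b : U)) _.
    apply: le_trans (ler_wpM2r (nrm_ge0 _) (nrmM (b : U) (a : U))) _.
    rewrite (nrm_st (b : U)).
    have : nrm (b : U) <= 1 by exact: nb.
    move=> nb1; rewrite mulrAC; apply: ler_piMl; first exact: (nrm_ge0 (a : U)).
    by apply: mulr_ile1 => //; exact: nrm_ge0.
  - by have [_ l3 p3] := phi_cp; split=> // k M /p3 [E _ hE]; exists E.
move=> x xs; pose y : U := b ** x ** star b.
have ys : y \in s1 by exact: map_f.
rewrite hpsi2; last exact: s1B.
have h1 : cnrm (phi (psi (u ** y ** u)) - u ** y ** u) < eps / 2.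
  by rewrite -ltcR -cnrmE; apply: happ; rewrite /s2 /=; exact: map_f.
have h2 := hu y ys.
apply: le_lt_trans (nrm_tri (V := U) _ (u ** y ** u) _) _.
have h2' : nrm ((u ** y ** u : U) - y) < eps / 2 by exact: h2.
have h1' : nrm ((phi (psi (u ** y ** u)) : U) - (u ** y ** u : U)) < eps / 2 by exact: h1.
by rewrite -/y (splitr eps); exact: ltrD h1' h2'.
Qed.

Lemma cnrmZ (c : R[i]) (x : A) : cnrm (c *: x) = complex.Re `|c| * cnrm x.
Proof.
apply: (@complexI R); rewrite rmorphM /= -!cnrmE normrZ.
by congr (_ * _).
Qed.

(** [t] and [d] must not depend on [T], which will be built from them; only the bound [K] is known
    in advance. *)
Lemma span_control (X : set A) (K eps : R) (s : seq A) :
  dense (linear_span X) -> 0 <= K -> 0 < eps ->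
  exists t : seq A, (forall x, x \in t -> X x) /\ exists2 d : R, 0 < d &
    forall T : A -> A, (forall c x y, T (c *: x + y) = c *: T x + T y) ->
      (forall a, cnrm (T a) <= K * cnrm a) ->
      (forall x, x \in t -> cnrm (T x - x) < d) ->
      forall a, a \in s -> cnrm (T a - a) < eps.
Proof.
move=> dX K0 eps0; elim: s => [|a s [t [tX [d d0 ht]]]].
  by exists [::]; split=> //; exists 1 => //.
(* Replacing [a] by [y] costs [K r] inside [T] and [r] outside, together [eps / 2]. *)
pose r := eps / (2 * (K + 1)).
have r0 : 0 < r by rewrite divr_gt0 // mulr_gt0 // ltr_wpDl.
have rK : r * (2 * (K + 1)) = eps by rewrite divfK // gt_eqF // mulr_gt0 // ltr_wpDl.
have r0C : 0 < r%:C%C by rewrite ltcR.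
have [y [ay [n [c [x [hx ye]]]]]] : ball a r%:C%C `&` linear_span X !=set0.
  by apply: dX; [exists a; exact: ballxx|exact: ball_open].
have {}ay : cnrm (a - y) < r by move: ay; rewrite -ball_normE /= cnrmE ltcR.
(* The summand 1 keeps [M] positive when all coefficients vanish. *)
pose M := 1 + \sum_i complex.Re `|c i|.
have Re0 i : 0 <= complex.Re `|c i| by have := normr_ge0 (c i); rewrite lecE => /andP[].
have M1 : 1 <= M by rewrite lerDl; apply: sumr_ge0 => i _.
have M0 : 0 < M by exact: lt_le_trans ltr01 M1.
pose d' := eps / (2 * M).
have d'0 : 0 < d' by rewrite divr_gt0 // mulr_gt0.
exists ([seq x i | i <- enum 'I_n] ++ t); split.
  by move=> z; rewrite mem_cat => /orP[/mapP [i _ ->] //|/tX].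
exists (Num.min d d'); first by rewrite lt_min d0.
move=> T TL TK Tt z; rewrite inE => /orP[/eqP ->{z}|zs]; last first.
  apply: (ht T TL TK) => // w wt.
  by have := Tt w; rewrite mem_cat wt orbT lt_min => /(_ isT) /andP[].
have Tx i : cnrm (T (x i) - x i) <= d'.
  apply: ltW; have := Tt (x i); rewrite mem_cat map_f ?mem_enum // lt_min.
  by move=> /(_ isT) /andP[].
have T0 : T 0 = 0 by have := TL (-1) 0 0; rewrite !scaleN1r !addNr.
have TB u v : T (u - v) = T u - T v.
  by have := TL (-1) v u; rewrite !scaleN1r addrC => ->; rewrite addrC.
have Ty : T y - y = \sum_i c i *: (T (x i) - x i).
  rewrite ye; elim: (index_enum _) => [|i w IH]; first by rewrite !big_nil T0 subr0.
  rewrite !big_cons TL -IH scalerBr opprD; set p := \sum_(_ <- _) _.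
  by rewrite addrACA.
have nTy : cnrm (T y - y) <= (\sum_i complex.Re `|c i|) * d'.
  rewrite Ty; apply: le_trans (nrm_sum (V := U) _ _ _) _; rewrite mulr_suml.
  apply: ler_sum => i _.
  change (cnrm (c i *: (T (x i) - x i)) <= complex.Re `|c i| * d').
  by rewrite cnrmZ ler_wpM2l.
have Md : M * d' = eps / 2 by rewrite /d'; field; rewrite gt_eqF.
have -> : T a - a = (T (a - y) + (T y - y)) + (y - a).
  by rewrite TB !subrKA.
have t1 := nrmD ((T (a - y) + (T y - y)) : U) (y - a : U).
have t2 := nrmD (T (a - y) : U) (T y - y : U).
have t3 : nrm (y - a : U) < r by rewrite nrmC; exact: ay.
have t4 : nrm (T (a - y) : U) <= K * cnrm (a - y) by exact: TK.
have t5 : nrm (T y - y : U) <= (M - 1) * d'.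
  by apply: le_trans nTy _; rewrite /M addrC addKr.
change (nrm ((T (a - y) + (T y - y) + (y - a)) : U) < eps).
have t6 : K * cnrm (a - y) <= K * r by rewrite ler_wpM2l // ltW.
have : r * (K + 1) = eps / 2 by rewrite -rK; field.
nra.
Qed.

End Approximation.

Theorem proposition4p2 (R : realType) (A : cstarAlgType R) (X : set A)
    (d N : nat)
    (A_unital : is_unital A)
    (dense_span : dense (linear_span X))
    (approx : forall (F : set A) (eps : R[i]),
      finite_set F -> F `<=` X -> 0 < eps ->
      exists (B : 'I_d.+1 -> set A) (b : 'I_d.+1 -> A),
        [/\ forall i, is_cstar_subalgebra (B i) /\ nuclear_dim_le N (B i),
            forall i, `|b i| <= 1,
            forall i, [set b i ** x ** star (b i) | x in F] `<=` B i
          & forall x, F x ->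
              `|x - \sum_(i < d.+1) b i ** x ** star (b i)| < eps]) :
  nuclear_dim_le ((d + 1) * (N + 1) - 1)%N [set: A].
Proof.
have [e he] := A_unital.
move=> S eps /finite_seqP [s Ss] _ eps0.
have epsE : eps = (complex.Re eps)%:C%C by rewrite RRe_real // gtr0_real.
have eps0' : 0 < complex.Re eps by rewrite -ltcR -epsE.
(* A dimension counts one less than the number of summands, so exactly (d + 1)(N + 1) of them are
   available. *)
have kE : ((d + 1) * (N + 1) - 1).+1 = (d.+1 * N.+1)%N.
  by rewrite !addn1 subn1 prednK // muln_gt0.
have [t [tX [r r0 ht]]] :=
  span_control he s dense_span (ler0n R (d.+1 * N.+1)) eps0'.
have r2 : 0 < r / 2 by lra.
have r2C : 0 < (r / 2)%:C%C by rewrite ltcR.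
have [||B [b [hB nb bB hb]]] := approx [set` t] _ _ _ r2C.
- by apply/finite_seqP; exists t.
- by move=> x /tX.
(* The [d.+1] compressions together cost [r / 2]; the other half is the error granted by
   [approx]. *)
pose q := r / 2 / d.+1%:R.
have q0 : 0 < q by rewrite divr_gt0.
have hT i : exists T, decomposable N.+1 T /\
    forall x, x \in t -> cnrm (T x - b i ** x ** star (b i)) < q.
  have [sub nuc] := hB i; apply: (compression_decomposable he sub nuc) => //.
  - by have := nb i; rewrite cnrmE -(rmorph1 (real_complex R)) lecR.
  - by move=> x xt; apply: (bB i); exists x.
have [T T_] := choice hT.
have Tdec := decomposable_sum he (fun i => (T_ i).1).
have Tapp x : x \in t -> cnrm (\sum_i T i x - x) < r.
  move=> xt; have h1 := hb x xt; rewrite cnrmE ltcR in h1.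
  have h2 : cnrm (\sum_i T i x - \sum_i b i ** x ** star (b i)) <= r / 2.
    rewrite -sumrB; apply: le_trans (nrm_sum (V := ucs_of he) _ _ _) _.
    apply: (@le_trans _ _ (\sum_(i < d.+1) q)).
      by apply: ler_sum => i _; apply: ltW; exact: (T_ i).2.
    by rewrite sumr_const card_ord -[q *+ _]mulr_natr /q divfK // pnatr_eq0.
  have := nrm_tri (V := ucs_of he) (\sum_i T i x) (\sum_i b i ** x ** star (b i)) x.
  have h1' : nrm ((\sum_i b i ** x ** star (b i) : ucs_of he) - x) < r / 2.
    by rewrite nrmC; exact: h1.
  have h2' : nrm ((\sum_i T i x : ucs_of he) -
      \sum_i b i ** x ** star (b i)) <= r / 2.
    exact: h2.
  move=> h3; apply: (le_lt_trans h3); lra.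
have fin := ht _ (decomposable_linear Tdec) (decomposable_bound he Tdec) Tapp.
move: Tdec; rewrite -kE => -[F [Fj [psi [phi [h1 h2 h3 h4 h5]]]]].
exists F, Fj, psi, phi; split=> // a Sa.
by rewrite h5 epsE cnrmE ltcR; apply: fin; move: Sa; rewrite Ss.
Qed.
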